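(* For any $u\in H^{-1}(\Omega)$, $$F_{\mathrm{D}}^{\#}(u)=\begin{cases}\displaystyle\min_{\mathbf{s}\in Y_{\mathrm{D}}(-u)}\int_{\Omega}\sigma^{\#}(\mathbf{s}(\mathbf{x}))d\mathbf{x}&\text{if }Y_{\mathrm{D}}(-u)\neq\emptyset,\\ \infty&\text{otherwise.}\end{cases}$$ (In particular the minimum is attained when $Y_{\mathrm{D}}(-u)\ne\emptyset$.)
   Context: Let $d\in\mathbb{N}$, $p\in(1,\infty)$, $\mu>0$, and let $\Omega\subset\mathbb{R}^d$ be open and bounded. All functions are real valued. $W^{1,p}_0(\Omega)$ is normed by $\|\nabla\cdot\|_{L^p(\Omega;\mathbb{R}^d)}$ and $H^1_0(\Omega)$ has inner product $\int_\Omega\langle\nabla f,\nabla g\rangle_{\mathbb{R}^d}d\mathbf{x}$. $H^{-1}(\Omega)$ is the topological dual of $H^1_0(\Omega)$, $\langle\cdot,\cdot\rangle$ denotes the duality pairing (in either order), and $-\Delta_{\mathrm{D}}:H^1_0(\Omega)\to H^{-1}(\Omega)$ is the (Riesz) isometry $\langle-\Delta_{\mathrm{D}}f,\phi\rangle=\int_\Omega\langle\nabla f,\nabla\phi\rangle_{\mathbb{R}^d}d\mathbf{x}$. $H^{-1}(\Omega)$ is a Hilbert space with inner product $\langle f,g\rangle_{H^{-1}(\Omega)}=\langle(-\Delta_{\mathrm{D}})^{-1}f,g\rangle$. $X_{\mathrm{D}}$ is the set of $f\in H^{-1}(\Omega)$ for which there exists $\widetilde f\in W^{1,p}_0(\Omega)$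 such that, for every $\phi\in H^1_0(\Omega)$, $\langle f,\phi\rangle=\lim_{n\to\infty}\int_\Omega\widetilde f\phi_n\,d\mathbf{x}$ for any sequence $\{\phi_n\}\subset C_0^\infty(\Omega)$ converging to $\phi$ in $H^1_0(\Omega)$. Such $\widetilde f$ is unique; for $h\in X_{\mathrm{D}}$ the corresponding function is denoted $\widetilde h$. $\sigma:\mathbb{R}^d\to\mathbb{R}$, $\sigma(\mathbf{y})=|\mathbf{y}|+\frac{\mu}{p}|\mathbf{y}|^p$. $F_{\mathrm{D}}:H^{-1}(\Omega)\to\mathbb{R}\cup\{\infty\}$ is $F_{\mathrm{D}}(f)=\int_\Omega\sigma(\nabla\widetilde f(\mathbf{x}))d\mathbf{x}$ if $f\in X_{\mathrm{D}}$ and $F_{\mathrm{D}}(f)=\infty$ otherwise. For a functional $F:H\to\mathbb{R}\cup\{\infty\}$, not identically $\infty$, on a real Hilbert space $H$, its conjugate is $F^{\#}(v)=\sup_{u\in H}\{\langle v,u\rangle_H-F(u)\}$; this defines $F_{\mathrm{D}}^{\#}$ on $H^{-1}(\Omega)$ and $\sigma^{\#}$ on $\mathbb{R}^d$. For $u\in H^{-1}(\Omega)$, $Y_{\mathrm{D}}(u)$ is the set of $\mathbf{s}\in L^{p/(p-1)}(\Omega;\mathbb{R}^d)$ such that $\operatorname{div}\mathbf{s}=(-\Delta_{\mathrm{D}})^{-1}u$ (distributional divergence on $\Omega$; hence $\operatorname{div}\mathbf{s}\in H^1_0(\Omega)$) and $$\langle\operatorname{div}\mathbf{s},h\rangle+\int_\Omega\langle\mathbf{s}(\mathbf{x}),\nabla\widetilde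 h(\mathbf{x})\rangle_{\mathbb{R}^d}d\mathbf{x}=0\quad\forall h\in X_{\mathrm{D}}.$$ *)

(* Defs.v *)
From HB Require Import structures.
From mathcomp Require Import all_boot all_order all_algebra.
From mathcomp Require Import all_classical all_reals all_analysis.

Set Implicit Arguments.
Unset Strict Implicit.
Unset Printing Implicit Defensive.

Import Order.TTheory GRing.Theory Num.Theory.
Import numFieldNormedType.Exports.

Local Open Scope classical_set_scope.
Local Open Scope ring_scope.

Definition rV_display : measure_display.
Proof. exact: default_measure_display. Qed.

Section borel_rV.
Variables (R : realType) (n : nat).

Definition rV_coord (i : 'I_n) (x : 'rV[R]_n) : measurableTypeR R := x ord0 i.

Let rV_measurable : set (set 'rV[R]_n) := g_sigma_preimage rV_coord.

Let rV_set0 : rV_measurable set0.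
Proof. exact: sigma_algebra0. Qed.

Let rV_setC A : rV_measurable A -> rV_measurable (~` A).
Proof. exact: sigma_algebraC. Qed.

Let rV_bigcup (F : (set 'rV[R]_n)^nat) : (forall i, rV_measurable (F i)) ->
  rV_measurable (\bigcup_i F i).
Proof. exact: sigma_algebra_bigcup. Qed.

HB.instance Definition _ := @isMeasurable.Build rV_display
  'rV[R]_n rV_measurable rV_set0 rV_setC rV_bigcup.

Lemma measurable_rV_coord (i : 'I_n) : measurable_fun [set: 'rV[R]_n] (rV_coord i).
Proof.
move=> _ Y mY; rewrite setTI; apply: sub_sigma_algebra => /=.
rewrite -bigcup_seq/=; exists i => /=; first by rewrite mem_index_enum.
by exists Y => //; rewrite setTI.
Qed.

Lemma measurable_fun_rV d (T : measurableType d) (f : T -> 'rV[R]_n) :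
  (forall i, measurable_fun [set: T] (rV_coord i \o f)) ->
  measurable_fun [set: T] f.
Proof.
move=> mf.
have pre : g_sigma_preimage (fun i => rV_coord i \o f) `<=` measurable.
  apply: smallest_sub; first exact: sigma_algebra_measurable.
  rewrite -bigcup_seq; apply: bigcup_sub => i _.
  by move=> A [B mB <-]; exact: mf.
by move: pre; rewrite g_sigma_preimage_comp => pre _ A mA; apply: pre; exists A.
Qed.

End borel_rV.

Lemma rV_measurableE (R : realType) n :
  @measurable _ 'rV[R]_n = <<s @open 'rV[R]_n >>.
Proof.
apply/seteqP; split; last first.
  apply: smallest_sub; first exact: sigma_algebra_measurable.
  move=> A oA.
  pose box (ab : 'rV[rat]_n * 'rV[rat]_n) : set 'rV[R]_n :=
    [set x | forall i, ratr (ab.1 ord0 i) < x ord0 i < ratr (ab.2 ord0 i)].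
  rewrite (_ : A = \bigcup_(ab in [set: 'rV[rat]_n * 'rV[rat]_n])
      (if `[< box ab `<=` A >] then box ab else set0)).
    apply: countable_bigcupT_measurable => [|ab]; first exact: countableP.
    case: ifPn => // _.
    rewrite (_ : box ab = \bigcap_(i in [set: 'I_n]) (@rV_coord R n i @^-1`
        `]ratr (ab.1 ord0 i), ratr (ab.2 ord0 i)[)).
      apply: fin_bigcap_measurable => // i _.
      rewrite -[X in measurable X]setTI; apply: measurable_rV_coord => //.
    apply/seteqP; split => y /= h i.
      by move=> _; rewrite /= in_itv; exact: h.
    by have := h i I; rewrite /= in_itv.
  apply/seteqP; split => [x Ax|x [ab _]]; last by case: asboolP => // + ?; exact.
  have /nbhs_ballP[e /= e0 eA] : nbhs x A by apply: open_nbhs_nbhs.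
  have h1 i : {q : rat | x ord0 i - e < ratr q < x ord0 i}.
    apply: cid; have [|q] := @rat_in_itvoo R (x ord0 i - e) (x ord0 i).
      by rewrite ltrBlDr ltrDl.
    by rewrite in_itv => ?; exists q.
  have h2 i : {q : rat | x ord0 i < ratr q < x ord0 i + e}.
    apply: cid; have [|q] := @rat_in_itvoo R (x ord0 i) (x ord0 i + e).
      by rewrite ltrDl.
    by rewrite in_itv => ?; exists q.
  exists (\row_i sval (h1 i), \row_i sval (h2 i)) => //.
  case: asboolP => [_ i|nA]; rewrite /= ?mxE.
    by case: (h1 i) => a /= /andP[_ ->]; case: (h2 i) => b /= /andP[-> _].
  exfalso; apply: nA => y /= ybox; apply: eA; split => // i j; rewrite ord1.
  have := ybox j; rewrite !mxE.
  case: (h1 j) => a /= /andP[ea _]; case: (h2 j) => b /= /andP[_ be] /andP[ay yb].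
  rewrite /ball/= ltr_distlC; apply/andP; split.
    exact: lt_trans ay.
  exact: lt_trans be.
apply: smallest_sub; first exact: smallest_sigma_algebra.
rewrite -bigcup_seq; apply: bigcup_sub => i _ B [C mC <-]; rewrite setTI.
have : measurable_fun [set: g_sigma_algebraType (@open 'rV[R]_n)]
    (@rV_coord R n i : _ -> measurableTypeR R).
  apply: (measurability _ (@measurable_realfun.RGenOpens.measurableE R)).
  move=> _ [_ [a [b ->]] <-]; rewrite setTI; apply: sub_sigma_algebra.
  have /continuousP : continuous (fun M : 'rV[R]_n => M ord0 i).
    exact: coord_continuous.
  by apply; exact: interval_open.
by move=> /(_ measurableT _ mC); rewrite setTI.
Qed.

Section lebesgue_rV.
Variable R : realType.

Definition rV_cons n (xy : measurableTypeR R * 'rV[R]_n) : 'rV[R]_n.+1 :=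
  row_mx (xy.1)%:M xy.2.

Definition rV_uncons n (v : 'rV[R]_n.+1) : measurableTypeR R * 'rV[R]_n :=
  (v ord0 ord0, \row_i v ord0 (lift ord0 i)).

Lemma rV_consK n : cancel (@rV_cons n) (@rV_uncons n).
Proof.
move=> [x y]; rewrite /rV_uncons /rV_cons /=; congr (_, _).
  have -> : (ord0 : 'I_n.+1) = lshift n (ord0 : 'I_1) by exact/val_inj.
  by rewrite (@row_mxEl _ 1 1 n) mxE eqxx.
apply/rowP => i; rewrite mxE.
have -> : lift ord0 i = rshift 1 i by exact/val_inj.
by rewrite (@row_mxEr _ 1 1 n).
Qed.

Lemma measurable_rV_cons n : measurable_fun [set: _] (@rV_cons n).
Proof.
apply: measurable_fun_rV => i; case: (@split_ordP 1 n i) => j ->.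
  rewrite [X in measurable_fun _ X](_ : _ = fst) //.
  by apply/funext => -[x y]; rewrite /rV_coord /rV_cons/= (@row_mxEl _ 1 1 n) !ord1 mxE eqxx.
rewrite [X in measurable_fun _ X](_ : _ = @rV_coord R n j \o snd).
  by apply: measurableT_comp => //; exact: measurable_rV_coord.
by apply/funext => -[x y]; rewrite /rV_coord /rV_cons/= (@row_mxEr _ 1 1 n).
Qed.

Lemma measurable_rV_uncons n : measurable_fun [set: _] (@rV_uncons n).
Proof.
apply: measurable_fun_pair; first exact: (@measurable_rV_coord R n.+1 ord0).
apply: measurable_fun_rV => i.
rewrite [X in measurable_fun _ X](_ : _ = rV_coord (lift ord0 i)).
  exact: measurable_rV_coord.
by apply/funext => v; rewrite /rV_coord /= mxE.
Qed.

Section step.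
Variables (n : nat) (m : {sigma_finite_measure set 'rV[R]_n -> \bar R}).

Definition lebesgue_rV_step : set 'rV[R]_n.+1 -> \bar R :=
  pushforward (@lebesgue_measure R \x m)%E (@rV_cons n).

HB.instance Definition _ := Measure.copy lebesgue_rV_step
  (measure_function_pushforward__canonical__measure_function_Measure
     (@lebesgue_measure R \x m)%E (@measurable_rV_cons n)).

Let lebesgue_rV_step_sigma_finite : sigma_finite [set: _] lebesgue_rV_step.
Proof.
have /sigma_finiteP[F [TF ndF Foo]] := sigma_finiteT (@lebesgue_measure R).
have /sigma_finiteP[G [TG ndG Goo]] := sigma_finiteT m.
exists (fun k => @rV_uncons n @^-1` (F k `*` G k)).
  apply/esym; rewrite -subTset => v _.
  suff : (\bigcup_k (F k `*` G k)) (rV_uncons v) by [].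
  case: (rV_uncons v) => x y.
  have [k _ Fkx] : (\bigcup_k F k) x by rewrite -TF.
  have [l _ Gly] : (\bigcup_k G k) y by rewrite -TG.
  exists (maxn k l) => //; split.
    by move: x Fkx; exact/subsetPset/ndF/leq_maxl.
  by move: y Gly; exact/subsetPset/ndG/leq_maxr.
move=> k; have [mFk Fkoo] := Foo k; have [mGk Gkoo] := Goo k; split.
  rewrite -[X in measurable X]setTI; apply: measurable_rV_uncons => //.
  exact: measurableX.
rewrite /lebesgue_rV_step /pushforward -comp_preimage.
rewrite (_ : _ \o _ = id) ?preimage_id.
  by rewrite product_measure1E// lte_mul_pinfty// ge0_fin_numE.
by apply/funext => x /=; rewrite rV_consK.
Qed.

HB.instance Definition _ := @Measure_isSigmaFinite.Build _ _ _
  lebesgue_rV_step lebesgue_rV_step_sigma_finite.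

End step.

(* Lebesgue measure on R^n as an iterated product measure; [lebesgue_rV_box]
   below gives its values on boxes. *)
Fixpoint lebesgue_rV n : {sigma_finite_measure set 'rV[R]_n -> \bar R} :=
  match n with
  | 0 => @dirac _ 'rV[R]_0 0 R
  | n'.+1 => lebesgue_rV_step (lebesgue_rV n')
  end.

Lemma lebesgue_rV_box n (A : 'I_n -> set (measurableTypeR R)) :
  (forall i, measurable (A i)) ->
  lebesgue_rV n [set x : 'rV[R]_n | forall i, A i (x ord0 i)] =
  (\prod_(i < n) lebesgue_measure (A i))%E.
Proof.
elim: n A => [|n IH] A mA.
  rewrite big_ord0 /= diracE mem_set//; by case.
have mB : measurable [set y : 'rV[R]_n | forall i, A (lift ord0 i) (y ord0 i)].
  rewrite (_ : [set _ | _] =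
      \bigcap_(i in [set: 'I_n]) (rV_coord i @^-1` A (lift ord0 i))).
    apply: fin_bigcap_measurable => // i _.
    by rewrite -[X in measurable X]setTI; exact: measurable_rV_coord.
  by apply/seteqP; split => y /= h i => [_|]; exact: h.
rewrite big_ord_recl /= /lebesgue_rV_step /pushforward.
rewrite (_ : _ @^-1` _ = A ord0 `*`
    [set y : 'rV[R]_n | forall i, A (lift ord0 i) (y ord0 i)]).
  by rewrite product_measure1E//= (IH (fun i => A (lift ord0 i))).
apply/seteqP; split => -[x y] /=.
  move=> h; have [+ ?] := (rV_consK (x, y), h).
  rewrite /rV_uncons => -[x0 y0]; split=> [|i]; first by rewrite -x0; exact: h.
  by rewrite -y0 mxE; exact: h.
move=> [Ax Ay] i; have := rV_consK (x, y); rewrite /rV_uncons => -[x0 y0].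
case: (unliftP ord0 i) => [j ->|->]; last by rewrite x0.
by have := Ay j; rewrite -[in X in X -> _]y0 mxE.
Qed.

End lebesgue_rV.

Section euclidean.
Variables (R : realType) (d : nat).
Implicit Types x y : 'rV[R]_d.

Definition dotv x y : R := \sum_(i < d) x ord0 i * y ord0 i.

(* The norm of the normed module 'rV[R]_d is the sup norm; only its topology
   and its bounded sets are used, lengths of vectors are measured by [enorm]. *)
Definition enorm x : R := Num.sqrt (dotv x x).

End euclidean.

Definition conjugate (R : realType) (T : Type) (H : set T) (ip : T -> T -> R)
    (F : T -> \bar R) (v : T) : \bar R :=
  ereal_sup [set ((ip v u)%:E - F u)%E | u in H].

Section spaces.
Variables (R : realType) (d : nat) (Omega : set 'rV[R]_d).
Local Notation V := 'rV[R]_d.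
Local Notation lam := (lebesgue_rV R d).
Implicit Types (f g phi : V -> R) (p : R).

Definition partial (i : 'I_d) f : V -> R := 'D_(delta_mx ord0 i) f.

Definition iter_partial (s : seq 'I_d) f : V -> R := foldr partial f s.

Definition smooth f :=
  forall s : seq 'I_d, continuous (iter_partial s f) /\
    forall i x, derivable (iter_partial s f) x (delta_mx ord0 i).

Definition support f : set V := closure [set x | f x != 0].

Definition test_fun f :=
  [/\ smooth f, compact (support f) & support f `<=` Omega].

Definition grad f (x : V) : V := \row_i partial i f x.

(* Elements of the function spaces are represented by functions on the whole of
   R^d, of which only the restriction to Omega (up to null sets) matters. *)
Definition Lp p : set (V -> R) :=
  [set f | f \_ Omega \in Lfun lam p%:E].

Definition Lp_norm p f : \bar R := ('N[lam]_p%:E[EFin \o (f \_ Omega)])%E.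

Definition LpV p : set (V -> V) :=
  [set G | measurable_fun Omega G /\ Lp p (fun x => enorm (G x))].

Definition LpV_norm p (G : V -> V) : \bar R := Lp_norm p (fun x => enorm (G x)).

Definition is_wgrad f (G : V -> V) :=
  forall phi, test_fun phi -> forall i : 'I_d,
    \int[lam]_(x in Omega) (f x * partial i phi x) =
    - \int[lam]_(x in Omega) (G x ord0 i * phi x).

Definition is_wdiv (s : V -> V) f :=
  forall phi, test_fun phi ->
    \int[lam]_(x in Omega) dotv (s x) (grad phi x) =
    - \int[lam]_(x in Omega) (f x * phi x).

Definition W1p p : set (V -> R) :=
  [set f | Lp p f /\ exists2 G, LpV p G & is_wgrad f G].

(* The weak gradient of an element of W^{1,p}; a representative is chosen, which
   is unique up to null sets. *)
Definition wgrad p f : V -> V := get [set G | LpV p G /\ is_wgrad f G].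

(* W^{1,p}_0 is the closure of the test functions in W^{1,p}. *)
Definition W1p0 p : set (V -> R) :=
  [set f | W1p p f /\ exists2 phi : (V -> R)^nat,
     forall n, test_fun (phi n) &
     (fun n => Lp_norm p (fun x => phi n x - f x)) @ \oo --> 0%E /\
     (fun n => LpV_norm p (fun x => grad (phi n) x - wgrad p f x))
       @ \oo --> 0%E].

Definition H10 : set (V -> R) := W1p0 2.

Definition H10_inner f g : R :=
  \int[lam]_(x in Omega) dotv (wgrad 2 f x) (wgrad 2 g x).

Definition H10_norm f : R := fine (LpV_norm 2 (wgrad 2 f)).

(* H^{-1}: bounded linear functionals on H^1_0. Boundedness forces such a
   functional to agree on functions that are equal almost everywhere on Omega;
   its values outside of H^1_0 are never used. *)
Definition Hm1 : set ((V -> R) -> R) :=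
  [set u | (forall a f g, H10 f -> H10 g ->
              u (fun x => a * f x + g x) = a * u f + u g) /\
           exists C : R, forall f, H10 f -> `|u f| <= C * H10_norm f].

Definition mlapD f : (V -> R) -> R := H10_inner f.

Definition inv_mlapD (u : (V -> R) -> R) : V -> R :=
  get [set f | H10 f /\ forall phi, H10 phi -> mlapD f phi = u phi].

Definition Hm1_inner (u v : (V -> R) -> R) : R := v (inv_mlapD u).

Definition is_tilde p (u : (V -> R) -> R) f :=
  W1p0 p f /\
  forall phi, H10 phi -> forall phin : (V -> R)^nat,
    (forall n, test_fun (phin n)) ->
    (fun n => H10_norm (fun x => phin n x - phi x)) @ \oo --> (0 : R) ->
    (fun n => \int[lam]_(x in Omega) (f x * phin n x)) @ \oo --> u phi.

Definition XD p : set ((V -> R) -> R) :=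
  [set u | Hm1 u /\ exists f, is_tilde p u f].

Definition tilde p (u : (V -> R) -> R) : V -> R := get (is_tilde p u).

End spaces.

Section functionals.
Variables (R : realType) (d : nat) (p mu : R) (Omega : set 'rV[R]_d).
Local Notation V := 'rV[R]_d.
Local Notation lam := (lebesgue_rV R d).

Definition sigma (y : V) : R := enorm y + mu / p * (enorm y `^ p).

Definition sigma_conj : V -> \bar R :=
  conjugate [set: V] (@dotv R d) (EFin \o sigma).

Definition FD (u : (V -> R) -> R) : \bar R :=
  if `[< XD Omega p u >]
  then (\int[lam]_(x in Omega) (sigma (wgrad Omega p (tilde Omega p u) x))%:E)%E
  else +oo%E.

Definition FD_conj : ((V -> R) -> R) -> \bar R :=
  conjugate (Hm1 Omega) (Hm1_inner Omega) FD.

(* [inv_mlapD Omega u] is the distributional divergence of s, so the first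
   summand of the last condition is the pairing of h in H^{-1} with div s in
   H^1_0. *)
Definition YD (u : (V -> R) -> R) : set (V -> V) :=
  [set s | [/\ LpV Omega (p / (p - 1)) s,
     is_wdiv Omega s (inv_mlapD Omega u) &
     forall h, XD Omega p h ->
       h (inv_mlapD Omega u) +
       \int[lam]_(x in Omega)
         dotv (s x) (wgrad Omega p (tilde Omega p h) x) = 0]].

Definition sigma_conj_int (s : V -> V) : \bar R :=
  (\int[lam]_(x in Omega) sigma_conj (s x))%E.

End functionals.

Definition is_min (R : realType) (T : Type) (A : set T) (F : T -> \bar R)
    (m : \bar R) :=
  (exists2 s, A s & F s = m) /\ forall s, A s -> (m <= F s)%E.

(* Main.v *)
From HB Require Import structures.
Require Import Defs.
From mathcomp Require Import all_boot all_order all_algebra ring lra.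
From mathcomp Require Import all_classical all_reals all_analysis.
From mathcomp Require Import measurable_realfun.

(** The formula is Fenchel duality between the energy, the integral of
    sigma(grad h~) over h in X_D, and the integral of the pointwise conjugate
    sigma#.  Put w = (-Delta)^{-1} u.  Then F#(u) is the supremum over h in X_D
    of h(w) - int sigma(grad h~), and a field s of L^q, with q = p/(p-1), lies in
    Y_D(-u) when div s = -w and h(w) = int s . grad h~ for all h in X_D.

    Weak duality ([weak_duality]): for such an s, integrating the pointwise
    inequality s . y <= sigma(y) + sigma#(s) along y = grad h~ bounds
    h(w) - int sigma(grad h~) by int sigma#(s).

    Strong duality ([strong_duality]): let M = F#(u) be finite.  On the space of
    all gradients grad h~ the linear functional grad h~ |-> h(w) is at most
    M + int sigma(grad h~).  The bound is a convex function of the field, so by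
    Hahn-Banach ([hahn_banach_convex]) the functional extends to a linear
    functional L on all p-integrable fields with L(G) <= M + int sigma(G).  Such
    an L is integration against a field s with int sigma#(s) <= M
    ([dual_representation]).  Indeed, replacing G by t G with t large turns the
    bound into continuity of L under dominated pointwise convergence
    ([order_continuous]).  Hence A |-> L(1_A e_i) is a charge without mass on null
    sets, whose Radon-Nikodym density is the i-th component of s
    ([coord_density]), and L is integration against s on bounded fields.  The
    supremum that defines sigma#(s) is attained at an explicit vector
    ([maximizerP]); testing the bound on L with truncations of this maximizer
    yields int sigma#(s) <= M.  Since sigma# grows like the q-th power
    ([sconj_coercive]), s is in L^q, and truncating G extends the representation
    to all G.  Finally s is in Y_D(-u): the condition on X_D is the definition of
    L on gradients, and it contains div s = -w because every test function is
    the h~ of a functional in X_D ([XD_test]).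

    Consequently F#(u) is finite exactly when Y_D(-u) is nonempty, and then s
    attains the minimum.

    The objects themselves require some classical theory.  Weak gradients and
    the functions h~ are determined up to null sets by the fundamental lemma
    ([fundamental_lemma]), which tests against smooth approximations of
    indicators of boxes.  Integration by parts for test functions reduces to the
    translation invariance of Lebesgue measure ([integral_partial0]).  The
    function w exists by the Riesz theorem ([riesz_H10]), proved by minimizing the
    Dirichlet energy over test functions: minimizing sequences are Cauchy,
    Poincare's inequality ([poincare]) controls the functions by their gradients,
    and the Riesz-Fischer theorem ([L2_fast_cauchy]) provides the limit. *)

Import Order.TTheory GRing.Theory Num.Theory.
Import numFieldNormedType.Exports.

Set Implicit Arguments.
Unset Strict Implicit.
Unset Printing Implicit Defensive.

Local Open Scope classical_set_scope.
Local Open Scope ring_scope.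

(** * Boxes, Borel sets and translations *)

Section boxes.
Variables (R : realType) (d : nat).
Local Notation V := 'rV[R]_d.
Local Notation lam := (lebesgue_rV R d).

Lemma open_measurable_rV (A : set V) : open A -> measurable A.
Proof. by move=> oA; rewrite rV_measurableE; exact: sub_sigma_algebra. Qed.

Lemma continuous_measurable_rV (f : V -> R) : continuous f -> measurable_fun [set: V] f.
Proof.
move=> /continuousP cf; apply: (measurability _ (@measurable_realfun.RGenOpens.measurableE R)).
move=> _ [_ [a [b ->]] <-]; rewrite setTI; apply: open_measurable_rV; apply: cf.
exact: interval_open.
Qed.

Definition obox (a b : V) : set V := [set x | forall i, a ord0 i < x ord0 i < b ord0 i].

Lemma oboxE a b : obox a b = [set x | forall i, `]a ord0 i, b ord0 i[%classic (x ord0 i)].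
Proof. by apply/seteqP; split => x /= h i; have := h i; rewrite in_itv. Qed.

Lemma measurable_obox a b : measurable (obox a b).
Proof.
have -> : obox a b = \bigcap_(i in [set: 'I_d]) (@rV_coord R d i @^-1`
    `]a ord0 i, b ord0 i[).
  by rewrite oboxE; apply/seteqP; split => y /= h i => [_|]; exact: h.
apply: fin_bigcap_measurable => // i _.
by rewrite -[X in measurable X]setTI; apply: measurable_rV_coord.
Qed.

Lemma lebesgue_obox a b : lam (obox a b) =
  (\prod_(i < d) (if a ord0 i < b ord0 i then b ord0 i - a ord0 i else 0)%:E)%E.
Proof.
rewrite oboxE (@lebesgue_rV_box R d (fun i => `]a ord0 i, b ord0 i[%classic)) //.
apply: eq_bigr => i _; rewrite lebesgue_measure_itv /= lte_fin -EFinB.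
by case: ifP.
Qed.

Lemma lebesgue_obox_fin a b : (lam (obox a b) < +oo)%E.
Proof. by rewrite lebesgue_obox prodEFin ltry. Qed.

Lemma oboxI a b a' b' : obox a b `&` obox a' b' =
  obox (\row_i Num.max (a ord0 i) (a' ord0 i)) (\row_i Num.min (b ord0 i) (b' ord0 i)).
Proof.
apply/seteqP; split => [x [h h'] i|x h]; first by rewrite !mxE gt_max lt_min andbACA (h i) (h' i).
by split => i; have := h i; rewrite !mxE gt_max lt_min => /andP[/andP[? ?] /andP[? ?]]; apply/andP.
Qed.

Definition cbox (a b : V) : set V := [set x | forall i, a ord0 i <= x ord0 i <= b ord0 i].

Definition ratv (q : 'rV[rat]_d) : V := \row_i ratr (q ord0 i).

(** Rational corners make the union countable.  It is the closed boxes
    that are required to lie in A, so that a bump on one of these open boxes has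
    its support in A. *)
Lemma open_bigcup_obox (A : set V) : open A ->
  A = \bigcup_(ab in [set ab : 'rV[rat]_d * 'rV[rat]_d | cbox (ratv ab.1) (ratv ab.2) `<=` A])
      obox (ratv ab.1) (ratv ab.2).
Proof.
move=> oA; apply/seteqP; split => [x Ax|x [ab abA abx]]; last first.
  by apply: abA => i; move: (abx i) => /andP[/ltW -> /ltW ->].
have /nbhs_ballP[e /= e0 eA] : nbhs x A by apply: open_nbhs_nbhs.
have h1 i : {q : rat | x ord0 i - e < ratr q < x ord0 i}.
  apply: cid; have [|q] := @rat_in_itvoo R (x ord0 i - e) (x ord0 i).
    by rewrite ltrBlDr ltrDl.
  by rewrite in_itv => ?; exists q.
have h2 i : {q : rat | x ord0 i < ratr q < x ord0 i + e}.
  apply: cid; have [|q] := @rat_in_itvoo R (x ord0 i) (x ord0 i + e).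
    by rewrite ltrDl.
  by rewrite in_itv => ?; exists q.
exists (\row_i sval (h1 i), \row_i sval (h2 i)) => /=; last first.
  move=> i; rewrite !mxE.
  by case: (h1 i) => a /= /andP[_ ->]; case: (h2 i) => b /= /andP[-> _].
move=> y ybox; apply: eA; split => // i j; rewrite ord1.
have := ybox j; rewrite !mxE.
case: (h1 j) => a /= /andP[ea _]; case: (h2 j) => b /= /andP[_ be] /andP[ay yb].
rewrite /ball/= ltr_distlC; apply/andP; split.
  exact: lt_le_trans ay.
exact: le_lt_trans be.
Qed.

Definition oboxes : set (set V) := [set A | exists a b, A = obox a b].

(** Boxes form a pi-system that generates the Borel sets, so that
    uniqueness of measures and Dynkin arguments only concern boxes. *)
Lemma measurable_rV_obox : @measurable _ V = <<s oboxes >>.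
Proof.
apply/seteqP; split.
  rewrite rV_measurableE; apply: smallest_sub; first exact: smallest_sigma_algebra.
  move=> A oA; rewrite (open_bigcup_obox oA).
  rewrite [X in <<s _ >> X](_ : _ = \bigcup_(ab in [set: 'rV[rat]_d * 'rV[rat]_d])
    (if `[< cbox (ratv ab.1) (ratv ab.2) `<=` A >] then obox (ratv ab.1) (ratv ab.2) else set0)).
    apply: (@countable_bigcupT_measurable _ (g_sigma_algebraType oboxes)) => [|ab].
      exact: countableP.
    case: ifPn => // _; apply: sub_sigma_algebra.
    by exists (ratv ab.1), (ratv ab.2).
  apply/seteqP; split => x [ab /=].
    by move=> h hx; exists ab => //; case: asboolP.
  by move=> _; case: asboolP => // ? ?; exists ab.
apply: smallest_sub; first exact: sigma_algebra_measurable.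
by move=> A [a [b ->]]; exact: measurable_obox.
Qed.

Lemma setI_closed_oboxes : setI_closed oboxes.
Proof. by move=> A B [a [b ->]] [a' [b' ->]]; rewrite oboxI; eexists; eexists. Qed.

Lemma obox_cover : \bigcup_k obox (const_mx (- k%:R)) (const_mx k%:R) = [set: V].
Proof.
apply/seteqP; split => // x _.
have [k xk] : exists k : nat, `|x| < k%:R.
  by exists (Num.bound `|x|); rewrite archi_boundP.
exists k => // i; rewrite !mxE -ltr_norml.
rewrite (le_lt_trans _ xk)// [leRHS]mx_normrE.
by apply: (le_trans _ (le_bigmax _ _ (ord0, i))).
Qed.

Lemma obox_measure_unique (m1 m2 : {measure set V -> \bar R}) :
  (forall a b, m1 (obox a b) = m2 (obox a b)) ->
  (forall a b, m1 (obox a b) < +oo)%E ->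
  forall A, measurable A -> m1 A = m2 A.
Proof.
move=> m12 m1oo; apply: (measure_unique oboxes (fun k => obox (const_mx (- k%:R)) (const_mx k%:R))).
- exact: measurable_rV_obox.
- exact: setI_closed_oboxes.
- by move=> k; eexists; eexists.
- exact: obox_cover.
- by move=> A [a [b ->]].
- by move=> k.
Qed.

Lemma measurable_shift (v : V) : measurable_fun [set: V] (fun x => x + v).
Proof.
apply: measurable_fun_rV => i.
rewrite [X in measurable_fun _ X](_ : _ = (fun x => rV_coord i x + v ord0 i)).
  apply: measurable_funD => //; exact: measurable_rV_coord.
by apply/funext => x; rewrite /rV_coord /= mxE.
Qed.

(** Translations preserve the side lengths of boxes, and a measure is
    determined by its values on boxes. *)
Lemma lebesgue_shift (v : V) A : measurable A ->
  pushforward lam (fun x : V => x + v) A = lam A.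
Proof.
move=> mA; apply/esym.
pose m2 := measure_function_pushforward__canonical__measure_function_Measure lam (measurable_shift v).
rewrite (obox_measure_unique (m2 := m2)) //.
  move=> a b; rewrite /m2 /= /pushforward.
  rewrite (_ : _ @^-1` _ = obox (a - v) (b - v)).
    rewrite !lebesgue_obox; apply: eq_bigr => i _; rewrite !mxE ltrD2r; congr (if _ then _ else _)%:E.
    by rewrite opprD opprK addrACA addNr addr0.
  by apply/seteqP; split => x /= h i; have := h i; rewrite !mxE ltrBlDr ltrBrDr.
exact: lebesgue_obox_fin.
Qed.

Lemma integral_shift (v : V) (f : V -> R) : lam.-integrable setT (EFin \o f) ->
  lam.-integrable setT (fun x : V => (f (x + v))%:E) /\
  (\int[lam]_x (f (x + v)%R)%:E = \int[lam]_x (f x)%:E)%E.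
Proof.
move=> intf.
have mf : measurable_fun setT f by apply/measurable_EFinP; exact: measurable_int intf.
have e (g : V -> \bar R) : (forall x, 0 <= g x)%E -> measurable_fun setT g ->
    (\int[lam]_x g (x + v)%R = \int[lam]_x g x)%E.
  move=> g0 mg.
  have := @ge0_integral_pushforward _ _ _ _ _ _ (measurable_shift v) lam setT g measurableT mg (fun x _ => g0 x).
  rewrite preimage_setT /= => <-.
  apply: eq_measure_integral; first exact: measurable_shift. move=> ? A mA ?; exact: lebesgue_shift.
have mfv : measurable_fun setT (fun x : V => (f (x + v))%:E).
  apply/measurable_EFinP; apply: (measurableT_comp (f := f)) => //.
  exact: measurable_shift.
split.
  apply/integrableP; split => //.
  move/integrableP : intf => [_].
  rewrite -(e (fun x => `|(f x)%:E|)%E) //.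
  by apply: measurableT_comp => //; exact/measurable_EFinP.
rewrite integralE [RHS]integralE.
have mfE : measurable_fun setT (EFin \o f) by exact/measurable_EFinP.
congr (_ - _)%E.
  have := e (EFin \o f)^\+%E; move=> /(_ (fun=> funepos_ge0 _ _)).
  move=> /(_ (measurable_funepos mfE)) h; apply: etrans (etrans h _).
    by apply: eq_integral => x _; rewrite !funeposE.
  by apply: eq_integral => x _; rewrite !funeposE.
have := e (EFin \o f)^\-%E; move=> /(_ (fun=> funeneg_ge0 _ _)).
move=> /(_ (measurable_funeneg mfE)) h; apply: etrans (etrans h _).
  by apply: eq_integral => x _; rewrite !funenegE.
by apply: eq_integral => x _; rewrite !funenegE.
Qed.

Lemma bounded_set_lam (A : set V) : measurable A -> bounded_set A -> (lam A < +oo)%E.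
Proof.
move=> mA [M [_ hM]].
have AB : A `<=` obox (const_mx (- (`|M| + 2))) (const_mx (`|M| + 2)).
  move=> x Ax i; rewrite !mxE -ltr_norml.
  have xM : `|x| <= `|M| + 1 by apply: (hM (`|M| + 1)) => //; rewrite ltr_pwDr// ler_norm.
  apply: (@le_lt_trans _ _ `|x|); last by rewrite (le_lt_trans xM)// ltrD2l ltr1n.
  rewrite [leRHS]mx_normrE.
  by apply: (le_trans _ (le_bigmax _ _ (ord0, i))).
apply: le_lt_trans (lebesgue_obox_fin _ _).
by apply: le_measure AB; rewrite inE //; exact: measurable_obox.
Qed.

End boxes.

(** * Integrals of derivatives of compactly supported functions *)

Section integral_tools.
Context dd (T : measurableType dd) (R : realType) (mu : {measure set T -> \bar R}).
Variables (D : set T) (mD : measurable D).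

Lemma integrable_measurable (f : T -> R) : mu.-integrable D (EFin \o f) ->
  measurable_fun D f.
Proof. by move=> h; apply/measurable_EFinP; exact: measurable_int h. Qed.

Lemma integrable_le (f g : T -> R) : measurable_fun D f ->
  mu.-integrable D (EFin \o g) -> (forall x, D x -> `|f x| <= g x) ->
  mu.-integrable D (EFin \o f).
Proof.
move=> mf ig fg; apply: (le_integrable _ _ _ ig) => //; first exact/measurable_EFinP.
by move=> x Dx /=; rewrite lee_fin (le_trans (fg _ Dx))// ler_norm.
Qed.

Lemma Rintegral_dominated_cvg (f_ : nat -> T -> R) (f g : T -> R) :
  (forall n, measurable_fun D (f_ n)) ->
  (forall x, D x -> f_ ^~ x @ \oo --> f x) ->
  mu.-integrable D (EFin \o g) ->
  (forall n x, D x -> `|f_ n x| <= g x) ->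
  mu.-integrable D (EFin \o f) /\
  (fun n => \int[mu]_(x in D) f_ n x) @ \oo --> \int[mu]_(x in D) f x.
Proof.
move=> mf_ f_f ig f_g.
have mf : measurable_fun D f by exact: (measurable_fun_cvg mf_).
have [| | | | |? _ h] := @dominated_convergence _ T R mu D mD (fun n => EFin \o f_ n) (EFin \o f) (EFin \o g).
- by move=> n; apply/measurable_EFinP.
- exact/measurable_EFinP.
- by apply: aeW => x Dx; apply: cvg_EFin; [exact: nearW|exact: f_f].
- by [].
- by apply: aeW => x n Dx; rewrite /= lee_fin f_g.
split => //; rewrite /Rintegral; apply: fine_cvg.
rewrite fineK//; exact: integrable_fin_num.
Qed.

Lemma integrable_indic_lty (A : set T) : measurable A -> (mu A < +oo)%E ->
  mu.-integrable setT (fun x => (\1_A x : R)%:E).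
Proof.
move=> mA Aoo; apply/integrableP; split; first exact/measurable_EFinP.
rewrite (eq_integral (fun x => (\1_A x : R)%:E)); last first.
  by move=> x _; rewrite gee0_abs// lee_fin.
by rewrite integral_indic// setIT.
Qed.

End integral_tools.

Section compact_support.
Variables (R : realType) (d : nat).
Local Notation V := 'rV[R]_d.
Local Notation lam := (lebesgue_rV R d).
Implicit Types f psi : V -> R.

(** A quantified form of compact support; the norm is the sup norm. *)
Definition vanish_off (M : R) f := forall x : V, M < `|x| -> f x = 0.

Lemma bounded_vanish_off M f : continuous f -> vanish_off M f ->
  exists2 B : R, 0 <= B & forall x, `|f x| <= B.
Proof.
move=> cf vf.
have cK : compact [set x : V | `|x| <= M].
  apply: bounded_closed_compact.
    by exists M; split; [exact: num_real|move=> N MN x /= xM; rewrite (le_trans xM)// ltW].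
  rewrite (_ : [set _ | _] = (fun x : V => `|x|) @^-1` [set y | y <= M]) //.
  apply: preimage_closed; last exact: closed_le.
  by move=> x _; exact: norm_continuous.
have /compact_bounded[B [_ hB]] : compact (f @` [set x : V | `|x| <= M]).
  by apply: continuous_compact => //; exact: continuous_subspaceT.
exists (`|B| + 1) => [|x]; first by rewrite addr_ge0.
have [xM|xM] := leP `|x| M.
  by apply: (hB (`|B| + 1)); [rewrite ltr_pwDr// ler_norm|exists x].
by rewrite vf// normr0 addr_ge0.
Qed.

Lemma ball_obox M (x : V) : `|x| <= M -> obox (const_mx (- (M + 1))) (const_mx (M + 1)) x.
Proof.
move=> xM i; rewrite !mxE -ltr_norml (@le_lt_trans _ _ M)// ?ltrDl//.
rewrite (le_trans _ xM)// [leRHS]mx_normrE.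
by apply: (le_trans _ (le_bigmax _ _ (ord0, i))).
Qed.

Lemma integrable_bounded_vanish_off M B f : measurable_fun setT f ->
  vanish_off M f -> (forall x, `|f x| <= B) -> lam.-integrable setT (EFin \o f).
Proof.
move=> mf vf fB.
pose A : set V := obox (const_mx (- (M + 1))) (const_mx (M + 1)).
have mA : measurable A by exact: measurable_obox.
apply: (@integrable_le _ _ _ _ _ measurableT _ (fun x => B * \1_A x)) => //.
  rewrite (_ : EFin \o _ = (fun x => B%:E * (\1_A x)%:E)%E); last exact/funext.
  apply: integrableZl => //; apply: integrable_indic_lty => //.
  exact: lebesgue_obox_fin.
move=> x _; have [xM|xM] := leP `|x| M; last first.
  by rewrite vf// normr0 mulr_ge0// (le_trans _ (fB 0)).
by rewrite indicE mem_set ?mulr1//; exact: ball_obox.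
Qed.

Lemma integrable_vanish_off M f : continuous f -> vanish_off M f ->
  lam.-integrable setT (EFin \o f).
Proof.
move=> cf vf; have [B _ fB] := bounded_vanish_off cf vf.
by apply: (integrable_bounded_vanish_off _ vf fB); exact: continuous_measurable_rV.
Qed.

(** Directional derivatives are derivatives of functions of one variable,
    for which the mean value theorem is available. *)
Lemma derive_line f (x v : V) (t : R) :
  (derivable f (x + t *: v) v <-> derivable (fun s : R => f (x + s *: v)) t 1) /\
  'D_1 (fun s : R => f (x + s *: v)) t = 'D_v f (x + t *: v).
Proof.
have e : (fun h : R => h^-1 *: (f (x + (h *: 1 + t) *: v) - f (x + t *: v))) =
         (fun h : R => h^-1 *: (f (h *: v + (x + t *: v)) - f (x + t *: v))).
  apply/funext => h; congr (_ *: (f _ - _)).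
  by rewrite -[h *: 1]/(h * 1) mulr1 scalerDl addrCA.
by split; rewrite /derivable /derive /= e.
Qed.

Lemma derivable_line_cont f (x v : V) :
  (forall y, derivable f y v) -> continuous (fun s : R => f (x + s *: v)).
Proof.
move=> df t; apply: differentiable_continuous; apply/derivable1_diffP.
exact: (proj1 (derive_line f x v t).1 (df _)).
Qed.

Lemma mvt_line f (x v : V) (h : R) : 0 < h ->
  (forall y, derivable f y v) ->
  exists2 c : R, 0 <= c <= h & f (x + h *: v) - f x = h * 'D_v f (x + c *: v).
Proof.
move=> h0 df.
have [||c cI] := @MVT R (fun s => f (x + s *: v)) (fun s => 'D_v f (x + s *: v)) 0 h h0.
- move=> t _; apply: DeriveDef.
    exact: (proj1 (derive_line f x v t).1 (df _)).
  exact: (derive_line f x v t).2.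
- by apply: continuous_subspaceT; exact: derivable_line_cont.
rewrite scale0r addr0 subr0 => E; exists c; last by rewrite E mulrC.
by move: cI; rewrite in_itv /= => /andP[/ltW -> /ltW ->].
Qed.

Lemma vanish_off_derive M f (v : V) : vanish_off M f -> vanish_off M ('D_v f).
Proof.
move=> vf x Mx.
rewrite -(@near_eq_derive _ _ _ (cst 0) f x v).
- by rewrite derive_cst.
- have : open [set y : V | M < `|y|].
    rewrite (_ : [set _ | _] = (fun y : V => `|y|) @^-1` [set z | M < z]) //.
    apply: open_comp; last exact: open_gt.
    by move=> y _; exact: norm_continuous.
  rewrite openE => /(_ x Mx); apply: filterS => y /= My.
  by rewrite vf.
Qed.

(** By translation invariance the integral of every difference quotient is
    0.  By the mean value theorem the quotients with steps at most 1 are bounded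
    by one constant and vanish off one box, so the limit passes under the
    integral. *)
Lemma integral_partial0 M psi (i : 'I_d) :
  (forall x, derivable psi x (delta_mx ord0 i)) -> continuous psi ->
  continuous (partial i psi) -> vanish_off M psi ->
  \int[lam]_x partial i psi x = 0.
Proof.
set e : V := delta_mx ord0 i => dpsi cpsi cdpsi vpsi.
have vd : vanish_off M (partial i psi) by exact: vanish_off_derive.
have [B B0 hB] := bounded_vanish_off cdpsi vd.
pose h (n : nat) : R := n.+1%:R^-1.
have h0 n : 0 < h n by rewrite invr_gt0 ltr0n.
have h1 n : h n <= 1 by rewrite invf_le1 ?ltr0n// ler1n.
pose q n (x : V) := (h n)^-1 * (psi (x + h n *: e) - psi x).
have iq : lam.-integrable setT (EFin \o psi) := integrable_vanish_off cpsi vpsi.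
pose C (x : V) : R := B * \1_(obox (const_mx (- (M + 1 + 1))) (const_mx (M + 1 + 1)) : set V) x.
have e1 : `|e| <= 1.
  rewrite [leLHS]mx_normrE; apply/bigmax_leP; split => // -[j k] _.
  by rewrite mxE /=; case: (_ && _); rewrite ?normr1 ?normr0.
have qC n x : `|q n x| <= C x.
  have [c /andP[c0 ch] E] := mvt_line x (h0 n) dpsi.
  rewrite /q E mulrA mulVf ?gt_eqF// mul1r.
  have [xM|xM] := leP `|x| (M + 1).
    by rewrite /C indicE mem_set ?mulr1; [exact: hB|apply: ball_obox; exact: xM].
  rewrite -/(partial i psi _) vd ?normr0 ?mulr_ge0//.
  have : `|x| <= `|x + c *: e| + 1.
    rewrite -[x in leLHS](addrK (c *: e)); apply: (le_trans (ler_normB _ _)).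
    rewrite lerD2l normrZ ger0_norm// mulr_ile1//.
    exact: le_trans (h1 n).
  by move/(lt_le_trans xM); rewrite ltrD2r.
have iC : lam.-integrable setT (EFin \o C).
  rewrite (_ : EFin \o _ = (fun x => B%:E * (\1_(obox (const_mx (- (M + 1 + 1))) (const_mx (M + 1 + 1)) : set V) x)%:E)%E); last exact/funext.
  apply: integrableZl => //; apply: integrable_indic_lty; first exact: measurable_obox.
  exact: lebesgue_obox_fin.
have mpsi : measurable_fun setT psi by exact: continuous_measurable_rV.
have mq n : measurable_fun setT (q n).
  apply: measurable_funM => //; apply: measurable_funB => //.
  by apply: (measurableT_comp (f := psi)) => //; exact: measurable_shift.
have cq x : q ^~ x @ \oo --> partial i psi x.
  have hn : h @ \oo --> (0 : R)^'.
    move=> A /= hA.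
    have hA' : \forall n \near \oo, h n != 0 -> A (h n) := @cvg_harmonic R _ hA.
    by apply: (@filterS _ \oo _ _ _ _ hA') => n /= hAn; apply: hAn; rewrite gt_eqF.
  have := dpsi x; rewrite /derivable => /cvg_ex[l hl].
  have -> : partial i psi x = l by rewrite /partial /derive; apply/cvg_lim.
  have := cvg_comp _ _ hn hl; apply: cvg_trans.
  apply: near_eq_cvg; apply: nearW => n /=.
  by rewrite /q [x + _]addrC.
have [_ ] := Rintegral_dominated_cvg measurableT mq (fun x _ => cq x) iC (fun n x _ => qC n x).
suff -> : (fun n => \int[lam]_x q n x) = (fun=> 0).
  by move/(@cvg_lim _ _ _ _ _ _ _)=> <- //; rewrite lim_cst.
apply/funext => n; have [i1 e2] := integral_shift (h n *: e) iq.
rewrite RintegralZl //; last first.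
  rewrite (_ : EFin \o _ = (fun x => (psi (x + h n *: e))%:E - (psi x)%:E)%E); last exact/funext.
  exact: integrableB i1 iq.
rewrite (RintegralB measurableT i1 iq).
by rewrite /Rintegral e2 subrr mulr0.
Qed.

End compact_support.

(** * Flat functions *)

Section flat_exp.
Variable R : realType.
Implicit Types (P : {poly R}) (x : R).

(** The derivative of exp(-1/x) is not of the same form, but the functions
    P(1/x) exp(-1/x), extended by 0 to x <= 0, are stable under derivation when P
    ranges over polynomials.  Their smoothness is therefore proved for all P at
    once. *)
Definition flat P x : R := if 0 < x then P.[x^-1] * expR (- x^-1) else 0.

(** The exponential series dominates every power of 1/x, and a linear bound
    is what differentiability at 0 requires. *)
Lemma flat_le P : exists2 C : R, 0 <= C & forall x, `|flat P x| <= C * `|x|.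
Proof.
have key (k : nat) (t : R) : 0 < t -> t ^+ k * expR (- t) <= k.+1`!%:R * t^-1.
  move=> t0; rewrite ler_pdivlMr// mulrAC -exprSr expRN ler_pdivrMr ?expR_gt0//.
  rewrite mulrC -ler_pdivrMr ?ltr0n ?fact_gt0// (le_trans _ (expR_ge1Dxn k (ltW t0)))//.
  by rewrite lerDr.
exists (\sum_(i < size P) `|P`_i| * i.+1`!%:R).
  by apply: sumr_ge0 => i _; rewrite mulr_ge0.
move=> x; rewrite /flat; case: ifPn => [x0|_]; last first.
  by rewrite normr0 mulr_ge0// sumr_ge0// => i _; rewrite mulr_ge0.
rewrite normrM (ger0_norm (expR_ge0 _)) horner_coef (gtr0_norm x0).
apply: (@le_trans _ _ ((\sum_(i < size P) `|P`_i| * x^-1 ^+ i) * expR (- x^-1))).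
  rewrite ler_wpM2r ?expR_ge0// (le_trans (ler_norm_sum _ _ _))// ler_sum// => i _.
  by rewrite normrM normrX (gtr0_norm (x := x^-1)) ?invr_gt0.
rewrite !mulr_suml ler_sum// => i _; rewrite -!mulrA ler_wpM2l//.
by rewrite (le_trans (key _ _ _)) ?invr_gt0// invrK.
Qed.

(** For x > 0 this is the chain rule.  At 0 the difference quotient of the
    function of P is the function of X P, which tends to 0 by [flat_le]. *)
Lemma is_derive_flat P x : is_derive x 1 (flat P) (flat ('X^2 * (P - P^`()))%R x).
Proof.
have [x0|x0|<-] := ltgtP 0 x.
- have H : is_derive x 1 (fun y => P.[y^-1] * expR (- y^-1)) (flat ('X^2 * (P - P^`())) x).
    have xn0 : x != 0 by rewrite gt_eqF.
    have d1 : is_derive x 1 (fun y : R => y^-1) (- x ^- 2) .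
      by apply: is_derive_eq (@is_deriveV R id x 1 1 xn0 (is_derive_id x 1)) _; rewrite -[LHS]/(_ * _) mulr1.
    have d2 : is_derive x 1 (fun y : R => P.[y^-1]) ((P^`()).[x^-1] * - x ^- 2).
      have := @is_derive1_comp R (horner P) (fun y : R => y^-1) x _ _ (is_derive_poly P x^-1) d1.
      by [].
    have d3 : is_derive x 1 (fun y : R => expR (- y^-1)) (expR (- x^-1) * x ^- 2).
      have := @is_derive1_comp R expR (fun y : R => - y^-1) x _ _ (is_derive_expR _) (is_deriveN d1).
      by rewrite opprK.
    apply: is_derive_eq (is_deriveM d2 d3) _.
    rewrite /flat x0 !hornerE -![_ *: _]/(_ * _) -exprVn.
    by ring.
  have N : \forall y \near x, P.[y^-1] * expR (- y^-1) = flat P y.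
    by near=> y; rewrite /flat ifT//; near: y; exact: lt_nbhsr.
  have [H1 H2] := H.
  apply: DeriveDef; first exact: near_eq_derivable N H1.
  by rewrite -(near_eq_derive _ N).
- have H : \forall y \near x, cst 0 y = flat P y.
    near=> y; rewrite /flat ifF//; apply/negbTE; rewrite -leNgt; apply: ltW.
    by near: y; exact: lt_nbhsl.
  have -> : flat ('X^2 * (P - P^`())) x = 0 by rewrite /flat ltNge (ltW x0).
  apply: DeriveDef.
    by apply: (near_eq_derivable H); exact: derivable_cst.
  by rewrite -(near_eq_derive _ H) derive_cst.
have -> : flat ('X^2 * (P - P^`())) 0 = 0 by rewrite /flat ltxx.
have [C C0 hC] := flat_le ('X * P).
have L : (fun h : R => h^-1 *: (flat P (h *: 1 + 0) - flat P 0)) @ 0^' --> (0 : R).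
  apply/cvgr0Pnorm_lt => e e0; near=> h.
  have -> : h^-1 *: (flat P (h *: 1 + 0) - flat P 0) = flat ('X * P) h.
    rewrite /flat ltxx subr0 addr0 -![_ *: _]/(_ * _) mulr1.
    case: ifPn => _; rewrite ?mulr0//.
    by rewrite mulrA hornerM hornerX.
  rewrite (le_lt_trans (hC h))// (@le_lt_trans _ _ ((C + 1) * `|h|))//.
    by rewrite ler_wpM2r// lerDl.
  rewrite mulrC -ltr_pdivlMr ?ltr_wpDl//.
  near: h; apply: dnbhs0_lt; by rewrite divr_gt0// ltr_wpDl.
by apply: DeriveDef; [apply/cvg_ex; exists 0|exact/cvg_lim].
Unshelve. all: by end_near. Qed.

End flat_exp.

(** * Smooth functions and bumps on boxes *)

Section smooth_functions.
Variables (R : realType) (d : nat).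
Local Notation V := 'rV[R]_d.
Implicit Types (f g : V -> R) (Omega : set V).
Local Notation e_ i := (delta_mx ord0 i : V).

(** Iterated partial derivatives never leave a class that is stable under
    each partial derivative.  Proofs of smoothness amount to the choice of such a
    class. *)
Lemma smooth_family (S : set (V -> R)) :
  (forall f, S f -> [/\ continuous f, (forall i x, derivable f x (e_ i)) &
                        forall i, S (partial i f)]) ->
  forall f, S f -> smooth f.
Proof.
move=> hS f Sf s; suff Ss : S (iter_partial s f) by have [? ? _] := hS _ Ss.
by elim: s => //= i s IH; have [_ _] := hS _ IH; exact.
Qed.

Lemma smooth_continuous f : smooth f -> continuous f.
Proof. by move=> /(_ [::])[]. Qed.

Lemma smooth_derivable f i x : smooth f -> derivable f x (e_ i).
Proof. by move=> /(_ [::])[_]; exact. Qed.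

Lemma smooth_partial f i : smooth f -> smooth (partial i f).
Proof.
by move=> sf s; have := sf (rcons s i); rewrite /iter_partial foldr_rcons.
Qed.

Lemma continuous_pointwiseM (T : topologicalType) (f g : T -> R) : continuous f -> continuous g ->
  continuous (fun x => f x * g x).
Proof. by move=> cf cg x; apply: (@continuousM _ _ f g x); [exact: cf|exact: cg]. Qed.

Lemma continuous_pointwiseD (T : topologicalType) (f g : T -> R) : continuous f -> continuous g ->
  continuous (fun x => f x + g x).
Proof. by move=> cf cg x; apply: (@continuousD _ _ _ f g x); [exact: cf|exact: cg]. Qed.

Lemma derivable_pointwiseM f g x (v : V) : derivable f x v -> derivable g x v ->
  derivable (fun y => f y * g y) x v /\
  'D_v (fun y => f y * g y) x = f x * 'D_v g x + g x * 'D_v f x.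
Proof. by move=> df dg; split; [exact: (derivableM df dg)|exact: (deriveM df dg)]. Qed.

Lemma derivable_pointwiseD f g x (v : V) : derivable f x v -> derivable g x v ->
  derivable (fun y => f y + g y) x v /\
  'D_v (fun y => f y + g y) x = 'D_v f x + 'D_v g x.
Proof. by move=> df dg; split; [exact: derivableD|exact: deriveD]. Qed.

(** The partial derivative of a product is a sum of two products: products
    do not form a stable class, but their sums do. *)
Inductive sum_of_products : (V -> R) -> Prop :=
| SumOfProducts_mul f g : smooth f -> smooth g -> sum_of_products (fun x => f x * g x)
| SumOfProducts_add f g : sum_of_products f -> sum_of_products g ->
    sum_of_products (fun x => f x + g x).

Lemma smooth_sum_of_products f : sum_of_products f -> smooth f.
Proof.
apply: (smooth_family (S := sum_of_products)) => {}f; elim => {f}[f g sf sg|f g _ [cf df pf] _ [cg dg pg]].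
  have df i x := smooth_derivable (i := i) (x := x) sf.
  have dg i x := smooth_derivable (i := i) (x := x) sg.
  split.
  - by apply: continuous_pointwiseM; exact: smooth_continuous.
  - by move=> i x; exact: (derivable_pointwiseM (df i x) (dg i x)).1.
  - move=> i.
    have -> : partial i (fun x => f x * g x) =
        (fun x => f x * partial i g x + g x * partial i f x).
      by apply/funext => x; exact: (derivable_pointwiseM (df i x) (dg i x)).2.
    apply: SumOfProducts_add.
      exact: (SumOfProducts_mul sf (smooth_partial i sg)).
    exact: (SumOfProducts_mul sg (smooth_partial i sf)).
split.
- exact: continuous_pointwiseD.
- by move=> i x; exact: (derivable_pointwiseD (df i x) (dg i x)).1.
- move=> i.
  have -> : partial i (fun x => f x + g x) = (fun x => partial i f x + partial i g x).
    by apply/funext => x; exact: (derivable_pointwiseD (df i x) (dg i x)).2.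
  exact: SumOfProducts_add.
Qed.

Lemma smoothM f g : smooth f -> smooth g -> smooth (fun x => f x * g x).
Proof. by move=> sf sg; apply: smooth_sum_of_products; exact: SumOfProducts_mul. Qed.

Lemma smooth_cst (c : R) : smooth (fun _ : V => c).
Proof.
apply: (smooth_family (S := [set f | exists c : R, f = fun=> c])); last by exists c.
move=> _ [k ->]; split.
- by move=> x; exact: cst_continuous.
- by move=> i x; exact: derivable_cst.
- move=> i; exists 0; apply/funext => x; exact: derive_cst.
Qed.

Lemma smooth_lin (a : R) f g : smooth f -> smooth g -> smooth (fun x => a * f x + g x).
Proof.
move=> sf sg; apply: smooth_sum_of_products; apply: SumOfProducts_add.
  exact: (SumOfProducts_mul (smooth_cst a) sf).
rewrite (_ : g = fun x => 1 * g x); last by apply/funext => x; rewrite mul1r.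
exact: (SumOfProducts_mul (smooth_cst 1) sg).
Qed.

Lemma smooth_prod (I : Type) (s : seq I) (F : I -> V -> R) :
  (forall i, smooth (F i)) -> smooth (fun x => \prod_(i <- s) F i x).
Proof.
move=> sF; elim: s => [|i s IH].
  by under eq_fun do rewrite big_nil; exact: smooth_cst.
under eq_fun do rewrite big_cons; exact: (smoothM (sF i) IH).
Qed.

(** The factor k absorbs the inner derivative, which makes the class
    of these functions stable. *)
Lemma is_derive_flat_affine (k c c' : R) (P : {poly R}) (i j : 'I_d) (x : V) :
  is_derive x (e_ j) (fun y : V => k * flat P (c * y ord0 i + c'))
    ((k * c *+ (i == j)) * flat ('X^2 * (P - P^`())) (c * x ord0 i + c')).
Proof.
pose F := fun y : V => k * flat P (c * y ord0 i + c').
pose m : R := c *+ (i == j).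
have e1 : (fun s : R => F (x + s *: e_ j)) =
    k \*o (flat P \o (fun s => m * s + (c * x ord0 i + c'))).
  apply/funext => s; rewrite /F /=; congr (k * flat P _).
  by rewrite !mxE eqxx /m; case: (i == j) => /=; ring.
have D : is_derive (0 : R) 1 (fun s : R => F (x + s *: e_ j))
    ((k * c *+ (i == j)) * flat ('X^2 * (P - P^`())) (c * x ord0 i + c')).
  rewrite e1.
  have a1 : is_derive (0 : R) 1 (fun s => m * s + (c * x ord0 i + c')) m.
    have H := is_deriveD (is_deriveZ m (is_derive_id (0 : R) 1)) (is_derive_cst (c * x ord0 i + c') (0 : R) 1).
    by apply: (is_derive_eq H); rewrite addr0 -[LHS]/(_ * _) mulr1.
  have a2 : is_derive (m * (0 : R) + (c * x ord0 i + c')) 1 (flat P) (flat ('X^2 * (P - P^`())) (c * x ord0 i + c')).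
    by rewrite mulr0 add0r; exact: is_derive_flat.
  have H := is_deriveZ k (@is_derive1_comp R (flat P) (fun s => m * s + (c * x ord0 i + c')) 0 _ _ a2 a1).
  apply: (is_derive_eq H); rewrite -[LHS]/(_ * _) /m; case: eqP => _; rewrite ?mulr0 ?mul0r//.
  by rewrite !mulr1n -mulrA [_ * c]mulrC.
have [h1 h2] := derive_line F x (e_ j) 0.
rewrite scale0r addr0 in h1 h2.
by have [D1 D2] := D; apply: DeriveDef; [apply/h1|rewrite -h2].
Qed.

Lemma smooth_flat_affine (P : {poly R}) (c c' : R) (i : 'I_d) :
  smooth (fun y : V => flat P (c * y ord0 i + c')).
Proof.
pose S := [set f : V -> R | exists k P, f = fun y => k * flat P (c * y ord0 i + c')].
apply: (smooth_family (S := S)); last first.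
  by exists 1, P; apply/funext => y; rewrite mul1r.
move=> _ [k [Q ->]]; split.
- apply: continuous_pointwiseM; first exact: cst_continuous.
  move=> y; apply: (@continuous_comp _ _ _ (fun y : V => c * y ord0 i + c') (flat Q) y).
    apply: continuous_pointwiseD; last exact: cst_continuous.
    apply: continuous_pointwiseM; first exact: cst_continuous.
    exact: coord_continuous.
  apply: differentiable_continuous; apply/derivable1_diffP.
  by case: (is_derive_flat Q (c * y ord0 i + c')).
- by move=> j x; case: (is_derive_flat_affine k c c' Q i j x).
- move=> j; exists (k * c *+ (i == j)), ('X^2 * (Q - Q^`())).
  by apply/funext => x; case: (is_derive_flat_affine k c c' Q i j x).
Qed.

(** Smooth approximations of the indicator of an open box: as n grows, both
    factors tend to 1 on their side of each face and remain 0 on the other. *)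
Definition bump (a b : V) (n : nat) (x : V) : R :=
  \prod_(i < d) (flat 1 (n.+1%:R * x ord0 i - n.+1%:R * a ord0 i) *
                 flat 1 (- n.+1%:R * x ord0 i + n.+1%:R * b ord0 i)).

Lemma smooth_bump a b n : smooth (bump a b n).
Proof.
apply: smooth_prod => i; apply: smoothM; last exact: smooth_flat_affine.
exact: smooth_flat_affine.
Qed.

Lemma flat1_bound (y : R) : 0 <= flat 1 y <= 1.
Proof.
rewrite /flat; case: ifPn => y0; last by rewrite lexx ler01.
by rewrite hornerC mul1r expR_ge0 expR_le1 oppr_le0 invr_ge0 ltW.
Qed.

Lemma bump_bound a b n x : 0 <= bump a b n x <= 1.
Proof.
have h (y z : R) : 0 <= flat 1 y * flat 1 z <= 1.
  have /andP[y0 y1] := flat1_bound y; have /andP[z0 z1] := flat1_bound z.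
  by rewrite mulr_ge0//= mulr_ile1.
by rewrite prodr_ge0 ?prodr_ile1// => i _; case/andP: (h (n.+1%:R * x ord0 i - n.+1%:R * a ord0 i) (- n.+1%:R * x ord0 i + n.+1%:R * b ord0 i)).
Qed.

Lemma bump_out a b n x : ~ obox a b x -> bump a b n x = 0.
Proof.
move=> /existsNP[i /negP]; rewrite negb_and -!leNgt => h.
rewrite /bump (bigD1 i)//= [X in X * _](_ : _ = 0) ?mul0r//.
case/orP: h => h; rewrite /flat.
  by rewrite ifF ?mul0r// -mulrBr pmulr_rgt0 ?ltr0n// subr_gt0 ltNge h.
rewrite [X in _ * X]ifF ?mulr0// addrC mulNr -mulrBr pmulr_rgt0 ?ltr0n//.
by rewrite subr_gt0 ltNge h.
Qed.

Lemma cvgn_prod (I : Type) (s : seq I) (u : I -> nat -> R) (l : I -> R) :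
  (forall i, u i @ \oo --> l i) ->
  (fun n => \prod_(i <- s) u i n) @ \oo --> \prod_(i <- s) l i.
Proof.
move=> ul; elim: s => [|i s IH].
  by under eq_fun do rewrite big_nil; rewrite big_nil; exact: cvg_cst.
by under eq_fun do rewrite big_cons; rewrite big_cons; exact: cvgM.
Qed.

Lemma bump_cvg a b x : (fun n => bump a b n x) @ \oo --> (\1_(obox a b) x : R).
Proof.
rewrite indicE; case: (pselect (obox a b x)) => [ox|nx]; last first.
  rewrite memNset//; under eq_fun do rewrite bump_out//; exact: cvg_cst.
rewrite mem_set//.
have key (y : R) : 0 < y -> (fun n => flat 1 (n.+1%:R * y)) @ \oo --> (1 : R).
  move=> y0; rewrite (_ : (fun n => _) = (fun n => expR (- (n.+1%:R^-1 * y^-1)))); last first.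
    apply/funext => n; rewrite /flat mulr_gt0// hornerC mul1r.
    by rewrite invfM.
  rewrite -[X in _ --> X]expR0; apply: continuous_cvg; first exact: continuous_expR.
  rewrite -[X in _ --> X]oppr0; apply: cvgN.
  rewrite -[X in _ --> X](mul0r y^-1); apply: cvgM; last exact: cvg_cst.
  exact: cvg_harmonic.
rewrite /bump (_ : (1%:R : R) = \prod_(i < d) (1 * 1)); last by rewrite mulr1 big1_eq.
apply: cvgn_prod => i; have /andP[ax xb] := ox i; apply: cvgM.
  by under eq_fun do rewrite -mulrBr; apply: key; rewrite subr_gt0.
by under eq_fun do rewrite addrC mulNr -mulrBr; apply: key; rewrite subr_gt0.
Qed.

Lemma closed_cbox a b : closed (cbox a b : set V).
Proof.
rewrite (_ : cbox a b = \bigcap_(i in [set: 'I_d]) ((fun x : V => x ord0 i) @^-1` `[a ord0 i, b ord0 i])).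
  apply: closed_bigI => i _; apply: preimage_closed; last exact: interval_closed.
  by move=> x _; exact: coord_continuous.
by apply/seteqP; split => x /= h i; [move=> _|]; have := h i; rewrite /= in_itv /=; [|exact].
Qed.

Lemma compact_cbox a b : compact (cbox a b : set V).
Proof.
have := @rV_compact R d (fun i => `[a ord0 i, b ord0 i]%classic) (fun i => @segment_compact _ _ _).
by rewrite (_ : [set v | _] = cbox a b).
Qed.

Lemma test_fun_bump Omega a b n : cbox a b `<=` Omega -> test_fun Omega (bump a b n).
Proof.
move=> abO; have s : Defs.support (bump a b n) `<=` cbox a b.
  rewrite /Defs.support [X in _ `<=` X](closure_id _).1; last exact: closed_cbox.
  apply: closureS => x /=; have [ox _ i|/bump_out->] := pselect (obox a b x); last by rewrite eqxx.
  by have /andP[/ltW-> /ltW->] := ox i.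
split; [exact: smooth_bump| |exact: subset_trans abO].
have := @subclosed_compact _ (Defs.support (bump a b n)) (cbox a b); apply => //; [exact: closed_closure|exact: compact_cbox].
Qed.

End smooth_functions.

(** * The fundamental lemma of the calculus of variations *)

Section fundamental_lemma.
Variables (R : realType) (d : nat) (Omega : set 'rV[R]_d).
Hypothesis oO : open Omega.
Local Notation V := 'rV[R]_d.
Local Notation lam := (lebesgue_rV R d).
Variable g : V -> R.
Hypothesis ig : lam.-integrable Omega (EFin \o g).
Hypothesis g0 : forall phi, test_fun Omega phi -> \int[lam]_(x in Omega) (g x * phi x) = 0.

Let mO : measurable Omega. Proof. exact: open_measurable_rV. Qed.

Lemma integral_cbox0 a b : cbox a b `<=` Omega -> (\int[lam]_(x in obox a b) (g x)%:E = 0)%E.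
Proof.
move=> abO.
have mg := integrable_measurable ig.
have oab : obox a b `<=` cbox a b by move=> x h i; move/andP: (h i) => [/ltW -> /ltW ->].
have [||||i1] := @Rintegral_dominated_cvg _ V R lam Omega mO (fun n x => g x * bump a b n x) (fun x => g x * \1_(obox a b) x) (fun x => `|g x|).
- move=> n; apply: measurable_funM => //; apply: measurable_funTS.
  by apply: continuous_measurable_rV; apply: smooth_continuous; exact: smooth_bump.
- by move=> x _; apply: cvgM; [exact: cvg_cst|exact: bump_cvg].
- exact: integrable_norm ig.
- move=> n x _; have /andP[b0 b1] := bump_bound a b n x.
  by rewrite normrM (ger0_norm b0) ler_piMr.
rewrite (_ : (fun n => _) = fun=> 0); last first.
  by apply/funext => n; apply: g0; exact: test_fun_bump.
move=> /(cvg_lim (@Rhausdorff R)); rewrite lim_cst// => /esym E.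
have fnum : (\int[lam]_(x in obox a b) (g x)%:E)%E \is a fin_num.
  apply: integrable_fin_num; first exact: measurable_obox.
  apply: integrableS ig => //; first exact: measurable_obox.
  exact: subset_trans abO.
rewrite -(fineK fnum); congr EFin; rewrite -[RHS]E.
transitivity (\int[lam]_(x in Omega `&` obox a b) g x).
  by rewrite (setIidr (subset_trans oab abO)).
rewrite Rintegral_mkcondr; apply: eq_Rintegral => x _.
by rewrite patchE indicE; case: ifP => _; rewrite ?mulr1 ?mulr0.
Qed.

(** The sets A for which g has integral 0 over the intersection of A with the
    box form a Dynkin class containing the pi-system of boxes. *)
Lemma ae_cbox0 a b : cbox a b `<=` Omega -> ae_eq lam (obox a b) (EFin \o g) (cst 0%E).
Proof.
move=> abO; set B := obox a b.
have mB : measurable B by exact: measurable_obox.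
have BO : B `<=` Omega.
  by apply: subset_trans abO => x h i; move/andP: (h i) => [/ltW -> /ltW ->].
have iB : lam.-integrable B (EFin \o g) by exact: integrableS ig.
suff P A : measurable A -> (\int[lam]_(x in B `&` A) (g x)%:E = 0)%E.
  apply: integral_ae_eq => // E EB mE; rewrite integral_cst// mul0e.
  by rewrite -[E](setIidr EB) P.
rewrite measurable_rV_obox; move: A.
apply: (@dynkin_induction _ V (@oboxes R d) (fun A => (\int[lam]_(x in B `&` A) (g x)%:E = 0)%E)).
- exact: measurable_rV_obox.
- exact: setI_closed_oboxes.
- by rewrite setIT integral_cbox0.
- move=> _ [a' [b' ->]]; rewrite oboxI integral_cbox0// => x h; apply: abO => i.
  have := h i; rewrite !mxE ge_max le_min.
  by move=> /andP[/andP[-> _] /andP[-> _]].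
- move=> S mS PS.
  have := integral_cbox0 abO; rewrite -/B -[in X in X -> _](setUIDK B S) setDE.
  rewrite integral_setU_EFin//; [|exact: measurableI|apply: measurableI => //; exact: measurableC| |].
  + by rewrite PS add0e.
  + apply: measurable_funS (integrable_measurable iB) => //.
    by rewrite -setIUr; exact: subIsetl.
  + by apply/disj_setPS => x [[_ Sx] [_ nSx]].
- move=> F mF tF PF; rewrite setI_bigcupr integral_bigcup.
  + by rewrite eseries0// => k _ _; exact: PF.
  + exact: trivIset_setIl.
  + by move=> k; exact: measurableI.
  + apply: integrableS iB => //; last by move=> x [k _ []].
    by apply: bigcup_measurable => k _; exact: measurableI.
Qed.

(** Bumps converge boundedly to indicators of boxes, so g has integral 0
    over every box whose closure lies in Omega and vanishes almost everywhere on
    it; countably many of these boxes cover Omega. *)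
Lemma fundamental_lemma : {ae lam, forall x, Omega x -> g x = 0}.
Proof.
have H (n : nat) : {ae lam, forall x, forall ab : 'rV[rat]_d * 'rV[rat]_d,
    unpickle n = Some ab -> cbox (ratv R ab.1) (ratv R ab.2) `<=` Omega ->
    obox (ratv R ab.1) (ratv R ab.2) x -> g x = 0}.
  case E : (unpickle n) => [ab|]; last by apply: aeW.
  have [c|c] := pselect (cbox (ratv R ab.1) (ratv R ab.2) `<=` Omega); last first.
    by apply: aeW => x _ [<-].
  have := ae_cbox0 c; apply: filterS => x h _ [<-] _ abx.
  by have [] := h abx.
have := ae_foralln H; apply: filterS => x h Ox.
have := Ox; rewrite {1}(open_bigcup_obox oO) => -[ab abO abx].
exact: (h (pickle ab) ab (pickleK _)).
Qed.

End fundamental_lemma.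

(** * Euclidean vectors and p-th powers of norms *)

Section euclidean_space.
Variables (R : realType) (d : nat).
Local Notation V := 'rV[R]_d.
Implicit Types (x y z : V) (a : R).

Lemma dotvC x y : dotv x y = dotv y x.
Proof. by apply: eq_bigr => i _; rewrite mulrC. Qed.

Lemma dotvDl x y z : dotv (x + y) z = dotv x z + dotv y z.
Proof. by rewrite -big_split; apply: eq_bigr => i _; rewrite mxE mulrDl. Qed.

Lemma dotvZl a x y : dotv (a *: x) y = a * dotv x y.
Proof. by rewrite mulr_sumr; apply: eq_bigr => i _; rewrite mxE mulrA. Qed.

Lemma dotvDr x y z : dotv z (x + y) = dotv z x + dotv z y.
Proof. by rewrite dotvC dotvDl !(dotvC z). Qed.

Lemma dotvZr a x y : dotv x (a *: y) = a * dotv x y.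
Proof. by rewrite dotvC dotvZl dotvC. Qed.

Lemma dotv_ge0 x : 0 <= dotv x x.
Proof. by apply: sumr_ge0 => i _; rewrite -expr2 sqr_ge0. Qed.

Lemma enorm_ge0 x : 0 <= enorm x. Proof. exact: sqrtr_ge0. Qed.

Lemma sqr_enorm x : enorm x ^+ 2 = dotv x x.
Proof. by rewrite sqr_sqrtr// dotv_ge0. Qed.

Lemma enormZ a x : enorm (a *: x) = `|a| * enorm x.
Proof. by rewrite /enorm dotvZl dotvZr mulrA -expr2 sqrtrM ?sqr_ge0// sqrtr_sqr. Qed.

Lemma enorm0 : enorm (0 : V) = 0.
Proof. by rewrite -(scale0r (0 : V)) enormZ normr0 mul0r. Qed.

Lemma enorm_eq0 x : enorm x = 0 -> x = 0.
Proof.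
move=> x0; have : dotv x x = 0 by rewrite -sqr_enorm x0 expr0n.
move/eqP; rewrite psumr_eq0 => [/allP h|i _]; last by rewrite -expr2 sqr_ge0.
apply/rowP => i; rewrite mxE; apply/eqP.
by have := h i (mem_index_enum _); rewrite -expr2 sqrf_eq0.
Qed.

(** Cauchy-Schwarz: expand the square of |y| x - |x| y. *)
Lemma dotv_le x y : dotv x y <= enorm x * enorm y.
Proof.
have [x0|x0] := eqVneq (enorm x) 0.
  by rewrite x0 mul0r (enorm_eq0 x0) -(scale0r (0 : V)) dotvZl mul0r.
have [y0|y0] := eqVneq (enorm y) 0.
  by rewrite y0 mulr0 (enorm_eq0 y0) -(scale0r (0 : V)) dotvZr mul0r.
have := dotv_ge0 (enorm y *: x - enorm x *: y).
rewrite -scaleN1r !(dotvDl, dotvDr, dotvZl, dotvZr) -!sqr_enorm (dotvC y x).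
have xp : 0 < enorm x by rewrite lt_def x0 enorm_ge0.
have yp : 0 < enorm y by rewrite lt_def y0 enorm_ge0.
set X := enorm x in xp *; set Y := enorm y in yp *; set D := dotv x y => h.
have {}h : 0 <= (X * Y) * (X * Y - D) by lra.
by move: h; rewrite pmulr_rge0 ?mulr_gt0// subr_ge0.
Qed.

Lemma enormN x : enorm (- x) = enorm x.
Proof. by rewrite -scaleN1r enormZ normrN1 mul1r. Qed.

Lemma norm_dotv_le x y : `|dotv x y| <= enorm x * enorm y.
Proof.
rewrite ler_norml dotv_le andbT lerNl -mulN1r -dotvZl scaleN1r.
by rewrite (le_trans (dotv_le _ _))// enormN.
Qed.

Lemma enormD x y : enorm (x + y) <= enorm x + enorm y.
Proof.
rewrite -ler_sqr ?nnegrE ?addr_ge0 ?enorm_ge0// sqrrD !sqr_enorm dotvDl !dotvDr (dotvC y x).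
have := dotv_le x y; lra.
Qed.

Lemma coord_le_enorm x i : `|x ord0 i| <= enorm x.
Proof.
rewrite -ler_sqr ?nnegrE ?enorm_ge0// sqr_enorm real_normK ?num_real// /dotv (bigD1 i)//=.
by rewrite expr2 lerDl sumr_ge0// => j _; rewrite -expr2 sqr_ge0.
Qed.

Lemma measurable_fun_coords dd (T : measurableType dd) (D : set T) (f : T -> V) :
  measurable D -> (forall i, measurable_fun D (fun x : T => f x ord0 i : R)) ->
  measurable_fun D f.
Proof.
move=> mD mf; apply: (measurability _ (@measurable_rV_obox R d)).
move=> _ [_ [a [b ->]] <-].
have -> : D `&` f @^-1` obox a b =
  D `&` \bigcap_(i in [set: 'I_d]) (D `&` (fun x : T => f x ord0 i) @^-1` `]a ord0 i, b ord0 i[).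
  apply/seteqP; split => x /= [Dx h]; split => // i; first by move=> _; split => //; rewrite /= in_itv; exact: h.
  by have [_] := h i I; rewrite /= in_itv.
apply: measurableI => //; apply: fin_bigcap_measurable => // i _.
exact: mf.
Qed.

Lemma measurable_coord dd (T : measurableType dd) (D : set T) (f : T -> V) (i : 'I_d) :
  measurable_fun D f -> measurable_fun D (fun x : T => f x ord0 i : R).
Proof. by move=> mf; exact: (measurableT_comp (@measurable_rV_coord R d i) mf). Qed.

Lemma measurable_dotv dd (T : measurableType dd) (D : set T) (f g : T -> V) :
  measurable_fun D f -> measurable_fun D g -> measurable_fun D (fun x : T => dotv (f x) (g x)).
Proof.
move=> mf mg; apply: measurable_sum => i.
by apply: measurable_funM; exact: measurable_coord.
Qed.

Lemma measurable_enorm dd (T : measurableType dd) (D : set T) (f : T -> V) :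
  measurable_fun D f -> measurable_fun D (fun x : T => enorm (f x)).
Proof.
move=> mf; rewrite [X in measurable_fun _ X](_ : _ = fun x : T => dotv (f x) (f x) `^ 2^-1).
  apply: (measurableT_comp (measurable_powR _)); exact: measurable_dotv.
by apply/funext => x; rewrite powR12_sqrt// dotv_ge0.
Qed.

Lemma measurable_scalev dd (T : measurableType dd) (D : set T) (k : T -> R) (f : T -> V) :
  measurable D -> measurable_fun D k -> measurable_fun D f -> measurable_fun D (fun x : T => k x *: f x).
Proof.
move=> mD mk mf; apply: measurable_fun_coords => // i.
under eq_fun do rewrite mxE; apply: measurable_funM => //; exact: measurable_coord.
Qed.

Lemma measurable_addv dd (T : measurableType dd) (D : set T) (f g : T -> V) :
  measurable D -> measurable_fun D f -> measurable_fun D g -> measurable_fun D (fun x : T => f x + g x).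
Proof.
move=> mD mf mg; apply: measurable_fun_coords => // i.
under eq_fun do rewrite mxE; apply: measurable_funD; exact: measurable_coord.
Qed.

End euclidean_space.

Section power_integrals.
Variables (R : realType) (d : nat) (Omega : set 'rV[R]_d).
Local Notation V := 'rV[R]_d.
Local Notation lam := (lebesgue_rV R d).
Hypothesis mO : measurable Omega.
Implicit Types (f g : V -> R) (F G : V -> V).

(** The p-th power of the norm of L^p, a real number without roots. *)
Definition Lp_pow p f := \int[lam]_(x in Omega) (`|f x| `^ p).

(** A crude substitute for Minkowski's inequality, sufficient to show that L^p
    is a vector space and that limits respect linear combinations. *)
Lemma powR_addn_le (p a b : R) : 0 < p -> 0 <= a -> 0 <= b ->
  (a + b) `^ p <= 2 `^ p * (a `^ p + b `^ p).
Proof.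
move=> p0 a0 b0; wlog ab : a b a0 b0 / a <= b => [H|].
  case: (leP a b) => [|/ltW] ab; first exact: H.
  by rewrite addrC [X in _ <= _ * X]addrC; exact: H.
apply: (@le_trans _ _ ((2 * b) `^ p)).
  apply: ge0_ler_powR; rewrite ?nnegrE ?(ltW p0) ?addr_ge0 ?mulr_ge0//.
  by rewrite mulr_natl mulr2n lerD2r.
by rewrite powRM// ler_wpM2l ?powR_ge0// lerDr powR_ge0.
Qed.

Lemma measurable_abs_powR p f : measurable_fun Omega f ->
  measurable_fun Omega (fun x => `|f x| `^ p).
Proof. by move=> mf; apply: (measurableT_comp (measurable_powR _)); exact: measurableT_comp. Qed.

Lemma restrict_Lp_powE p f : p != 0 ->
  (\int[lam]_x `|(EFin \o (f \_ Omega)) x| `^ p = \int[lam]_(x in Omega) (`|f x| `^ p)%:E)%E.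
Proof.
move=> p0; rewrite [RHS]integral_mkcond; apply: eq_integral => x _ /=.
by rewrite !patchE; case: ifP => _ //; rewrite normr0 powR0.
Qed.

Lemma LpP p f : 0 < p -> Lp Omega p f <->
  measurable_fun Omega f /\ lam.-integrable Omega (EFin \o (fun x => `|f x| `^ p)).
Proof.
move=> p0; have p0' : p != 0 by rewrite gt_eqF.
have absE : (\int[lam]_(x in Omega) `|(EFin \o (fun x0 => (`|f x0| `^ p)%R)) x|)%E =
    (\int[lam]_(x in Omega) (`|f x| `^ p)%:E)%E.
  by apply: eq_integral => x _; rewrite /= ger0_norm ?powR_ge0.
rewrite /Lp /=; split.
  move=> /andP[]; rewrite !inE /= => mf fin.
  have := (measurable_restrict f mO measurableT).2 mf; rewrite setTI => {}mf.
  split => //; apply/integrableP; split.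
    by apply/measurable_EFinP; exact: measurable_abs_powR.
  rewrite absE -restrict_Lp_powE//.
  by move: fin; rewrite /finite_norm unlock; apply: lty_poweRy; rewrite invr_eq0.
move=> [mf /integrableP[_]]; rewrite absE => fin.
apply/andP; rewrite !inE /=; split.
  by have := (measurable_restrict f mO measurableT).1; rewrite setTI; apply.
rewrite /finite_norm unlock (restrict_Lp_powE _ p0'); exact: poweR_lty fin.
Qed.

Lemma Lp_normE p f : 0 < p -> Lp Omega p f ->
  Lp_norm Omega p f = (Lp_pow p f `^ p^-1)%:E.
Proof.
move=> p0 /(LpP _ p0)[mf ifp]; rewrite /Lp_norm unlock restrict_Lp_powE ?gt_eqF//.
rewrite -[X in (X `^ _)%E = _]fineK ?poweR_EFin//.
exact: integrable_fin_num ifp.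
Qed.

Lemma Lp_pow_ge0 p f : 0 <= Lp_pow p f.
Proof. by apply: Rintegral_ge0 => x _; rewrite powR_ge0. Qed.

Lemma cvg_powR0 (u : nat -> R) r : 0 < r -> (forall n, 0 <= u n) ->
  u @ \oo --> (0 : R) -> (fun n => u n `^ r) @ \oo --> (0 : R).
Proof.
move=> r0 u0 /cvgr0Pnorm_lt h; apply/cvgr0Pnorm_lt => e e0.
have e'0 : 0 < e `^ r^-1 by rewrite powR_gt0.
apply: filterS (h _ e'0) => n; rewrite ger0_norm// ger0_norm ?powR_ge0// => une.
have -> : e = (e `^ r^-1) `^ r by rewrite -powRrM mulVf ?gt_eqF// powRr1// ltW.
by apply: gt0_ltr_powR => //; rewrite nnegrE// powR_ge0.
Qed.

Lemma cvg_Lp_norm0 p (f_ : nat -> V -> R) : 0 < p -> (forall n, Lp Omega p (f_ n)) ->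
  ((fun n => Lp_norm Omega p (f_ n)) @ \oo --> 0%E <->
   (fun n => Lp_pow p (f_ n)) @ \oo --> (0 : R)).
Proof.
move=> p0 hf; under eq_fun do rewrite Lp_normE//.
have ge n : 0 <= Lp_pow p (f_ n) by exact: Lp_pow_ge0.
have rE n : Lp_pow p (f_ n) = (Lp_pow p (f_ n) `^ p^-1) `^ p.
  by rewrite -powRrM mulVf ?gt_eqF// powRr1.
split => h.
  have {}h : (fun n => Lp_pow p (f_ n) `^ p^-1) @ \oo --> (0 : R) by exact: (fine_cvg h).
  under eq_fun do rewrite rE; apply: cvg_powR0 => // n; exact: powR_ge0.
apply: cvg_EFin; first exact: nearW.
by apply: cvg_powR0; rewrite ?invr_gt0.
Qed.

(** The pointwise bound on h lets one statement serve both for linear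
    combinations of functions and for lengths of linear combinations of fields. *)
Lemma integrable_pow_lin p (a : R) f g (h : V -> R) : 0 < p ->
  Lp Omega p f -> Lp Omega p g -> measurable_fun Omega h ->
  (forall x, Omega x -> `|h x| <= `|a| * `|f x| + `|g x|) ->
  Lp Omega p h /\ Lp_pow p h <= 2 `^ p * (`|a| `^ p * Lp_pow p f + Lp_pow p g).
Proof.
move=> p0 /(LpP _ p0)[mf ifp] /(LpP _ p0)[mg igp] mh hfg.
pose b x := 2 `^ p * (`|a| `^ p * `|f x| `^ p + `|g x| `^ p).
have hb x : Omega x -> `|h x| `^ p <= b x.
  move=> Ox; apply: (@le_trans _ _ ((`|a| * `|f x| + `|g x|) `^ p)).
    by apply: ge0_ler_powR; rewrite ?nnegrE ?(ltW p0) ?addr_ge0 ?mulr_ge0//; exact: hfg.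
  by rewrite /b -powRM// powR_addn_le// mulr_ge0.
have i1 : lam.-integrable Omega (EFin \o (fun x => `|a| `^ p * `|f x| `^ p)).
  exact: (integrableZl mO (`|a| `^ p) ifp).
have i2 : lam.-integrable Omega (EFin \o (fun x => `|a| `^ p * `|f x| `^ p + `|g x| `^ p)).
  exact: (integrableD mO i1 igp).
have ib : lam.-integrable Omega (EFin \o b) by exact: (integrableZl mO (2 `^ p) i2).
have ih : lam.-integrable Omega (EFin \o (fun x => `|h x| `^ p)).
  apply: (integrable_le mO _ ib); first exact: measurable_abs_powR.
  by move=> x Ox; rewrite ger0_norm ?powR_ge0// hb.
split; first by apply/LpP.
apply: (le_trans (le_Rintegral mO ih ib hb)).
by rewrite /b RintegralZl// RintegralD// RintegralZl.
Qed.

Lemma cvg_Lp_pow_lin p (a : R) (f_ g_ h_ : nat -> V -> R) : 0 < p ->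
  (forall n, Lp Omega p (f_ n)) -> (forall n, Lp Omega p (g_ n)) ->
  (forall n, measurable_fun Omega (h_ n)) ->
  (forall n x, Omega x -> `|h_ n x| <= `|a| * `|f_ n x| + `|g_ n x|) ->
  (fun n => Lp_pow p (f_ n)) @ \oo --> (0 : R) ->
  (fun n => Lp_pow p (g_ n)) @ \oo --> (0 : R) ->
  (fun n => Lp_pow p (h_ n)) @ \oo --> (0 : R).
Proof.
move=> p0 hf hg mh hfg cf cg.
apply: (@squeeze_cvgr _ _ _ _ (fun=> 0) (fun n => 2 `^ p * (`|a| `^ p * Lp_pow p (f_ n) + Lp_pow p (g_ n)))).
- apply: nearW => n; rewrite Lp_pow_ge0/=.
  exact: (integrable_pow_lin p0 (hf n) (hg n) (mh n) (hfg n)).2.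
- exact: cvg_cst.
- rewrite -[X in _ --> X](mulr0 (2 `^ p)); apply: cvgM; first exact: cvg_cst.
  rewrite -[X in _ --> X](addr0 0); apply: cvgD => //.
  rewrite -[X in _ --> X](mulr0 (`|a| `^ p)); exact: (cvgM (cvg_cst _) cf).
Qed.

Lemma Lp_lin p a f g : 0 < p -> Lp Omega p f -> Lp Omega p g ->
  Lp Omega p (fun x => a * f x + g x).
Proof.
move=> p0 Lf Lg; apply: (integrable_pow_lin (a := a) p0 Lf Lg _ _).1.
  have [mf _] := (LpP _ p0).1 Lf; have [mg _] := (LpP _ p0).1 Lg.
  by apply: measurable_funD => //; apply: measurable_funM.
by move=> x _; rewrite (le_trans (ler_normD _ _))// normrM.
Qed.

Lemma LpV_lin p a F G : 0 < p -> LpV Omega p F -> LpV Omega p G ->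
  LpV Omega p (fun x => a *: F x + G x).
Proof.
move=> p0 [mF LF] [mG LG].
have m : measurable_fun Omega (fun x => a *: F x + G x).
  by apply: measurable_addv => //; exact: measurable_scalev.
split => //; apply: (integrable_pow_lin (a := a) p0 LF LG _ _).1.
  exact: measurable_enorm.
move=> x _; rewrite !(ger0_norm (enorm_ge0 _)).
by rewrite (le_trans (enormD _ _))// enormZ.
Qed.

Hypothesis fO : (lam Omega < +oo)%E.

Lemma integrable_cst (k : R) : lam.-integrable Omega (EFin \o (fun=> k)).
Proof.
apply/integrableP; split; first exact/measurable_EFinP.
rewrite (eq_integral (fun=> `|k|%:E)%E) // integral_cst//.
by rewrite lte_mul_pinfty// lee_fin.
Qed.

Lemma integrable_bounded (B : R) f : measurable_fun Omega f ->
  (forall x, Omega x -> `|f x| <= B) -> lam.-integrable Omega (EFin \o f).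
Proof.
move=> mf fB; apply: (integrable_le mO mf (g := fun=> B)) => //.
exact: integrable_cst.
Qed.

Lemma Lp_bounded p (B : R) f : 0 < p -> measurable_fun Omega f ->
  (forall x, Omega x -> `|f x| <= B) -> Lp Omega p f.
Proof.
move=> p0 mf fB; apply/LpP => //; split => //.
apply: (integrable_bounded (B := B `^ p)); first exact: measurable_abs_powR.
move=> x Ox; rewrite ger0_norm ?powR_ge0//; apply: ge0_ler_powR; rewrite ?nnegrE ?(ltW p0)//.
  exact: le_trans (fB x Ox).
exact: fB.
Qed.

Lemma le1D_powR p (y : R) : 1 <= p -> 0 <= y -> y <= 1 + y `^ p.
Proof.
move=> p1 y0; have [y1|y1] := leP y 1.
  by rewrite (le_trans y1)// lerDl powR_ge0.
by rewrite (le_trans (le1r_powR (ltW y1) p1))// lerDr.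
Qed.

Lemma Lp_integrable p f : 1 <= p -> Lp Omega p f -> lam.-integrable Omega (EFin \o f).
Proof.
move=> p1 /LpP[]; first exact: lt_le_trans p1.
move=> mf ifp; apply: (integrable_le mO mf (g := fun x => 1 + `|f x| `^ p)).
  exact: (integrableD mO (integrable_cst 1) ifp).
by move=> x _; exact: le1D_powR.
Qed.

Lemma LpV_coord_integrable p F i : 1 <= p -> LpV Omega p F ->
  lam.-integrable Omega (EFin \o (fun x => F x ord0 i)).
Proof.
move=> p1 [mF LF]; apply: (integrable_le mO _ (Lp_integrable p1 LF)).
  exact: measurable_coord.
by move=> x _; exact: coord_le_enorm.
Qed.

End power_integrals.

(** * Calculus of test functions *)

Section test_functions.
Variables (R : realType) (d : nat) (Omega : set 'rV[R]_d).
Hypotheses (oO : open Omega) (bO : bounded_set Omega).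
Local Notation V := 'rV[R]_d.
Local Notation lam := (lebesgue_rV R d).
Implicit Types (f g phi psi : V -> R).

Let mO : measurable Omega. Proof. exact: open_measurable_rV. Qed.
Let fO : (lam Omega < +oo)%E. Proof. exact: bounded_set_lam. Qed.

Lemma support_neq0 phi x : phi x != 0 -> Defs.support phi x.
Proof. by move=> h; apply: subset_closure. Qed.

Lemma test_fun_support phi psi : test_fun Omega phi -> smooth psi ->
  (forall x, ~ Defs.support phi x -> psi x = 0) -> test_fun Omega psi.
Proof.
move=> [_ cphi sphi] spsi h.
have s : Defs.support psi `<=` Defs.support phi.
  rewrite [X in _ `<=` X](closure_id _).1; last exact: closed_closure.
  apply: closureS => x /= /eqP nx; apply: contrapT => /h; exact: nx.
split => //; last exact: subset_trans sphi.
have := @subclosed_compact _ (Defs.support psi) (Defs.support phi).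
by apply => //; exact: closed_closure.
Qed.

Lemma test_fun_out phi x : test_fun Omega phi -> ~ Omega x -> phi x = 0.
Proof.
move=> [_ _ sphi] nOx; apply: contrapT => /eqP h; apply: nOx.
by apply: sphi; exact: support_neq0.
Qed.

Lemma test_fun_vanish phi : test_fun Omega phi -> exists M, vanish_off M phi.
Proof.
move=> [_ /compact_bounded[M [_ hM]] _]; exists (M + 1) => x Mx.
apply: contrapT => /eqP /support_neq0 h.
have : `|x| <= M + 1 by apply: (hM (M + 1)) => //; rewrite ltrDl.
by rewrite leNgt Mx.
Qed.

Lemma test_fun_partial phi i : test_fun Omega phi -> test_fun Omega (partial i phi).
Proof.
move=> tphi; have [sphi _ _] := tphi.
apply: (test_fun_support tphi); first exact: smooth_partial.
move=> x nx.
rewrite /partial -(@near_eq_derive _ _ _ (cst 0) phi x).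
  by rewrite derive_cst.
have : open (~` Defs.support phi) by apply: closed_openC; exact: closed_closure.
rewrite openE => /(_ x nx); apply: filterS => y ny /=.
by apply: contrapT => /eqP; rewrite eq_sym => /support_neq0.
Qed.

Lemma test_fun_lin (a : R) phi psi : test_fun Omega phi -> test_fun Omega psi ->
  test_fun Omega (fun x => a * phi x + psi x).
Proof.
move=> [s1 c1 h1] [s2 c2 h2].
have s : Defs.support (fun x => a * phi x + psi x) `<=` Defs.support phi `|` Defs.support psi.
  rewrite [X in _ `<=` X](closure_id _).1; last by apply: closedU; exact: closed_closure.
  apply: closureS => x /= nx.
  have [p0|/support_neq0] := eqVneq (phi x) 0; last by left.
  by right; apply: support_neq0; move: nx; rewrite p0 mulr0 add0r.
split; first exact: smooth_lin.
  have := @subclosed_compact _ (Defs.support (fun x => a * phi x + psi x)) (Defs.support phi `|` Defs.support psi).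
  apply => //; [exact: closed_closure|exact: compactU].
by apply: (subset_trans s); rewrite subUset.
Qed.

Lemma test_fun_smoothM f phi : smooth f -> test_fun Omega phi ->
  test_fun Omega (fun x => f x * phi x).
Proof.
move=> sf tphi; have [sphi _ _] := tphi.
apply: (test_fun_support tphi); first exact: smoothM.
move=> x nx; rewrite (_ : phi x = 0) ?mulr0//.
by apply: contrapT => /eqP /support_neq0.
Qed.

Lemma test_fun_cst0 : test_fun Omega (fun _ : V => 0 : R).
Proof.
have s0 : Defs.support (fun _ : V => 0 : R) = set0.
  rewrite /Defs.support (_ : [set x | _] = set0) ?closure0//.
  by apply/seteqP; split => // x /=; rewrite eqxx.
by split; rewrite ?s0; [exact: smooth_cst|exact: compact0|].
Qed.

Lemma test_fun_continuous phi : test_fun Omega phi -> continuous phi.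
Proof. by move=> [/smooth_continuous]. Qed.

Lemma test_fun_measurable phi : test_fun Omega phi -> measurable_fun Omega phi.
Proof.
move=> /test_fun_continuous c; apply: measurable_funTS; exact: continuous_measurable_rV.
Qed.

Lemma test_fun_bounded phi : test_fun Omega phi -> exists2 B : R, 0 <= B & forall x, `|phi x| <= B.
Proof.
move=> tphi; have [M vM] := test_fun_vanish tphi.
by apply: (bounded_vanish_off _ vM); exact: test_fun_continuous.
Qed.

Lemma integrableM_test f phi : lam.-integrable Omega (EFin \o f) -> test_fun Omega phi ->
  lam.-integrable Omega (EFin \o (fun x => f x * phi x)).
Proof.
move=> iF tphi; have [B B0 hB] := test_fun_bounded tphi.
apply: (integrable_le mO (g := fun x => B * `|f x|)).
- apply: measurable_funM; [exact: integrable_measurable iF|exact: test_fun_measurable].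
- have := integrableZl mO B (integrable_norm iF); by [].
- by move=> x _; rewrite normrM mulrC ler_wpM2r.
Qed.

Lemma test_fun_integrable phi : test_fun Omega phi -> lam.-integrable Omega (EFin \o phi).
Proof.
move=> tphi; have [B _ hB] := test_fun_bounded tphi.
by apply: (integrable_bounded mO fO (B := B)) => //; exact: test_fun_measurable.
Qed.

Lemma Rintegral_supp f : (forall x, ~ Omega x -> f x = 0) ->
  \int[lam]_(x in Omega) f x = \int[lam]_x f x.
Proof.
move=> f0; rewrite Rintegral_mkcond; apply: eq_Rintegral => x _.
by rewrite patchE; case: ifPn => // /negP; rewrite inE => /f0.
Qed.

Lemma integral_test_partial phi i : test_fun Omega phi ->
  \int[lam]_(x in Omega) partial i phi x = 0.
Proof.
move=> tphi; have [sphi _ _] := tphi; have [M vM] := test_fun_vanish tphi.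
have tp := test_fun_partial i tphi.
rewrite Rintegral_supp; last by move=> x; exact: test_fun_out.
apply: (integral_partial0 _ _ _ vM).
- by move=> x; exact: smooth_derivable.
- exact: smooth_continuous.
- by apply: smooth_continuous; exact: smooth_partial.
Qed.

(** The product of f and phi is a test function, so its partial
    derivative has integral 0. *)
Lemma integration_by_parts_test f phi i : smooth f -> test_fun Omega phi ->
  \int[lam]_(x in Omega) (f x * partial i phi x) =
  - \int[lam]_(x in Omega) (partial i f x * phi x).
Proof.
move=> sf tphi; have [sphi _ _] := tphi.
have t1 : test_fun Omega (fun x => f x * phi x) by exact: test_fun_smoothM.
have t2 : test_fun Omega (fun x => f x * partial i phi x).
  exact: (test_fun_smoothM sf (test_fun_partial i tphi)).
have t3 : test_fun Omega (fun x => partial i f x * phi x).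
  exact: (test_fun_smoothM (smooth_partial i sf) tphi).
have := integral_test_partial i t1.
under eq_Rintegral => x _.
  rewrite /partial (derivable_pointwiseM (smooth_derivable sf) (smooth_derivable sphi)).2.
  rewrite -/(partial i phi x) -/(partial i f x) [phi x * _]mulrC.
over.
rewrite RintegralD//; [|exact: test_fun_integrable|exact: test_fun_integrable].
by move/eqP; rewrite addr_eq0 => /eqP.
Qed.

Lemma is_wgrad_grad phi : test_fun Omega phi -> is_wgrad Omega phi (grad phi).
Proof.
move=> [sphi _ _] psi tpsi i; rewrite integration_by_parts_test//.
by congr (- _); apply: eq_Rintegral => x _; rewrite mxE.
Qed.

Lemma measurable_grad phi : test_fun Omega phi -> measurable_fun Omega (grad phi).
Proof.
move=> tphi; apply: measurable_fun_coords => // i.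
under eq_fun do rewrite mxE; apply: test_fun_measurable; exact: test_fun_partial.
Qed.

Lemma test_fun_Lp p phi : 0 < p -> test_fun Omega phi -> Lp Omega p phi.
Proof.
move=> p0 tphi; have [B _ hB] := test_fun_bounded tphi.
by apply: (Lp_bounded mO fO p0 (B := B)) => //; exact: test_fun_measurable.
Qed.

Lemma enorm_le_coords (B : R) (x : V) : 0 <= B -> (forall i, `|x ord0 i| <= B) ->
  enorm x <= Num.sqrt (d%:R * B ^+ 2).
Proof.
move=> B0 h; apply: ler_wsqrtr; rewrite /dotv.
have -> : d%:R * B ^+ 2 = \sum_(i < d) B ^+ 2.
  by rewrite sumr_const card_ord mulr_natl.
apply: ler_sum => i _; rewrite -expr2 -real_normK ?num_real//.
by rewrite lerXn2r// ?nnegrE.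
Qed.

Lemma grad_bounded phi : test_fun Omega phi -> exists B : R, forall x, enorm (grad phi x) <= B.
Proof.
move=> tphi.
have /choice[B hB] : forall i : 'I_d, exists B : R, 0 <= B /\ forall x, `|partial i phi x| <= B.
  by move=> i; have [B B0 hB] := test_fun_bounded (test_fun_partial i tphi); exists B.
exists (Num.sqrt (d%:R * (\sum_i B i) ^+ 2)) => x; apply: enorm_le_coords.
  by apply: sumr_ge0 => i _; case: (hB i).
move=> i; rewrite mxE (le_trans ((hB i).2 x))// (bigD1 i)//= lerDl.
by apply: sumr_ge0 => j _; case: (hB j).
Qed.

Lemma test_fun_LpV p phi : 0 < p -> test_fun Omega phi -> LpV Omega p (grad phi).
Proof.
move=> p0 tphi; have [B hB] := grad_bounded tphi.
split; first exact: measurable_grad.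
apply: (Lp_bounded mO fO p0 (B := B)); first by apply: measurable_enorm; exact: measurable_grad.
by move=> x _; rewrite ger0_norm ?enorm_ge0.
Qed.

Lemma grad_lin (a : R) phi psi x : smooth phi -> smooth psi ->
  grad (fun x => a * phi x + psi x) x = a *: grad phi x + grad psi x.
Proof.
move=> s1 s2; apply/rowP => i; rewrite !mxE /partial.
have h1 : derivable (fun x => a * phi x) x (delta_mx ord0 i) /\
   'D_(delta_mx ord0 i) (fun x => a * phi x) x = a * 'D_(delta_mx ord0 i) phi x.
  have := derivable_pointwiseM (derivable_cst a x (delta_mx ord0 i)) (smooth_derivable s1 (i := i) (x := x)).
  by rewrite derive_cst mulr0 addr0.
by rewrite (derivable_pointwiseD h1.1 (smooth_derivable s2)).2 h1.2.
Qed.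

End test_functions.

(** * Weak gradients *)

Section weak_gradients.
Variables (R : realType) (d : nat) (Omega : set 'rV[R]_d).
Hypotheses (oO : open Omega) (bO : bounded_set Omega).
Local Notation V := 'rV[R]_d.
Local Notation lam := (lebesgue_rV R d).
Implicit Types (f g phi psi : V -> R) (F G : V -> V).

Let mO : measurable Omega. Proof. exact: open_measurable_rV. Qed.
Let fO : (lam Omega < +oo)%E. Proof. exact: bounded_set_lam. Qed.

Lemma ae_eq_Rintegral f g : measurable_fun Omega f -> measurable_fun Omega g ->
  {ae lam, forall x, Omega x -> f x = g x} ->
  \int[lam]_(x in Omega) f x = \int[lam]_(x in Omega) g x.
Proof.
move=> mf mg fg; congr fine; apply: ae_eq_integral => //; try exact/measurable_EFinP.
by apply: filterS fg => x h Ox; rewrite h.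
Qed.

Lemma ae_eq_tests f g : lam.-integrable Omega (EFin \o f) -> lam.-integrable Omega (EFin \o g) ->
  (forall phi, test_fun Omega phi ->
     \int[lam]_(x in Omega) (f x * phi x) = \int[lam]_(x in Omega) (g x * phi x)) ->
  {ae lam, forall x, Omega x -> f x = g x}.
Proof.
move=> iF iG h.
have ifg : lam.-integrable Omega (EFin \o (fun x => f x - g x)).
  exact: (integrableB mO iF iG).
have := @fundamental_lemma R d Omega oO (fun x => f x - g x) ifg _.
move=> H; suff : {ae lam, forall x, Omega x -> f x - g x = 0}.
  by apply: filterS => x hx Ox; apply/eqP; rewrite -subr_eq0 hx.
apply: H => phi tphi.
under eq_Rintegral do rewrite mulrBl.
rewrite RintegralB ?h ?subrr//; exact: integrableM_test.
Qed.

Lemma ae_eq_coords F G :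
  (forall i, {ae lam, forall x, Omega x -> F x ord0 i = G x ord0 i}) ->
  {ae lam, forall x, Omega x -> F x = G x}.
Proof.
move=> h; have h' (n : nat) : {ae lam, forall x, forall i : 'I_d, i = n :> nat -> Omega x -> F x ord0 i = G x ord0 i}.
  have [nd|dn] := ltnP n d.
    have := h (Ordinal nd); apply: filterS => x hx i iE Ox.
    by rewrite (_ : i = Ordinal nd) ?hx//; exact/val_inj.
  by apply: aeW => x i iE; have := ltn_ord i; rewrite iE ltnNge dn.
have := ae_foralln h'; apply: filterS => x hx Ox.
by apply/rowP => i; exact: (hx i).
Qed.

Lemma wgrad_unique p p' f F G : 1 <= p -> 1 <= p' ->
  LpV Omega p F -> LpV Omega p' G -> is_wgrad Omega f F -> is_wgrad Omega f G ->
  {ae lam, forall x, Omega x -> F x = G x}.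
Proof.
move=> p1 p1' LF LG wF wG; apply: ae_eq_coords => i.
apply: ae_eq_tests; [exact: LpV_coord_integrable LF|exact: LpV_coord_integrable LG|].
move=> phi tphi; apply: oppr_inj; by rewrite -wF// -wG.
Qed.

Lemma is_wgrad_lin (a : R) f g F G p : 1 <= p -> Lp Omega p f -> Lp Omega p g ->
  LpV Omega p F -> LpV Omega p G -> is_wgrad Omega f F -> is_wgrad Omega g G ->
  is_wgrad Omega (fun x => a * f x + g x) (fun x => a *: F x + G x).
Proof.
move=> p1 Lf Lg LF LG wf wg phi tphi i.
have if_ := Lp_integrable mO fO p1 Lf; have ig := Lp_integrable mO fO p1 Lg.
have iF := LpV_coord_integrable mO fO i p1 LF; have iG := LpV_coord_integrable mO fO i p1 LG.
have tp := test_fun_partial i tphi.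
under eq_Rintegral do rewrite mulrDl -mulrA.
under [in RHS]eq_Rintegral do rewrite !mxE mulrDl -mulrA.
have Z h psi : lam.-integrable Omega (EFin \o h) -> test_fun Omega psi ->
    lam.-integrable Omega (EFin \o (fun x => a * (h x * psi x))).
  by move=> ih tpsi; exact: (integrableZl mO a (integrableM_test oO ih tpsi)).
rewrite !RintegralD//; [|exact: Z|exact: (integrableM_test oO)|exact: Z|exact: (integrableM_test oO)].
rewrite !RintegralZl//; [|exact: (integrableM_test oO)|exact: (integrableM_test oO)].
by rewrite wf// wg// mulrN -opprD.
Qed.

Lemma wgradP p f : W1p Omega p f -> LpV Omega p (wgrad Omega p f) /\ is_wgrad Omega f (wgrad Omega p f).
Proof. by move=> [_ [G LG wG]]; apply: (@getPex _ [set G | LpV Omega p G /\ is_wgrad Omega f G]); exists G. Qed.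

Lemma Lp_pow_ae p f g : measurable_fun Omega f -> measurable_fun Omega g ->
  {ae lam, forall x, Omega x -> f x = g x} -> Lp_pow Omega p f = Lp_pow Omega p g.
Proof.
move=> mf mg fg; apply: ae_eq_Rintegral; try exact: measurable_abs_powR.
by apply: filterS fg => x h Ox; rewrite h.
Qed.

Lemma Lp_sub p f g : 0 < p -> Lp Omega p f -> Lp Omega p g -> Lp Omega p (fun x => f x - g x).
Proof.
move=> p0 Lf Lg; rewrite (_ : (fun x => _) = (fun x => -1 * g x + f x)).
  exact: Lp_lin.
by apply/funext => x; rewrite mulN1r addrC.
Qed.

Lemma LpV_sub p F G : 0 < p -> LpV Omega p F -> LpV Omega p G -> LpV Omega p (fun x => F x - G x).
Proof.
move=> p0 LF LG; rewrite (_ : (fun x => _) = (fun x => -1 *: G x + F x)).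
  exact: LpV_lin.
by apply/funext => x; rewrite scaleN1r addrC.
Qed.

(** The definition refers to a chosen weak gradient.  As weak gradients are
    unique up to null sets, membership can be checked with any of them. *)
Lemma W1p0_intro p f G (phi : nat -> V -> R) : 1 <= p -> Lp Omega p f -> LpV Omega p G ->
  is_wgrad Omega f G -> (forall n, test_fun Omega (phi n)) ->
  (fun n => Lp_pow Omega p (fun x => phi n x - f x)) @ \oo --> (0 : R) ->
  (fun n => Lp_pow Omega p (fun x => enorm (grad (phi n) x - G x))) @ \oo --> (0 : R) ->
  W1p0 Omega p f.
Proof.
move=> p1 Lf LG wG tphi c1 c2; have p0 : 0 < p by exact: lt_le_trans p1.
have Wf : W1p Omega p f by split => //; exists G.
have [Lw ww] := wgradP Wf.
split => //; exists phi => //; split.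
  apply/(cvg_Lp_norm0 mO) => // n; apply: Lp_sub => //; exact: test_fun_Lp.
have LD n : LpV Omega p (fun x => grad (phi n) x - wgrad Omega p f x).
  by apply: LpV_sub => //; exact: test_fun_LpV.
apply/(@cvg_Lp_norm0 _ _ _ mO p (fun n x => enorm (grad (phi n) x - wgrad Omega p f x)) p0 (fun n => (LD n).2)).
have E n : Lp_pow Omega p (fun x => enorm (grad (phi n) x - wgrad Omega p f x)) =
    Lp_pow Omega p (fun x => enorm (grad (phi n) x - G x)).
  apply: Lp_pow_ae.
  - by apply: measurable_enorm; case: (LD n).
  - apply: measurable_enorm.
    by have [] := LpV_sub p0 (test_fun_LpV oO bO p0 (tphi n)) LG.
  - by apply: filterS (wgrad_unique p1 p1 Lw LG ww wG) => x h Ox; rewrite h.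
by rewrite (funext E).
Qed.

Lemma W1p0_elim p f : 1 <= p -> W1p0 Omega p f ->
  [/\ Lp Omega p f, LpV Omega p (wgrad Omega p f), is_wgrad Omega f (wgrad Omega p f) &
   exists2 phi : nat -> V -> R, forall n, test_fun Omega (phi n) &
    (fun n => Lp_pow Omega p (fun x => phi n x - f x)) @ \oo --> (0 : R) /\
    (fun n => Lp_pow Omega p (fun x => enorm (grad (phi n) x - wgrad Omega p f x))) @ \oo --> (0 : R)].
Proof.
move=> p1 [Wf [phi tphi [c1 c2]]]; have p0 : 0 < p by exact: lt_le_trans p1.
have [Lw ww] := wgradP Wf; have [Lf _] := Wf.
split => //; exists phi => //; split.
  apply/(cvg_Lp_norm0 mO) => // n; apply: Lp_sub => //; exact: test_fun_Lp.
have LD n : LpV Omega p (fun x => grad (phi n) x - wgrad Omega p f x).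
  by apply: LpV_sub => //; exact: test_fun_LpV.
exact/(@cvg_Lp_norm0 _ _ _ mO p (fun n x => enorm (grad (phi n) x - wgrad Omega p f x)) p0 (fun n => (LD n).2)).
Qed.

Lemma wgrad_lin p (a : R) f g : 1 <= p -> W1p0 Omega p f -> W1p0 Omega p g ->
  W1p0 Omega p (fun x => a * f x + g x) /\
  {ae lam, forall x, Omega x -> wgrad Omega p (fun x => a * f x + g x) x =
     a *: wgrad Omega p f x + wgrad Omega p g x}.
Proof.
move=> p1 /(W1p0_elim p1)[Lf LF wF [phi tphi [c1 c2]]] /(W1p0_elim p1)[Lg LG wG [psi tpsi [c3 c4]]].
have p0 : 0 < p by exact: lt_le_trans p1.
set F := wgrad Omega p f in LF wF c2 *; set G := wgrad Omega p g in LG wG c4 *.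
have wFG : is_wgrad Omega (fun x => a * f x + g x) (fun x => a *: F x + G x).
  exact: (is_wgrad_lin a p1).
have LFG : LpV Omega p (fun x => a *: F x + G x) by exact: LpV_lin.
have Lfg : Lp Omega p (fun x => a * f x + g x) by exact: Lp_lin.
have W0 : W1p0 Omega p (fun x => a * f x + g x).
  apply: (W1p0_intro p1 Lfg LFG wFG (phi := fun n x => a * phi n x + psi n x)).
  - by move=> n; exact: test_fun_lin.
  - apply: (cvg_Lp_pow_lin mO (a := a) p0 _ _ _ _ c1 c3).
    + by move=> n; apply: Lp_sub => //; exact: test_fun_Lp.
    + by move=> n; apply: Lp_sub => //; exact: test_fun_Lp.
    + move=> n; have [] := (LpP mO _ p0).1 (Lp_sub p0 (test_fun_Lp oO bO p0 (test_fun_lin a (tphi n) (tpsi n))) Lfg).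
      by [].
    + move=> n x _; rewrite -normrM (_ : _ - _ = a * (phi n x - f x) + (psi n x - g x)); last by ring.
      exact: ler_normD.
  - apply: (cvg_Lp_pow_lin mO (a := a) p0 _ _ _ _ c2 c4).
    + by move=> n; have [] := LpV_sub p0 (test_fun_LpV oO bO p0 (tphi n)) LF.
    + by move=> n; have [] := LpV_sub p0 (test_fun_LpV oO bO p0 (tpsi n)) LG.
    + move=> n; apply: measurable_enorm.
      by have [] := LpV_sub p0 (test_fun_LpV oO bO p0 (test_fun_lin a (tphi n) (tpsi n))) LFG.
    + move=> n x _; have [s1 _ _] := tphi n; have [s2 _ _] := tpsi n.
      rewrite grad_lin// (_ : _ - _ = a *: (grad (phi n) x - F x) + (grad (psi n) x - G x)); last first.
        by rewrite scalerBr opprD addrACA.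
      move: (grad (phi n) x - F x) (grad (psi n) x - G x) => A B.
      have := enormD (a *: A) B; rewrite enormZ.
      move: (enorm_ge0 (a *: A + B)) (enorm_ge0 A) (enorm_ge0 B).
      move: (enorm (a *: A + B)) (enorm A) (enorm B) => u v w u0 v0 w0.
      by rewrite (ger0_norm u0) (ger0_norm v0) (ger0_norm w0).
split => //; have [_ Lw ww _] := W1p0_elim p1 W0.
exact: (wgrad_unique p1 p1 Lw LFG ww wFG).
Qed.

Lemma test_fun_W1p0 p phi : 1 <= p -> test_fun Omega phi ->
  W1p0 Omega p phi /\ {ae lam, forall x, Omega x -> wgrad Omega p phi x = grad phi x}.
Proof.
move=> p1 tphi; have p0 : 0 < p by exact: lt_le_trans p1.
have Lphi := test_fun_Lp oO bO p0 tphi; have Lg := test_fun_LpV oO bO p0 tphi.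
have w := is_wgrad_grad oO bO tphi.
have z (h : V -> R) : h = (fun=> 0) -> Lp_pow Omega p h = 0.
  move=> ->; rewrite /Lp_pow; under eq_Rintegral do rewrite normr0 powR0 ?gt_eqF//.
  by rewrite Rintegral_cst// mul0r.
have W0 : W1p0 Omega p phi.
  apply: (W1p0_intro p1 Lphi Lg w (phi := fun=> phi)) => //.
    under eq_fun => n. rewrite z; last by apply/funext => x; rewrite subrr. over.
    exact: cvg_cst.
  under eq_fun => n. rewrite z; last by apply/funext => x; rewrite subrr enorm0. over.
  exact: cvg_cst.
split => //; have [_ Lw ww _] := W1p0_elim p1 W0.
exact: (wgrad_unique p1 p1 Lw Lg ww w).
Qed.

End weak_gradients.

(** * Square integrable functions and Poincare's inequality *)

Section hilbert.
Variables (R : realType) (d : nat) (Omega : set 'rV[R]_d).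
Hypotheses (oO : open Omega) (bO : bounded_set Omega).
Local Notation V := 'rV[R]_d.
Local Notation lam := (lebesgue_rV R d).
Implicit Types (f g h phi : V -> R) (F G H : V -> V).

Let mO : measurable Omega. Proof. exact: open_measurable_rV. Qed.
Let p0 : (0 : R) < 2. Proof. by rewrite ltr0n. Qed.

(** The discriminant of a nonnegative quadratic polynomial.  Besides
    Cauchy-Schwarz inequalities it gives the Euler-Lagrange estimate for almost
    minimizers of the Dirichlet energy. *)
Lemma discriminant_le (A B C : R) : 0 <= A -> 0 <= C ->
  (forall t, 0 <= A * t ^+ 2 + 2 * B * t + C) -> B ^+ 2 <= A * C.
Proof.
move=> A0 C0 h; have [A00|An0] := eqVneq A 0.
  have [->|B0] := eqVneq B 0; first by rewrite expr0n mulr_ge0.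
  have := h (- (C + 1) / (2 * B)).
  rewrite A00 !mul0r add0r mulrC divfK ?mulf_neq0 ?pnatr_eq0// => ?; exfalso; lra.
have Ap : 0 < A by rewrite lt_def An0.
have := h (- B / A).
have -> : A * (- B / A) ^+ 2 + 2 * B * (- B / A) + C = (A * C - B ^+ 2) / A by field.
by rewrite pmulr_lge0 ?invr_gt0// subr_ge0.
Qed.

Lemma Lp_pow2E f : Lp_pow Omega 2 f = \int[lam]_(x in Omega) (f x ^+ 2).
Proof. by apply: eq_Rintegral => x _; rewrite powR_mulrn// real_normK// num_real. Qed.

Lemma Lp2P f : Lp Omega 2 f <-> measurable_fun Omega f /\
  lam.-integrable Omega (EFin \o (fun x => f x ^+ 2)).
Proof.
have E : (fun x => `|f x| `^ 2) = (fun x => f x ^+ 2).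
  by apply/funext => x; rewrite powR_mulrn// real_normK// num_real.
by have := LpP mO f p0; rewrite E.
Qed.

Lemma Lp2_mul f g : Lp Omega 2 f -> Lp Omega 2 g ->
  lam.-integrable Omega (EFin \o (fun x => f x * g x)).
Proof.
move=> /Lp2P[mf if2] /Lp2P[mg ig2].
apply: (integrable_le mO (g := fun x => f x ^+ 2 + g x ^+ 2)).
- exact: measurable_funM.
- exact: (integrableD mO if2 ig2).
- move=> x _; rewrite normrM -(real_normK (num_real (f x))) -(real_normK (num_real (g x))).
  have := sqr_ge0 (`|f x| - `|g x|); rewrite sqrrB.
  have := mulr_ge0 (normr_ge0 (f x)) (normr_ge0 (g x)); lra.
Qed.

Lemma L2_cauchy_schwarz f g : Lp Omega 2 f -> Lp Omega 2 g ->
  (\int[lam]_(x in Omega) (f x * g x)) ^+ 2 <= Lp_pow Omega 2 f * Lp_pow Omega 2 g.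
Proof.
move=> Lf Lg; apply: discriminant_le; try exact: Lp_pow_ge0.
move=> t; have Lh := Lp_lin mO t p0 Lf Lg.
have := Lp_pow_ge0 Omega 2 (fun x => t * f x + g x).
have [_ if2] := (Lp2P f).1 Lf; have [_ ig2] := (Lp2P g).1 Lg; have ifg := Lp2_mul Lf Lg.
have i1 : lam.-integrable Omega (EFin \o (fun x => t ^+ 2 * f x ^+ 2)) := integrableZl mO (t ^+ 2) if2.
have i2 : lam.-integrable Omega (EFin \o (fun x => (2 * t) * (f x * g x))) := integrableZl mO (2 * t) ifg.
have i3 : lam.-integrable Omega (EFin \o (fun x => t ^+ 2 * f x ^+ 2 + (2 * t) * (f x * g x))) := integrableD mO i1 i2.
rewrite !Lp_pow2E; under eq_Rintegral.
  move=> x _; rewrite (_ : _ ^+ 2 = t ^+ 2 * f x ^+ 2 + (2 * t) * (f x * g x) + g x ^+ 2); last by ring.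
over.
rewrite RintegralD// RintegralD// RintegralZl// RintegralZl//; lra.
Qed.

Lemma LpV_dotv F G : LpV Omega 2 F -> LpV Omega 2 G ->
  lam.-integrable Omega (EFin \o (fun x => dotv (F x) (G x))).
Proof.
move=> [mF LF] [mG LG]; apply: (integrable_le mO _ (Lp2_mul LF LG)).
  exact: measurable_dotv.
by move=> x _; exact: norm_dotv_le.
Qed.

Definition L2_inner F G := \int[lam]_(x in Omega) dotv (F x) (G x).

Lemma L2_innerC F G : L2_inner F G = L2_inner G F.
Proof. by apply: eq_Rintegral => x _; rewrite dotvC. Qed.

Lemma L2_inner_ge0 F : 0 <= L2_inner F F.
Proof. by apply: Rintegral_ge0 => x _; exact: dotv_ge0. Qed.

Lemma L2_inner_lin (a : R) F G H : LpV Omega 2 F -> LpV Omega 2 G -> LpV Omega 2 H ->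
  L2_inner (fun x => a *: F x + G x) H = a * L2_inner F H + L2_inner G H.
Proof.
move=> LF LG LH; rewrite /L2_inner; under eq_Rintegral do rewrite dotvDl dotvZl.
have i1 := LpV_dotv LF LH; have i2 := LpV_dotv LG LH.
rewrite RintegralD//; last exact: (integrableZl mO a i1).
by rewrite RintegralZl.
Qed.

Lemma L2_inner_cauchy_schwarz F G : LpV Omega 2 F -> LpV Omega 2 G ->
  (L2_inner F G) ^+ 2 <= L2_inner F F * L2_inner G G.
Proof.
move=> LF LG; apply: discriminant_le; try exact: L2_inner_ge0.
move=> t; have Lh := LpV_lin mO t p0 LF LG.
have := L2_inner_ge0 (fun x => t *: F x + G x).
have E H : LpV Omega 2 H -> L2_inner H (fun x => t *: F x + G x) = t * L2_inner F H + L2_inner G H.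
  by move=> LH; rewrite L2_innerC L2_inner_lin.
rewrite L2_inner_lin// !E// (L2_innerC G F); lra.
Qed.

Lemma Lp_pow_enormE F : Lp_pow Omega 2 (fun x => enorm (F x)) = L2_inner F F.
Proof. by rewrite Lp_pow2E; apply: eq_Rintegral => x _; rewrite sqr_enorm. Qed.

Lemma L2_inner_ae F F' G G' : LpV Omega 2 F -> LpV Omega 2 G -> LpV Omega 2 F' -> LpV Omega 2 G' ->
  {ae lam, forall x, Omega x -> F x = F' x} -> {ae lam, forall x, Omega x -> G x = G' x} ->
  L2_inner F G = L2_inner F' G'.
Proof.
move=> [mF _] [mG _] [mF' _] [mG' _] FF GG; apply: ae_eq_Rintegral => //; try exact: measurable_dotv.
by apply: filterS2 FF GG => x h1 h2 Ox; rewrite h1// h2.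
Qed.

Lemma smooth_coord (i : 'I_d) : smooth (fun x : V => x ord0 i).
Proof.
pose S := [set f : V -> R | f = (fun x => x ord0 i) \/ exists c : R, f = fun=> c].
have e (x v : V) : (fun h : R => h^-1 *: ((h *: v + x) ord0 i - x ord0 i)) @ 0^' --> v ord0 i.
  apply: (@cvg_trans _ ((fun=> v ord0 i) @ (0 : R)^')); last exact: cvg_cst.
  apply: near_eq_cvg; near=> h; rewrite /= !mxE addrK -[RHS]/(_ * _) mulrA mulVf ?mul1r//.
  by near: h; exact: nbhs_dnbhs_neq.
apply: (smooth_family (S := S)); last by left.
move=> _ [->|[c ->]]; split.
- by move=> x; exact: coord_continuous.
- by move=> j x; apply/cvg_ex; eexists; exact: e.
- move=> j; right; exists ((delta_mx ord0 j : V) ord0 i); apply/funext => x.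
  by apply/cvg_lim => //; exact: e.
- by move=> x; exact: cst_continuous.
- by move=> j x; exact: derivable_cst.
- by move=> j; right; exists 0; apply/funext => x; exact: derive_cst.
Unshelve. all: by end_near. Qed.

Lemma partial_coord (i : 'I_d) x : partial i (fun x : V => x ord0 i) x = 1.
Proof.
rewrite /partial /derive; apply/cvg_lim => //.
apply: (@cvg_trans _ ((fun=> 1) @ (0 : R)^')); last exact: cvg_cst.
apply: near_eq_cvg; near=> h; rewrite /= !mxE !eqxx addrK -[RHS]/(_ * _) mulr1 mulVf//.
by near: h; exact: nbhs_dnbhs_neq.
Unshelve. all: by end_near. Qed.

(** Since the coordinate x_i has partial derivative 1, integration by parts
    gives int phi^2 = -2 int x_i phi d_i phi.  As |x_i| is bounded on Omega, the
    right-hand side is at most half of int phi^2 plus a multiple of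
    int (d_i phi)^2. *)
(** [poincare_test] passes to limits of test functions; the powers of 2 come from
    the crude triangle inequality of [integrable_pow_lin]. *)
Lemma poincare_test (i : 'I_d) : exists2 C : R, 0 <= C &
  forall phi, test_fun Omega phi -> Lp_pow Omega 2 phi <= C * L2_inner (grad phi) (grad phi).
Proof.
have [M [_ hM]] := bO; pose K : R := `|M| + 1.
have xK x : Omega x -> `|x ord0 i| <= K.
  move=> Ox; apply: (@le_trans _ _ `|x|).
    by rewrite [leRHS]mx_normrE; apply: (le_trans _ (le_bigmax _ _ (ord0, i))).
  by apply: (hM K) => //; rewrite /K ltr_pwDr// ler_norm.
(* 4 K^2 comes from 2 |x_i b c| <= b^2 / 2 + 2 K^2 c^2 with b = phi, c = d_i phi *)
exists (4 * K ^+ 2) => [|phi tphi]; first by rewrite mulr_ge0// sqr_ge0.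
have [sphi _ _] := tphi.
have sx := smooth_coord i.
have tp := test_fun_partial i tphi.
have t1 : test_fun Omega (fun x => phi x * phi x) by exact: test_fun_smoothM.
have t2 : test_fun Omega (fun x => x ord0 i * phi x * partial i phi x).
  exact: (test_fun_smoothM (smoothM sx sphi) tp).
have t3 : test_fun Omega (fun x => partial i phi x * partial i phi x).
  exact: (test_fun_smoothM (smooth_partial i sphi) tp).
have int := test_fun_integrable oO bO.
have := integration_by_parts_test oO bO i (smoothM sx sphi) tphi.
under [in X in _ = X -> _]eq_Rintegral => x _.
  rewrite {1}/partial (derivable_pointwiseM (smooth_derivable sx) (smooth_derivable sphi)).2.
  rewrite -/(partial i phi x) -/(partial i (fun x : V => x ord0 i) x) partial_coord mulr1.
  rewrite mulrDl addrC -[x ord0 i * _ * _]mulrA [partial i phi x * _]mulrC mulrA.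
over.
rewrite RintegralD//; [|exact: int|exact: int].
set A := \int[lam]_(x in Omega) (x ord0 i * phi x * partial i phi x).
set B := \int[lam]_(x in Omega) (phi x * phi x) => E.
have EB : B = - 2 * A by lra.
have -> : Lp_pow Omega 2 phi = B.
  by rewrite Lp_pow2E; apply: eq_Rintegral => x _; rewrite expr2.
pose D := \int[lam]_(x in Omega) (partial i phi x * partial i phi x).
have DG : D <= L2_inner (grad phi) (grad phi).
  have L := test_fun_LpV oO bO p0 tphi.
  apply: le_Rintegral => //; [exact: int|exact: LpV_dotv|].
  move=> x _; rewrite /dotv (bigD1 i)//= !mxE lerDl sumr_ge0// => j _.
  by rewrite -expr2 sqr_ge0.
suff H : - 2 * A <= 2^-1 * B + 2 * K ^+ 2 * D.
  have := ler_wpM2l (mulr_ge0 (ler0n R 4) (sqr_ge0 K)) DG; rewrite -/K. lra.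
rewrite /A /B /D -!RintegralZl//; [|exact: int..].
rewrite -RintegralD//; [|exact: (integrableZl mO _ (int _ t1))|exact: (integrableZl mO _ (int _ t3))].
apply: le_Rintegral => //; first exact: (integrableZl mO _ (int _ t2)).
  exact: (integrableD mO (integrableZl mO _ (int _ t1)) (integrableZl mO _ (int _ t3))).
move=> x Ox; have x2 : x ord0 i ^+ 2 <= K ^+ 2.
  by rewrite -real_normK ?num_real// lerXn2r ?nnegrE//; [exact: le_trans (xK x Ox)|exact: xK].
have := sqr_ge0 (phi x + 2 * (x ord0 i * partial i phi x)).
have := ler_wpM2r (sqr_ge0 (partial i phi x)) x2.
set a := x ord0 i; set b := phi x; set c := partial i phi x => h1 h2.
rewrite sqrrD in h2; lra.
Qed.

End hilbert.

(** * The Riesz-Fischer theorem *)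

Section completeness.
Variables (R : realType).

(** The explicit rate of convergence is what is squared and integrated
    later on. *)
Lemma geometric_cauchy_limit (c : R) (u : nat -> R) :
  (forall n, `|u n.+1 - u n| <= c * 2^-1 ^+ n) ->
  exists l, forall n, `|l - u n| <= 2 * c * 2^-1 ^+ n.
Proof.
move=> h.
have step n k : `|u (n + k)%N - u n| <= 2 * c * (2^-1 ^+ n - 2^-1 ^+ (n + k)).
  elim: k => [|k IH]; first by rewrite addn0 !subrr normr0 mulr0.
  rewrite addnS; have := h (n + k)%N; have := ler_normD (u (n + k).+1 - u (n + k)%N) (u (n + k)%N - u n).
  rewrite addrA subrK exprS; lra.
have c0 : 0 <= c by have := h 0; rewrite expr0 mulr1; apply: le_trans.
have q0 n : 0 <= 2^-1 ^+ n :> R by rewrite exprn_ge0.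
have vw m n : u m - 2 * c * 2^-1 ^+ m <= u n + 2 * c * 2^-1 ^+ n.
  have H a b : (a <= b)%N -> `|u b - u a| <= 2 * c * 2^-1 ^+ a - 2 * c * 2^-1 ^+ b.
    by move=> ab; have := step a (b - a)%N; rewrite subnKC// mulrBr.
  have pm := mulr_ge0 c0 (q0 m); have pn := mulr_ge0 c0 (q0 n).
  have [mn|/ltnW nm] := leqP m n.
    by have := H _ _ mn; rewrite ler_norml => /andP[]; lra.
  by have := H _ _ nm; rewrite ler_norml => /andP[]; lra.
pose S := [set u m - 2 * c * 2^-1 ^+ m | m in [set: nat]].
have hS : has_sup S.
  split; first by exists (u 0%N - 2 * c * 2^-1 ^+ 0), 0%N.
  by exists (u 0%N + 2 * c * 2^-1 ^+ 0) => _ [m _ <-]; exact: vw.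
exists (sup S) => n.
have h1 : u n - 2 * c * 2^-1 ^+ n <= sup S by apply: ub_le_sup; [case: hS|exists n].
have h2 : sup S <= u n + 2 * c * 2^-1 ^+ n.
  by apply: ge_sup; [case: hS|move=> _ [m _ <-]; exact: vw].
by rewrite ler_norml; lra.
Qed.

Variables (d : nat) (Omega : set 'rV[R]_d).
Local Notation V := 'rV[R]_d.
Local Notation lam := (lebesgue_rV R d).
Hypotheses (oO : open Omega) (bO : bounded_set Omega).
Let mO : measurable Omega. Proof. exact: open_measurable_rV. Qed.
Let p0 : (0 : R) < 2. Proof. by rewrite ltr0n. Qed.

Lemma cvg_half0 (K : R) : (fun n => K * 2^-1 ^+ n) @ \oo --> (0 : R).
Proof.
rewrite -[X in _ --> X](mulr0 K); apply: cvgM; first exact: cvg_cst.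
by apply: cvg_expr; rewrite ger0_norm// invf_lt1// ltr1n.
Qed.

Lemma integrable_le_ae (f g : V -> R) : measurable_fun Omega f ->
  lam.-integrable Omega (EFin \o g) -> (forall x, Omega x -> 0 <= g x) ->
  {ae lam, forall x, Omega x -> `|f x| <= g x} ->
  lam.-integrable Omega (EFin \o f) /\
  \int[lam]_(x in Omega) `|f x| <= \int[lam]_(x in Omega) g x.
Proof.
move=> mf ig g0 fg.
have mnf : measurable_fun Omega (fun x => `|f x|) by exact: measurableT_comp.
have le : (\int[lam]_(x in Omega) `|f x|%:E <= \int[lam]_(x in Omega) (g x)%:E)%E.
  apply: ae_ge0_le_integral => //.
  - exact/measurable_EFinP.
  - by apply/measurable_EFinP; exact: integrable_measurable ig.
have goo : (\int[lam]_(x in Omega) (g x)%:E < +oo)%E by exact: integrable_lty ig.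
have if_ : lam.-integrable Omega (EFin \o f).
  apply/integrableP; split; first exact/measurable_EFinP.
  exact: le_lt_trans goo.
split => //; rewrite /Rintegral; apply: fine_le => //.
  exact: (integrable_fin_num mO (integrable_norm if_)).
exact: (integrable_fin_num mO ig).
Qed.

(** The Riesz-Fischer theorem for fast Cauchy sequences.  The function
    g = sum_n 4^n (f_{n+1} - f_n)^2 is integrable, and at every point where it is
    finite |f_{n+1} - f_n| <= sqrt(g) 2^-n, which gives both a pointwise limit
    and its convergence in L^2. *)
Lemma L2_fast_cauchy (f : nat -> V -> R) : (forall n, Lp Omega 2 (f n)) ->
  (forall n, Lp_pow Omega 2 (fun x => f n.+1 x - f n x) <= 4^-1 ^+ n * 4^-1 ^+ n) ->
  exists2 l : V -> R, Lp Omega 2 l & (fun n => Lp_pow Omega 2 (fun x => f n x - l x)) @ \oo --> (0 : R).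
Proof.
move=> Lf fast.
pose e n x : R := 4 ^+ n * (f n.+1 x - f n x) ^+ 2.
have e0 n x : 0 <= e n x by rewrite mulr_ge0 ?sqr_ge0// exprn_ge0.
have mf n : measurable_fun Omega (f n) by have [] := (Lp2P oO (f n)).1 (Lf n).
have Ld n : Lp Omega 2 (fun x => f n.+1 x - f n x) by exact: Lp_sub.
have ie n : lam.-integrable Omega (EFin \o e n).
  by have [_ i2] := (Lp2P oO _).1 (Ld n); exact: (integrableZl mO (4 ^+ n) i2).
have me n : measurable_fun Omega (e n) := integrable_measurable (ie n).
have Ie n : \int[lam]_(x in Omega) e n x <= 4^-1 ^+ n.
  have [_ i2] := (Lp2P oO _).1 (Ld n).
  rewrite RintegralZl//; have := fast n; rewrite Lp_pow2E => h.
  apply: (le_trans (ler_wpM2l _ h)); first exact: exprn_ge0.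
  by rewrite mulrA -exprMn divff ?pnatr_eq0// expr1n mul1r.
pose g x : \bar R := (\sum_(0 <= n <oo) (e n x)%:E)%E.
have g0 x : (0 <= g x)%E by apply: nneseries_ge0 => n _ _; rewrite lee_fin.
have mg : measurable_fun Omega g.
  rewrite (_ : g = fun x => (\sum_(i <oo | i \in xpredT) (e i x)%:E)%E); last first.
    by apply/funext => x; apply: eq_eseriesl.
  apply: ge0_emeasurable_sum => //; first by move=> n x _ _; rewrite lee_fin.
  by move=> n _; apply/measurable_EFinP.
have Ig : (\int[lam]_(x in Omega) g x < +oo)%E.
  rewrite integral_nneseries//; last 2 first.
    by move=> n; apply/measurable_EFinP.
    by move=> n x _; rewrite lee_fin.
  apply: (@le_lt_trans _ _ (\sum_(0 <= n <oo) ((4^-1 : R) ^+ n)%:E)%E).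
    apply: lee_nneseries => [n _ _|n _]; first by apply: integral_ge0 => x _; rewrite lee_fin.
    have F := integrable_fin_num mO (ie n).
    by rewrite -(fineK F) lee_fin; exact: Ie.
  rewrite (_ : (\sum_(0 <= n <oo) _)%E = limn (EFin \o series (geometric 1 (4^-1 : R)))).
    have cg : cvgn (series (geometric 1 (4^-1 : R))).
      by apply: is_cvg_geometric_series; rewrite ger0_norm// invf_lt1// ltr1n.
    by rewrite EFin_lim// ltry.
  congr (limn _); apply/funext => n; rewrite /= /series /= -sumEFin.
  by apply: eq_bigr => i _; rewrite mul1r.
have ig : lam.-integrable Omega g.
  by apply/integrableP; split => //; under eq_integral do rewrite gee0_abs//.
pose A := Omega `&` [set x | g x \is a fin_num].
have mA : measurable A by exact: emeasurable_fin_num.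
pose c x : R := Num.sqrt (fine (g x)).
have key x : A x -> exists l, forall n, `|l - f n x| <= 2 * c x * 2^-1 ^+ n.
  move=> [_ gx]; apply: geometric_cauchy_limit => n.
  have le_g : e n x <= fine (g x).
    have nn k : xpredT k -> (0 <= (e k x)%:E)%E by rewrite lee_fin.
    rewrite -lee_fin fineK// /g (@nneseriesD1 _ (fun n => (e n x)%:E) n xpredT nn isT).
    by rewrite leeDl//; apply: nneseries_ge0 => k _ _; rewrite lee_fin.
  rewrite -ler_sqr ?nnegrE ?mulr_ge0 ?sqrtr_ge0 ?exprn_ge0//.
  rewrite real_normK ?num_real// exprMn sqr_sqrtr ?fine_ge0// exprAC.
  have -> : (2^-1 ^+ 2 : R) = 4^-1 by rewrite exprVn -natrX.
  by rewrite exprVn ler_pdivlMr ?exprn_gt0// mulrC.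
pose l x := get [set l | forall n, `|l - f n x| <= 2 * c x * 2^-1 ^+ n].
have lP x : A x -> forall n, `|l x - f n x| <= 2 * c x * 2^-1 ^+ n.
  by move=> /key[y hy]; exact: (@getPex _ [set l | forall n, `|l - f n x| <= 2 * c x * 2^-1 ^+ n] (ex_intro _ y hy)).
have ml : measurable_fun A l.
  apply: (@measurable_fun_cvg _ _ _ A f).
    by move=> n; apply: measurable_funS (mf n) => // x [].
  move=> x Ax; apply/cvgrPdist_le => eps eps0.
  have := cvg_half0 (2 * c x); move/cvgrPdist_le => /(_ _ eps0); apply: filterS => n.
  rewrite sub0r normrN => h; apply: (le_trans (lP x Ax n)); apply: le_trans h; exact: ler_norm.
(* off A, a null subset of Omega, the value 0 makes the limit measurable *)
pose l' := l \_ A.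
have ml' : measurable_fun Omega l'.
  have := (measurable_restrict l mA mO).1; apply.
  by apply: measurable_funS ml => //; exact: subIsetr.
have aeA : {ae lam, forall x, Omega x -> A x}.
  have := integrable_ae mO ig; apply: filterS => x h Ox; split => //; exact: h.
have ifg : lam.-integrable Omega (EFin \o (fun x => fine (g x))).
  apply: (le_integrable mO _ _ ig).
    by apply/measurable_EFinP; apply: measurableT_comp mg; exact: fine_measurable.
  move=> x Ox /=; rewrite [leRHS]gee0_abs//; case: (g x) (g0 x) => //= [r r0|_]; last by rewrite normr0 leey.
  by rewrite ger0_norm.
pose b n x := 4 * 4^-1 ^+ n * fine (g x).
have ib n : lam.-integrable Omega (EFin \o b n) := integrableZl mO _ ifg.
have b0 n x : Omega x -> 0 <= b n x.
  by move=> _; rewrite mulr_ge0 ?fine_ge0// mulr_ge0// exprn_ge0.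
have mD n : measurable_fun Omega (fun x => f n x - l' x) by exact: measurable_funB.
have mD2 n : measurable_fun Omega (fun x => (f n x - l' x) ^+ 2) by exact: measurable_funX.
have bound n : {ae lam, forall x, Omega x -> `|(f n x - l' x) ^+ 2| <= b n x}.
  apply: filterS aeA => x h Ox; have Ax := h Ox.
  rewrite normrX /l' patchE mem_set// distrC /b.
  have := lP x Ax n; rewrite -ler_sqr ?nnegrE//; last first.
    exact: le_trans (lP x Ax n).
  move/le_trans; apply; rewrite !exprMn sqr_sqrtr ?fine_ge0// exprAC.
  have -> : (2^-1 ^+ 2 : R) = 4^-1 by rewrite exprVn -natrX.
  by rewrite mulrAC -natrX.
have H n := integrable_le_ae (mD2 n) (ib n) (b0 n) (bound n).
have LD n : Lp Omega 2 (fun x => f n x - l' x) by apply/(Lp2P oO); split => //; case: (H n).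
exists l'.
  rewrite (_ : l' = fun x => -1 * (f 0%N x - l' x) + f 0%N x); first exact: Lp_lin.
  by apply/funext => x; ring.
pose I0 : R := \int[lam]_(x in Omega) fine (g x).
apply: (@squeeze_cvgr _ _ _ _ (fun=> 0) (fun n => (4 * I0) * 2^-1 ^+ n)).
- apply: nearW => n; rewrite Lp_pow_ge0/= Lp_pow2E.
  have [_ Hn] := H n.
  have -> : \int[lam]_(x in Omega) ((f n x - l' x) ^+ 2) = \int[lam]_(x in Omega) `|(f n x - l' x) ^+ 2|.
    by apply: eq_Rintegral => x _; rewrite ger0_norm// sqr_ge0.
  rewrite (le_trans Hn)// /b RintegralZl// -/I0 mulrAC -!mulrA ler_wpM2l// ler_wpM2l//.
    by apply: Rintegral_ge0 => x _; exact: fine_ge0.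
  by rewrite lerXn2r ?nnegrE// lef_pV2 ?posrE// ler_nat.
- exact: cvg_cst.
- exact: cvg_half0.
Qed.

End completeness.

(** * The Hilbert space H^1_0 *)

Section H10_hilbert.
Variables (R : realType) (d : nat) (Omega : set 'rV[R]_d).
Hypotheses (d0 : (0 < d)%N) (oO : open Omega) (bO : bounded_set Omega).
Local Notation V := 'rV[R]_d.
Local Notation lam := (lebesgue_rV R d).
Implicit Types (f g h phi : V -> R) (u : (V -> R) -> R).

Let mO : measurable Omega. Proof. exact: open_measurable_rV. Qed.
Let p1 : (1 : R) <= 2. Proof. by rewrite ler1n. Qed.
Let p0 : (0 : R) < 2. Proof. by rewrite ltr0n. Qed.
Local Notation W := (wgrad Omega 2).
Local Notation inner := (H10_inner Omega).
Local Notation norm := (H10_norm Omega).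

Lemma H10_LpV f : H10 Omega f -> LpV Omega 2 (W f).
Proof. by move=> /(W1p0_elim oO bO p1)[]. Qed.

Lemma H10_innerE f g : inner f g = L2_inner Omega (W f) (W g).
Proof. by []. Qed.

Lemma H10_normE f : H10 Omega f -> norm f = Num.sqrt (inner f f).
Proof.
move=> /H10_LpV LW; have [mW Le] := LW.
have -> : norm f = Lp_pow Omega 2 (fun x => enorm (W f x)) `^ 2^-1.
  by rewrite -[RHS]/(fine ((Lp_pow Omega 2 (fun x => enorm (W f x)) `^ 2^-1)%:E)) -(Lp_normE mO p0 Le).
by rewrite powR12_sqrt ?Lp_pow_ge0// Lp_pow_enormE.
Qed.

Lemma H10_inner_ge0 f : 0 <= inner f f.
Proof. exact: L2_inner_ge0. Qed.

Lemma H10_lin a f g : H10 Omega f -> H10 Omega g -> H10 Omega (fun x => a * f x + g x).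
Proof. by move=> Hf Hg; have [] := wgrad_lin oO bO a p1 Hf Hg. Qed.

Lemma H10_innerC f g : inner f g = inner g f.
Proof. exact: L2_innerC. Qed.

Lemma H10_inner_lin a f g h : H10 Omega f -> H10 Omega g -> H10 Omega h ->
  inner (fun x => a * f x + g x) h = a * inner f h + inner g h.
Proof.
move=> Hf Hg Hh; have [Hfg ae] := wgrad_lin oO bO a p1 Hf Hg.
have Lf := H10_LpV Hf; have Lg := H10_LpV Hg; have Lh := H10_LpV Hh.
have Lfg := H10_LpV Hfg; have L := LpV_lin mO a p0 Lf Lg.
have reflh : {ae lam, forall x, Omega x -> W h x = W h x} by apply: aeW.
by apply: etrans (L2_inner_lin oO a Lf Lg Lh); exact: (L2_inner_ae oO Lfg Lh L Lh ae reflh).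
Qed.

Lemma H10_cauchy_schwarz f g : H10 Omega f -> H10 Omega g -> `|inner f g| <= norm f * norm g.
Proof.
move=> Hf Hg; rewrite (H10_normE Hf) (H10_normE Hg).
have := L2_inner_cauchy_schwarz oO (H10_LpV Hf) (H10_LpV Hg); rewrite -!H10_innerE.
have := H10_inner_ge0 f; have := H10_inner_ge0 g.
move: (inner f g) (inner f f) (inner g g) => a b c c0 b0 h.
by rewrite -sqrtrM// -sqrtr_sqr ler_wsqrtr.
Qed.

Lemma H10_test phi : test_fun Omega phi -> H10 Omega phi.
Proof. by move=> /(test_fun_W1p0 oO bO p1)[]. Qed.

Lemma sub_linE f g : (fun x => f x - g x) = (fun x => -1 * g x + f x).
Proof. by apply/funext => x; rewrite mulN1r addrC. Qed.

Lemma H10_sub f g : H10 Omega f -> H10 Omega g -> H10 Omega (fun x => f x - g x).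
Proof. by move=> Hf Hg; rewrite sub_linE; exact: H10_lin. Qed.

Lemma wgrad_sub f g : H10 Omega f -> H10 Omega g ->
  {ae lam, forall x, Omega x -> W (fun x => f x - g x) x = W f x - W g x}.
Proof.
move=> Hf Hg; rewrite sub_linE; have [_] := wgrad_lin oO bO (-1) p1 Hg Hf.
by apply: filterS => x h Ox; rewrite h// scaleN1r addrC.
Qed.

Lemma H10_norm_ge0 f : H10 Omega f -> 0 <= norm f.
Proof. by move=> /H10_normE ->; exact: sqrtr_ge0. Qed.

Lemma sqr_H10_norm f : H10 Omega f -> norm f ^+ 2 = inner f f.
Proof. by move=> /H10_normE ->; rewrite sqr_sqrtr// H10_inner_ge0. Qed.

Lemma H10_norm_sub_grad phi f G : test_fun Omega phi -> H10 Omega f -> LpV Omega 2 G ->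
  {ae lam, forall x, Omega x -> W f x = G x} ->
  inner (fun x => phi x - f x) (fun x => phi x - f x) =
  Lp_pow Omega 2 (fun x => enorm (grad phi x - G x)).
Proof.
move=> tphi Hf LG fG; have Hphi := H10_test tphi; have Hs := H10_sub Hphi Hf.
rewrite Lp_pow_enormE.
have L : LpV Omega 2 (fun x => grad phi x - G x).
  by apply: LpV_sub => //; exact: test_fun_LpV.
have ae : {ae lam, forall x, Omega x -> W (fun x => phi x - f x) x = grad phi x - G x}.
  have [_ a1] := test_fun_W1p0 oO bO p1 tphi.
  apply: filterS3 (wgrad_sub Hphi Hf) a1 fG => x h1 h2 h3 Ox.
  by rewrite h1// h2// h3.
have LL := H10_LpV Hs.
exact: (L2_inner_ae oO LL LL L L ae ae).
Qed.

Lemma cvg_sqrt0 (v : nat -> R) : v @ \oo --> (0 : R) -> (fun n => Num.sqrt (v n)) @ \oo --> (0 : R).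
Proof.
move=> h; rewrite -[X in _ --> X]sqrtr0; apply: continuous_cvg => //.
exact: sqrt_continuous.
Qed.

Lemma H10_dense f : H10 Omega f -> exists2 phi : nat -> V -> R,
  forall n, test_fun Omega (phi n) &
  (fun n => norm (fun x => phi n x - f x)) @ \oo --> (0 : R).
Proof.
move=> Hf; have [_ LW _ [phi tphi [_ c]]] := W1p0_elim oO bO p1 Hf.
exists phi => //; have E n : norm (fun x => phi n x - f x) =
    Num.sqrt (Lp_pow Omega 2 (fun x => enorm (grad (phi n) x - W f x))).
  have Hs := H10_sub (H10_test (tphi n)) Hf.
  have reflf : {ae lam, forall x, Omega x -> W f x = W f x} by apply: aeW.
  by rewrite (H10_normE Hs) (H10_norm_sub_grad (tphi n) Hf LW reflf).
rewrite (funext E); exact: cvg_sqrt0 c.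
Qed.

Lemma poincare : exists2 C : R, 0 <= C & forall f, H10 Omega f -> Lp_pow Omega 2 f <= C * inner f f.
Proof.
have [C C0 hC] := poincare_test oO bO (Ordinal d0).
exists (2 `^ 2 * C * 2 `^ 2) => [|f Hf]; first by rewrite !mulr_ge0// powR_ge0.
have [Lf LW _ [phi tphi [c1 c2]]] := W1p0_elim oO bO p1 Hf.
pose a n := Lp_pow Omega 2 (fun x => phi n x - f x).
pose b n := Lp_pow Omega 2 (fun x => enorm (grad (phi n) x - W f x)).
have b2 n : Lp_pow Omega 2 f <= 2 `^ 2 * (a n + C * (2 `^ 2 * (b n + inner f f))).
  have Lphi := test_fun_Lp oO bO p0 (tphi n); have Lg := test_fun_LpV oO bO p0 (tphi n).
  have Ls := Lp_sub oO p0 Lphi Lf; have LGs := LpV_sub oO p0 Lg LW.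
  have [mf _] := (LpP mO f p0).1 Lf.
  have h1 x : Omega x -> `|f x| <= `|1 : R| * `|phi n x - f x| + `|phi n x|.
    move=> _; rewrite normr1 mul1r distrC -[f x in leLHS](subrK (phi n x)).
    exact: ler_normD.
  apply: (le_trans (integrable_pow_lin mO p0 Ls Lphi mf h1).2).
  rewrite normr1 powR1 mul1r ler_wpM2l ?powR_ge0// lerD2l.
  apply: (le_trans (hC _ (tphi n))); rewrite ler_wpM2l// -Lp_pow_enormE.
  have h2 x : Omega x -> `|enorm (grad (phi n) x)| <=
      `|1 : R| * `|enorm (grad (phi n) x - W f x)| + `|enorm (W f x)|.
    move=> _; rewrite normr1 mul1r !(ger0_norm (enorm_ge0 _)).
    by rewrite -[X in enorm X <= _](subrK (W f x)) enormD.
  apply: (le_trans (integrable_pow_lin mO p0 LGs.2 LW.2 (measurable_enorm Lg.1) h2).2).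
  by rewrite normr1 powR1 mul1r -[X in _ + X]/(Lp_pow Omega 2 (fun x => enorm (W f x))) (Lp_pow_enormE Omega (W f)).
have lim : (fun n => 2 `^ 2 * (a n + C * (2 `^ 2 * (b n + inner f f)))) @ \oo -->
    2 `^ 2 * (0 + C * (2 `^ 2 * (0 + inner f f))).
  apply: cvgM; first exact: cvg_cst.
  apply: cvgD; first exact: c1.
  apply: cvgM; first exact: cvg_cst.
  apply: cvgM; first exact: cvg_cst.
  by apply: cvgD; [exact: c2|exact: cvg_cst].
have -> : 2 `^ 2 * C * 2 `^ 2 * inner f f = 2 `^ 2 * (0 + C * (2 `^ 2 * (0 + inner f f))) by ring.
by rewrite -(cvg_lim _ lim)//; apply: limr_ge; [apply/cvg_ex; eexists; exact: lim|apply: nearW].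
Qed.

Lemma Hm1_sub u f g : Hm1 Omega u -> H10 Omega f -> H10 Omega g ->
  u (fun x => f x - g x) = u f - u g.
Proof. by move=> [lu _] Hf Hg; rewrite sub_linE lu// mulN1r addrC. Qed.

Lemma Hm1_bound u : Hm1 Omega u -> exists2 C : R, 0 <= C & forall f, H10 Omega f -> `|u f| <= C * norm f.
Proof.
move=> [_ [C hC]]; exists `|C| => // f Hf; apply: (le_trans (hC _ Hf)).
by rewrite ler_wpM2r ?H10_norm_ge0// ler_norm.
Qed.

Lemma Hm1_cvg u f (phi : nat -> V -> R) : Hm1 Omega u -> H10 Omega f ->
  (forall n, test_fun Omega (phi n)) ->
  (fun n => norm (fun x => phi n x - f x)) @ \oo --> (0 : R) ->
  (fun n => u (phi n)) @ \oo --> u f.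
Proof.
move=> Hu Hf tphi c; have [C C0 hC] := Hm1_bound Hu.
apply/cvgrPdist_le => e e0.
have c' : (fun n => C * norm (fun x => phi n x - f x)) @ \oo --> (0 : R).
  by rewrite -[X in _ --> X](mulr0 C); apply: cvgM => //; exact: cvg_cst.
move/cvgrPdist_le : c' => /(_ _ e0); apply: filterS => n; rewrite sub0r normrN => h.
have Hphi := H10_test (tphi n).
rewrite distrC -Hm1_sub//; apply: le_trans h; apply: le_trans (ler_norm _).
by apply: hC; exact: H10_sub.
Qed.

End H10_hilbert.

Section riesz.
Variables (R : realType) (d : nat) (Omega : set 'rV[R]_d).
Hypotheses (d0 : (0 < d)%N) (oO : open Omega) (bO : bounded_set Omega).
Local Notation V := 'rV[R]_d.
Local Notation lam := (lebesgue_rV R d).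
Implicit Types (f g h phi psi : V -> R).

Let mO : measurable Omega. Proof. exact: open_measurable_rV. Qed.
Let fO : (lam Omega < +oo)%E. Proof. exact: bounded_set_lam. Qed.
Let p1 : (1 : R) <= 2. Proof. by rewrite ler1n. Qed.
Let p0 : (0 : R) < 2. Proof. by rewrite ltr0n. Qed.
Local Notation W := (wgrad Omega 2).
Local Notation norm := (H10_norm Omega).

Lemma L2_weak_cvg (f_ : nat -> V -> R) f psi : (forall n, Lp Omega 2 (f_ n)) -> Lp Omega 2 f ->
  Lp Omega 2 psi -> (fun n => Lp_pow Omega 2 (fun x => f_ n x - f x)) @ \oo --> (0 : R) ->
  (fun n => \int[lam]_(x in Omega) (f_ n x * psi x)) @ \oo --> \int[lam]_(x in Omega) (f x * psi x).
Proof.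
move=> Lf_ Lf Lpsi c; apply/cvgrPdist_le => e e0.
have c' : (fun n => Num.sqrt (Lp_pow Omega 2 (fun x => f_ n x - f x) * Lp_pow Omega 2 psi)) @ \oo --> (0 : R).
  apply: cvg_sqrt0; rewrite -[X in _ --> X](mul0r (Lp_pow Omega 2 psi)).
  by apply: cvgM; [exact: c|exact: cvg_cst].
move/cvgrPdist_le : c' => /(_ _ e0); apply: filterS => n; rewrite sub0r normrN => h.
have Ls := Lp_sub oO p0 (Lf_ n) Lf.
have := L2_cauchy_schwarz oO Ls Lpsi.
have -> : \int[lam]_(x in Omega) ((f_ n x - f x) * psi x) =
  \int[lam]_(x in Omega) (f_ n x * psi x) - \int[lam]_(x in Omega) (f x * psi x).
  under eq_Rintegral do rewrite mulrBl.
  by apply: RintegralB => //; exact: (Lp2_mul oO).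
move=> cs; rewrite distrC; apply: le_trans h; apply: le_trans (ler_norm _).
by rewrite -sqrtr_sqr ler_wsqrtr.
Qed.

(** The functions and each of their partial derivatives have limits in L^2.
    Passing to the limit in the integration by parts formula shows that the limits
    of the partial derivatives form a weak gradient of the limit function. *)
Lemma H10_fast_cauchy (phi : nat -> V -> R) : (forall n, test_fun Omega (phi n)) ->
  (forall n, Lp_pow Omega 2 (fun x => phi n.+1 x - phi n x) <= 4^-1 ^+ n * 4^-1 ^+ n) ->
  (forall n i, Lp_pow Omega 2 (fun x => partial i (phi n.+1) x - partial i (phi n) x) <= 4^-1 ^+ n * 4^-1 ^+ n) ->
  exists2 f, H10 Omega f & (fun n => norm (fun x => phi n x - f x)) @ \oo --> (0 : R).
Proof.
move=> tphi fast fast'.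
have L2t psi : test_fun Omega psi -> Lp Omega 2 psi := test_fun_Lp oO bO p0.
have tp n i := test_fun_partial i (tphi n).
have [f Lf cf] := L2_fast_cauchy oO (fun n => L2t _ (tphi n)) fast.
have /choice[G hG] : forall i : 'I_d, exists g, Lp Omega 2 g /\
    (fun n => Lp_pow Omega 2 (fun x => partial i (phi n) x - g x)) @ \oo --> (0 : R).
  move=> i; have [g Lg cg] := L2_fast_cauchy oO (fun n => L2t _ (tp n i)) (fun n => fast' n i).
  by exists g.
pose F x : V := \row_i G i x.
have mF : measurable_fun Omega F.
  apply: measurable_fun_coords => // i; under eq_fun do rewrite mxE.
  by have [] := (LpP mO (G i) p0).1 (hG i).1.
have dotE (v w : V) : enorm (v - w) ^+ 2 = \sum_i (v ord0 i - w ord0 i) ^+ 2.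
  by rewrite sqr_enorm; apply: eq_bigr => i _; rewrite !mxE expr2.
have intsq (g : V -> R) : Lp Omega 2 g -> lam.-integrable Omega (EFin \o (fun x => g x ^+ 2)).
  by move=> /(Lp2P oO)[].
have isum (r : seq 'I_d) (g : 'I_d -> V -> R) : (forall i, Lp Omega 2 (g i)) ->
    lam.-integrable Omega (EFin \o (fun x => \sum_(i <- r) g i x ^+ 2)) /\
    \int[lam]_(x in Omega) (\sum_(i <- r) g i x ^+ 2) = \sum_(i <- r) Lp_pow Omega 2 (g i).
  move=> Lg; elim: r => [|i r [IH1 IH2]].
    split; first by under eq_fun do rewrite big_nil; exact: integrable_cst.
    by under eq_Rintegral do rewrite big_nil; rewrite Rintegral_cst// mul0r big_nil.
  have i1 := intsq _ (Lg i).
  split; first by under eq_fun do rewrite big_cons; exact: (integrableD mO i1 IH1).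
  by under eq_Rintegral do rewrite big_cons; rewrite RintegralD// IH2 big_cons Lp_pow2E.
have LF : LpV Omega 2 F.
  split => //; apply/(Lp2P oO); split; first exact: measurable_enorm.
  have [i1 _] := isum (index_enum _) G (fun i => (hG i).1).
  rewrite (_ : (fun x => enorm (F x) ^+ 2) = (fun x => \sum_i G i x ^+ 2))//.
  by apply/funext => x; rewrite sqr_enorm; apply: eq_bigr => i _; rewrite !mxE expr2.
have wF : is_wgrad Omega f F.
  move=> psi tpsi i; have tpp := test_fun_partial i tpsi.
  have c1 := L2_weak_cvg (fun n => L2t _ (tphi n)) Lf (L2t _ tpp) cf.
  have c2 := L2_weak_cvg (fun n => L2t _ (tp n i)) (hG i).1 (L2t _ tpsi) (hG i).2.
  have E n : \int[lam]_(x in Omega) (phi n x * partial i psi x) =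
      - \int[lam]_(x in Omega) (partial i (phi n) x * psi x).
    by apply: (integration_by_parts_test oO bO) => //; case: (tphi n).
  rewrite (funext E) in c1.
  have := cvg_unique (@Rhausdorff R) c1 (cvgN c2).
  by move=> ->; congr (- _); apply: eq_Rintegral => x _; rewrite mxE.
have cF : (fun n => Lp_pow Omega 2 (fun x => enorm (grad (phi n) x - F x))) @ \oo --> (0 : R).
  have E n : Lp_pow Omega 2 (fun x => enorm (grad (phi n) x - F x)) =
      \sum_i Lp_pow Omega 2 (fun x => partial i (phi n) x - G i x).
    have [_ <-] := isum (index_enum _) (fun i x => partial i (phi n) x - G i x)
      (fun i => Lp_sub oO p0 (L2t _ (tp n i)) (hG i).1).
    rewrite Lp_pow2E; apply: eq_Rintegral => x _; rewrite dotE.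
    by apply: eq_bigr => i _; rewrite !mxE.
  rewrite (funext E).
  have H (r : seq 'I_d) : (fun n => \sum_(i <- r) Lp_pow Omega 2 (fun x => partial i (phi n) x - G i x)) @ \oo --> (0 : R).
    elim: r => [|i r IH]; first by under eq_fun do rewrite big_nil; exact: cvg_cst.
    under eq_fun do rewrite big_cons.
    by have := cvgD (hG i).2 IH; rewrite addr0; exact.
  exact: H.
have Hf : H10 Omega f := W1p0_intro oO bO p1 Lf LF wF tphi cf cF.
exists f => //.
have LW := H10_LpV oO bO Hf.
have ae : {ae lam, forall x, Omega x -> W f x = F x}.
  have [_ _ ww _] := W1p0_elim oO bO p1 Hf.
  exact: (wgrad_unique oO bO p1 p1 LW LF ww wF).
have E n : norm (fun x => phi n x - f x) = Num.sqrt (Lp_pow Omega 2 (fun x => enorm (grad (phi n) x - F x))).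
  have Hs := H10_sub oO bO (H10_test oO bO (tphi n)) Hf.
  by rewrite (H10_normE oO bO Hs) (H10_norm_sub_grad oO bO (tphi n) Hf LF ae).
by rewrite (funext E); exact: cvg_sqrt0 cF.
Qed.

End riesz.

(** * The Riesz theorem and the inverse of the Dirichlet Laplacian *)

Section riesz_representation.
Variables (R : realType) (d : nat) (Omega : set 'rV[R]_d).
Hypotheses (d0 : (0 < d)%N) (oO : open Omega) (bO : bounded_set Omega).
Local Notation V := 'rV[R]_d.
Implicit Types (f g h phi psi : V -> R) (u : (V -> R) -> R).

Let mO : measurable Omega. Proof. exact: open_measurable_rV. Qed.
Let p1 : (1 : R) <= 2. Proof. by rewrite ler1n. Qed.
Let p0 : (0 : R) < 2. Proof. by rewrite ltr0n. Qed.
Local Notation inner := (H10_inner Omega).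
Local Notation norm := (H10_norm Omega).

Lemma H10_inner_linr a f g h : H10 Omega f -> H10 Omega g -> H10 Omega h ->
  inner h (fun x => a * f x + g x) = a * inner h f + inner h g.
Proof.
move=> Hf Hg Hh; rewrite (H10_innerC Omega h) (H10_innerC Omega h f) (H10_innerC Omega h g).
exact: H10_inner_lin.
Qed.

Lemma Hm1_H10_inner f : H10 Omega f -> Hm1 Omega (inner f).
Proof.
move=> Hf; split; first by move=> a g h Hg Hh; exact: H10_inner_linr.
by exists (norm f) => g Hg; exact: H10_cauchy_schwarz.
Qed.

Lemma cvg_H10_inner f h (phi : nat -> V -> R) : H10 Omega f -> H10 Omega h ->
  (forall n, test_fun Omega (phi n)) ->
  (fun n => norm (fun x => phi n x - f x)) @ \oo --> (0 : R) ->
  (fun n => inner (phi n) h) @ \oo --> inner f h.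
Proof.
move=> Hf Hh tphi c; have := Hm1_cvg oO bO (Hm1_H10_inner Hh) Hf tphi c.
by rewrite (H10_innerC Omega f h); under [in X in _ -> X]eq_fun do rewrite (H10_innerC Omega _ h).
Qed.

Lemma partial_diff_le phi psi i : test_fun Omega phi -> test_fun Omega psi ->
  Lp_pow Omega 2 (fun x => partial i phi x - partial i psi x) <=
  inner (fun x => -1 * psi x + phi x) (fun x => -1 * psi x + phi x).
Proof.
move=> tphi tpsi; have td := test_fun_lin (-1) tpsi tphi.
have [_ ae] := test_fun_W1p0 oO bO p1 td.
have LW := H10_LpV oO bO (H10_test oO bO td).
have Lg := test_fun_LpV oO bO p0 td.
rewrite H10_innerE (L2_inner_ae oO LW LW Lg Lg ae ae) Lp_pow2E.
have [s1 _ _] := tphi; have [s2 _ _] := tpsi.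
have tp := test_fun_lin (-1) (test_fun_partial i tpsi) (test_fun_partial i tphi).
have E : (fun x => partial i phi x - partial i psi x) = (fun x => -1 * partial i psi x + partial i phi x).
  by apply/funext => x; rewrite mulN1r addrC.
apply: le_Rintegral => //.
- have := test_fun_Lp oO bO p0 tp; rewrite -E => L.
  exact: ((Lp2P oO _).1 L).2.
- exact: (LpV_dotv oO Lg Lg).
move=> x _; rewrite /dotv (bigD1 i)//= grad_lin// !mxE.
have -> : (partial i phi x - partial i psi x) ^+ 2 =
  (-1 * partial i psi x + partial i phi x) * (-1 * partial i psi x + partial i phi x) by ring.
by rewrite lerDl sumr_ge0// => j _; rewrite -expr2 sqr_ge0.
Qed.

(** Minimize J(phi) = |phi|^2 / 2 - u(phi) over test functions, where |phi| is
    the norm of H^1_0.  If J(phi_n) <= inf J + eps_n, then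
    t |-> J(phi_n + t psi) - inf J is a nonnegative quadratic polynomial, and its
    discriminant shows that (phi_n, psi) differs from u(psi) by at most
    sqrt(2 eps_n) |psi|.  For psi = phi_{n+1} - phi_n this makes the sequence fast
    Cauchy, and in the limit it gives (f, psi) = u(psi). *)
Lemma riesz_H10 u : Hm1 Omega u ->
  exists f, H10 Omega f /\ forall phi, H10 Omega phi -> mlapD Omega f phi = u phi.
Proof.
move=> Hu; have [K K0 hK] := Hm1_bound oO bO Hu; have [lu _] := Hu.
have [CP CP0 hCP] := poincare d0 oO bO.
have HT := @H10_test R d Omega oO bO.
pose J phi := 2^-1 * inner phi phi - u phi.
pose S := [set J phi | phi in test_fun Omega].
have Jlb phi : test_fun Omega phi -> - (K ^+ 2 / 2) <= J phi.
  move=> tphi; have Hphi := HT _ tphi.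
  have := hK _ Hphi; have := sqr_H10_norm oO bO Hphi; rewrite /J.
  move: (inner phi phi) (norm phi) (u phi) => a b c <-.
  rewrite ler_norml => /andP[_ h]; have := sqr_ge0 (b - K); rewrite sqrrB; lra.
have hS : has_inf S.
  split; first by exists (J (fun=> 0)), (fun=> 0) => //; exact: test_fun_cst0.
  by exists (- (K ^+ 2 / 2)) => _ [phi tphi <-]; exact: Jlb.
pose m := inf S.
have mJ phi : test_fun Omega phi -> m <= J phi.
  by move=> tphi; apply: ge_inf; [case: hS|exists phi].
(* the factor 8 (CP + 1), with CP the constant of Poincare's inequality, makes the
   squared norms of both phi_{n+1} - phi_n and its gradient at most 16^-n *)
pose eps (n : nat) : R := 4^-1 ^+ n * 4^-1 ^+ n / (8 * (CP + 1)).
have CP1 : 0 < CP + 1 by rewrite ltr_wpDl.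
have q0 n : 0 < 4^-1 ^+ n :> R by rewrite exprn_gt0// invr_gt0.
have eps0 n : 0 < eps n by rewrite divr_gt0 ?mulr_gt0.
have /choice[phi hphi] : forall n, exists phi, test_fun Omega phi /\ J phi <= m + eps n.
  by move=> n; have [_ [phi tphi <-] h] := inf_adherent (eps0 n) hS; exists phi; split => //; exact: ltW.
have tphi n : test_fun Omega (phi n) := (hphi n).1.
have Hphi n := HT _ (tphi n).
have disc n psi : test_fun Omega psi ->
    (inner (phi n) psi - u psi) ^+ 2 <= 2 * eps n * inner psi psi.
  move=> tpsi; have Hpsi := HT _ tpsi.
  have H : ((inner (phi n) psi - u psi) / 2) ^+ 2 <= (inner psi psi / 2) * eps n.
    apply: discriminant_le; [by rewrite divr_ge0// H10_inner_ge0|exact: ltW|].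
    move=> t; have tt := test_fun_lin t tpsi (tphi n).
    have := mJ _ tt; have := (hphi n).2; rewrite /J.
    have Ht := HT _ tt.
    rewrite (H10_inner_lin oO bO t Hpsi (Hphi n) Ht) (H10_inner_linr t Hpsi (Hphi n) Hpsi).
    rewrite (H10_inner_linr t Hpsi (Hphi n) (Hphi n)) (H10_innerC Omega psi (phi n)) (lu t psi (phi n) Hpsi (Hphi n)).
    move: (inner (phi n) psi) (inner psi psi) (inner (phi n) (phi n)) (u psi) (u (phi n)) => a b c e f h1 h2.
    lra.
  move: H; rewrite expr_div_n; move: (inner (phi n) psi) (inner psi psi) (u psi) => a b c.
  rewrite -natrX /=; lra.
have incr n : inner (fun x => -1 * phi n x + phi n.+1 x) (fun x => -1 * phi n x + phi n.+1 x) <= 8 * eps n.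
  have tpsi := test_fun_lin (-1) (tphi n) (tphi n.+1).
  have Hpsi := HT _ tpsi.
  have h1 := disc n _ tpsi; have h2 := disc n.+1 _ tpsi.
  have := H10_inner_lin oO bO (-1) (Hphi n) (Hphi n.+1) Hpsi.
  have N0 := H10_inner_ge0 Omega (fun x => -1 * phi n x + phi n.+1 x).
  move: h1 h2 N0; set psi := (fun x => -1 * phi n x + phi n.+1 x).
  have le : eps n.+1 <= eps n.
    have i0 : 0 <= (8 * (CP + 1))^-1 by rewrite invr_ge0 mulr_ge0// ltW.
    rewrite /eps (ler_wpM2r i0)// !exprS.
    have := ltW (mulr_gt0 (q0 n) (q0 n)); move: (4^-1 ^+ n) => q.
    have -> : 4^-1 * q * (4^-1 * q) = 16^-1 * (q * q) by field.
    lra.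
  have := ltW (eps0 n.+1).
  move: (eps n) (eps n.+1) le (inner (phi n) psi) (inner (phi n.+1) psi) (inner psi psi) (u psi).
  move=> e e' ee a b N c e'0 h1 h2 N0 NE.
  have [->|Nn] := eqVneq N 0; first by lra.
  have Np : 0 < N by rewrite lt_def Nn.
  have NN : N * N <= 8 * e * N.
    have -> : N * N = ((b - c) - (a - c)) ^+ 2 by rewrite NE; ring.
    have := sqr_ge0 ((b - c) + (a - c)); have := ler_wpM2r N0 ee; rewrite sqrrB sqrrD; lra.
  by rewrite -(ler_pM2r Np).
have e8 n : 8 * eps n = 4^-1 ^+ n * 4^-1 ^+ n / (CP + 1).
  by rewrite /eps; field; rewrite gt_eqF// gt_eqF.
have e8' n : 8 * eps n <= 4^-1 ^+ n * 4^-1 ^+ n.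
  by rewrite e8 ler_pdivrMr// ler_peMr ?lerDr// mulr_ge0// ltW.
have diffE n : (fun x => phi n.+1 x - phi n x) = (fun x => -1 * phi n x + phi n.+1 x).
  exact: sub_linE.
have [f Hf cf] : exists2 f, H10 Omega f & (fun n => norm (fun x => phi n x - f x)) @ \oo --> (0 : R).
  apply: (H10_fast_cauchy oO bO tphi) => [n|n i].
    rewrite diffE; have Hd := HT _ (test_fun_lin (-1) (tphi n) (tphi n.+1)).
    apply: (le_trans (hCP _ Hd)); apply: (le_trans (ler_wpM2l CP0 (incr n))).
    rewrite e8 mulrCA ler_piMr ?ler_pdivrMr ?mul1r ?lerDl// mulr_ge0 ?ltW//.
  by apply: (le_trans (partial_diff_le i (tphi n.+1) (tphi n))); apply: (le_trans (incr n)).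
exists f; split => //.
have ftest psi : test_fun Omega psi -> inner f psi = u psi.
  move=> tpsi; have Hpsi := HT _ tpsi.
  have c1 := cvg_H10_inner Hf Hpsi tphi cf.
  have c2 : (fun n => inner (phi n) psi) @ \oo --> u psi.
    apply/cvgrPdist_le => e0 e00.
    have c3 : (fun n => Num.sqrt ((2 * inner psi psi / (8 * (CP + 1))) * 2^-1 ^+ n)) @ \oo --> (0 : R).
      by apply: cvg_sqrt0; exact: cvg_half0.
    move/cvgrPdist_le : c3 => /(_ _ e00); apply: filterS => n; rewrite sub0r normrN => h.
    apply: le_trans h; apply: le_trans (ler_norm _); rewrite distrC -sqrtr_sqr ler_wsqrtr//.
    apply: (le_trans (disc n _ tpsi)).
    have N0 := H10_inner_ge0 Omega psi.
    have -> : 2 * eps n * inner psi psi = 2 * inner psi psi / (8 * (CP + 1)) * (4^-1 ^+ n * 4^-1 ^+ n).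
      by rewrite /eps; ring.
    apply: ler_wpM2l; first by rewrite divr_ge0// ?mulr_ge0// ltW.
    rewrite -exprMn lerXn2r// ?nnegrE ?mulr_ge0 ?invr_ge0//; lra.
  exact: (cvg_unique (@Rhausdorff R) c1 c2).
move=> g Hg; have [psi tpsi cpsi] := H10_dense oO bO Hg.
have c1 := Hm1_cvg oO bO Hu Hg tpsi cpsi.
have c2 := Hm1_cvg oO bO (Hm1_H10_inner Hf) Hg tpsi cpsi.
have E : (fun n => inner f (psi n)) = (fun n => u (psi n)) by apply/funext => n; exact: ftest.
by rewrite E in c2; exact: (cvg_unique (@Rhausdorff R) c2 c1).
Qed.

Lemma inv_mlapDP u : Hm1 Omega u ->
  H10 Omega (inv_mlapD Omega u) /\ forall phi, H10 Omega phi -> inner (inv_mlapD Omega u) phi = u phi.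
Proof.
move=> /riesz_H10[f hf].
exact: (@getPex _ [set f | H10 Omega f /\ forall phi, H10 Omega phi -> mlapD Omega f phi = u phi] (ex_intro _ f hf)).
Qed.

Lemma Hm1_opp u : Hm1 Omega u -> Hm1 Omega (fun f => - u f).
Proof.
move=> [lu [C hC]]; split.
  by move=> a f g Hf Hg; rewrite lu// opprD mulrN.
by exists C => f Hf; rewrite normrN; exact: hC.
Qed.

(** The chosen values of the inverse Laplacian at u and -u are opposite up to a
    function of norm 0, which the bounded functional h does not see. *)
Lemma Hm1_inv_opp u (h : (V -> R) -> R) : Hm1 Omega u -> Hm1 Omega h ->
  h (inv_mlapD Omega (fun f => - u f)) = - h (inv_mlapD Omega u).
Proof.
move=> Hu Hh; have [H1 E1] := inv_mlapDP Hu; have [H2 E2] := inv_mlapDP (Hm1_opp Hu).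
set w := inv_mlapD Omega u in H1 E1 *; set w' := inv_mlapD _ _ in H2 E2 *.
have Hz := H10_lin oO bO 1 H1 H2; have [lh _] := Hh.
have z0 : norm (fun x => 1 * w x + w' x) = 0.
  rewrite (H10_normE oO bO Hz) (H10_inner_lin oO bO 1 H1 H2 Hz) E1// E2// mul1r subrr.
  exact: sqrtr0.
have [C _ hC] := Hm1_bound oO bO Hh.
have := hC _ Hz; rewrite z0 mulr0 lh// mul1r normr_le0 addrC => /eqP h0.
by apply/eqP; rewrite -subr_eq0 opprK h0.
Qed.

End riesz_representation.

(** * Extension of linear functionals below a convex function *)

Section sandwich.
Variables (R : realType) (V : lmodType R) (D : set V) (P : V -> R) (E : set (V * R)).
Hypothesis linD : forall a x y, D x -> D y -> D (a *: x + y).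
Hypothesis convP : forall t x y, D x -> D y -> 0 <= t -> t <= 1 ->
  P (t *: x + (1 - t) *: y) <= t * P x + (1 - t) * P y.

(** Linear functionals on subspaces of D that lie below P, encoded by their
    graphs so that the union of a chain is just a union.  That such a set is the
    graph of a function is a consequence of the bound by P. *)
Definition linear_graph (A : set (V * R)) := [/\ A (0, 0),
  (forall a x y r s, A (x, r) -> A (y, s) -> A (a *: x + y, a * r + s)) &
  forall x r, A (x, r) -> D x /\ r <= P x].

(** Two values at the same point would put a vertical line (0, t (s - r)) into
    the graph, contradicting the bound P 0 for large t. *)
Lemma linear_graph_fun A x r s : linear_graph A -> A (x, r) -> A (x, s) -> r = s.
Proof.
move=> [A0 Al AP] Ar As.
have H t : t * (s - r) <= P 0.
  have h1 : A (0, s - r).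
    by have := Al (-1) _ _ _ _ Ar As; rewrite scaleN1r addNr mulN1r addrC.
  have := Al t _ _ _ _ h1 A0; rewrite scaler0 !addr0 => /AP[]; by [].
apply/eqP; rewrite eq_sym -subr_eq0; apply/negPn/negP => n0.
by have := H ((P 0 + 1) / (s - r)); rewrite divfK// => h; lra.
Qed.

(** The value c at x0 must exceed all slopes (r - P (x - a x0)) / a and stay
    below all slopes (P (y + b x0) - s) / b.  Convexity of P puts the first
    slopes below the second, so their supremum can serve as c. *)
Lemma linear_graph_extend A x0 : linear_graph A -> D x0 ->
  exists c, linear_graph [set z | exists x r t, A (x, r) /\ z = (x + t *: x0, r + t * c)].
Proof.
move=> [A0 Al AP] Dx0.
have Dx x r : A (x, r) -> D x by case/AP.
have key x y r s a b : A (x, r) -> A (y, s) -> 0 < a -> 0 < b ->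
    (r - P (x - a *: x0)) / a <= (P (y + b *: x0) - s) / b.
  move=> Ax Ay a0 b0; have ab0 : 0 < a + b by rewrite addr_gt0.
  pose t := b / (a + b).
  have t1 : 1 - t = a / (a + b) by rewrite /t; field; rewrite gt_eqF.
  have t0 : 0 <= t by rewrite divr_ge0// ltW.
  have tle1 : t <= 1 by rewrite -subr_ge0 t1 divr_ge0// ltW.
  have D1 : D (x - a *: x0) by rewrite addrC -scaleNr; apply: linD => //; exact: Dx Ax.
  have D2 : D (y + b *: x0) by rewrite addrC; apply: linD => //; exact: Dx Ay.
  have := convP D1 D2 t0 tle1.
  have -> : t *: (x - a *: x0) + (1 - t) *: (y + b *: x0) = t *: x + (1 - t) *: y.
    rewrite scalerBr scalerDr !scalerA addrACA.
    have -> : t * a = (1 - t) * b by rewrite t1 /t; ring.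
    by rewrite addNr addr0.
  have A2 : A ((1 - t) *: y, (1 - t) * s).
    by have := Al (1 - t) _ _ _ _ Ay A0; rewrite !addr0.
  have [_ h1] := AP _ _ (Al t _ _ _ _ Ax A2).
  move=> /(le_trans h1); rewrite t1 /t; set p := P _; set q := P _ => h2.
  rewrite ler_pdivrMr// mulrAC ler_pdivlMr//.
  have := ler_wpM2r (ltW ab0) h2.
  have -> : (b / (a + b) * r + a / (a + b) * s) * (a + b) = b * r + a * s by field; rewrite gt_eqF.
  have -> : (b / (a + b) * p + a / (a + b) * q) * (a + b) = b * p + a * q by field; rewrite gt_eqF.
  by move=> h3; nra.
pose S := [set v : R | exists x r a, [/\ A (x, r), 0 < a & v = (r - P (x - a *: x0)) / a]].
have S0 : S !=set0 by exists ((0 - P (0 - 1 *: x0)) / 1), 0, 0, 1.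
exists (sup S); split.
- by exists 0, 0, 0; split => //; rewrite scale0r mul0r !addr0.
- move=> a _ _ _ _ [x [r [t [Ax [-> ->]]]]] [y [s [t' [Ay [-> ->]]]]].
  exists (a *: x + y), (a * r + s), (a * t + t'); split; first exact: Al.
  congr (_, _); last by ring.
  by rewrite scalerDr scalerDl scalerA addrACA.
- move=> _ _ [x [r [t [Ax [-> ->]]]]]; split.
    by rewrite addrC; apply: linD => //; exact: Dx Ax.
  have [t0|t0|->] := ltgtP t 0; last by rewrite scale0r mul0r !addr0; case: (AP _ _ Ax).
    have : (r - P (x - (- t) *: x0)) / - t <= sup S.
      apply: ub_le_sup; last by exists x, r, (- t); split => //; rewrite oppr_gt0.
      by exists ((P (0 + 1 *: x0) - 0) / 1) => _ [y [s [a [Ay a0 ->]]]]; exact: key.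
    rewrite scaleNr opprK ler_pdivrMr ?oppr_gt0//; lra.
  have : sup S <= (P (x + t *: x0) - r) / t.
    by apply: ge_sup => // _ [y [s [a [Ay a0 ->]]]]; exact: key.
  rewrite ler_pdivlMr//; lra.
Qed.

(** Zorn's lemma is applied to the sets A whose union with E is a linear
    graph, which makes the empty chain harmless; by [linear_graph_extend] a maximal
    graph is defined on all of D. *)
Lemma hahn_banach_convex : linear_graph E -> exists L : V -> R,
  [/\ forall a x y, D x -> D y -> L (a *: x + y) = a * L x + L y,
      forall x, D x -> L x <= P x & forall x r, E (x, r) -> L x = r].
Proof.
move=> gE.
have [|A [gA maxA]] := @Zorn_bigcup (V * R) [set A | linear_graph (A `|` E)].
  move=> F FP tF /=; have [E0 El EP] := gE; split; first by right.
    move=> a x y r s [[X FX Xx]|Ex] [[Y FY Yy]|Ey].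
    - have [XY|YX] := tF _ _ FX FY.
        have [_ Yl _] := FP _ FY.
        by have [Z|Z] := Yl a x y r s (or_introl (XY _ Xx)) (or_introl Yy); [left; exists Y|right].
      have [_ Xl _] := FP _ FX.
      by have [Z|Z] := Xl a x y r s (or_introl Xx) (or_introl (YX _ Yy)); [left; exists X|right].
    - have [_ Xl _] := FP _ FX.
      by have [Z|Z] := Xl a x y r s (or_introl Xx) (or_intror Ey); [left; exists X|right].
    - have [_ Yl _] := FP _ FY.
      by have [Z|Z] := Yl a x y r s (or_intror Ex) (or_introl Yy); [left; exists Y|right].
    - by right; exact: El.
  move=> x r [[X FX Xx]|/EP//]; have [_ _ XP] := FP _ FX.
  by apply: XP; left.
have [M0 Ml MP] := gA; set M := A `|` E in gA M0 Ml MP.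
have tot x : D x -> exists r, M (x, r).
  move=> Dx; apply: contrapT => nx.
  have [c gB] := linear_graph_extend gA Dx.
  set B := [set z | _] in gB.
  have MB : M `<=` B.
    by move=> [y s] My; exists y, s, 0; split => //; rewrite scale0r mul0r !addr0.
  have Bx : B (x, c) by exists 0, 0, 1; split => //; rewrite scale1r mul1r !add0r.
  apply: (maxA B); last first.
    by rewrite /= setUidl// => z Ez; apply: MB; right.
  split; first by move=> z Az; apply: MB; left.
  by move=> /(_ _ Bx) Ax; apply: nx; exists c; left.
pose L x := get [set r | M (x, r)].
have LM x : D x -> M (x, L x) by move=> /tot[r hr]; exact: (@getPex _ [set r | M (x, r)] (ex_intro _ r hr)).
exists L; split.
- move=> a x y Dx Dy; apply: (linear_graph_fun gA (LM _ (linD a Dx Dy))).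
  by apply: Ml; exact: LM.
- by move=> x Dx; have [] := MP _ _ (LM _ Dx).
- move=> x r Ex; have Mx : M (x, r) by right.
  by have [Dx _] := MP _ _ Mx; exact: linear_graph_fun gA (LM _ Dx) Mx.
Qed.

End sandwich.

(** * The integrand and its conjugate *)

Section sigma_conjugate.
Variables (R : realType) (d : nat) (p mu : R).
Hypotheses (p1 : 1 < p) (mu0 : 0 < mu).
Local Notation V := 'rV[R]_d.
Implicit Types (s y : V).

(** Near the origin sigma grows with slope 1, so a vector s of length at most 1
    has conjugate 0 and only the excess of |s| over 1 counts.  The supremum of
    s . y - sigma(y) is attained at a y parallel to s whose length a solves
    mu a^(p-1) = excess; this a is [slope s], and the value of the supremum is
    [sconj s]. *)
Definition excess s : R := Num.max (enorm s - 1) 0.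
Definition slope s : R := (excess s / mu) `^ (p - 1)^-1.
Definition maximizer s : V := (slope s / enorm s) *: s.
Definition sconj s : R := mu * (1 - p^-1) * slope s `^ p.
Local Notation q := (p / (p - 1)).

Let p0 : 0 < p. Proof. exact: lt_trans p1. Qed.
Let pm1 : 0 < p - 1. Proof. by rewrite subr_gt0. Qed.
Let q0 : 0 < q. Proof. by rewrite divr_gt0. Qed.
Let cp : 0 < 1 - p^-1. Proof. by rewrite subr_gt0 invf_lt1. Qed.

Lemma conj_exponent_gt1 : 1 < q.
Proof. by rewrite ltr_pdivlMr// mul1r ltrBlDr ltrDl. Qed.

Lemma excess_ge0 s : 0 <= excess s. Proof. by rewrite le_max lexx orbT. Qed.
Lemma slope_ge0 s : 0 <= slope s. Proof. exact: powR_ge0. Qed.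
Lemma enorm_le_excess s : enorm s <= 1 + excess s.
Proof. by rewrite -lerBlDl le_max lexx. Qed.
Lemma excess_le s : excess s <= enorm s.
Proof. by rewrite ge_max enorm_ge0 andbT lerBlDr lerDl. Qed.

Lemma excessE s : excess s = mu * slope s `^ (p - 1).
Proof.
rewrite /slope -powRrM mulVf ?gt_eqF// powRr1; last by rewrite divr_ge0// ?excess_ge0// ltW.
by rewrite mulrC divfK// gt_eqF.
Qed.

Lemma slope_powE s : slope s `^ p = (excess s / mu) `^ q.
Proof. by rewrite /slope -powRrM; congr (_ `^ _); rewrite mulrC. Qed.

Lemma sconj_ge0 s : 0 <= sconj s.
Proof. by rewrite !mulr_ge0 ?powR_ge0// ltW. Qed.

Lemma sigma_ge0 y : 0 <= sigma p mu y.
Proof. by rewrite addr_ge0 ?enorm_ge0// mulr_ge0 ?powR_ge0// divr_ge0 ?ltW. Qed.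

(** Bound |s| by 1 + mu a^(p-1) with a the slope of s.  The term 1 produces
    the linear part of sigma, and Young's inequality with exponents q and p
    splits a^(p-1) |y|. *)
Lemma young_sigma s y : dotv s y <= sigma p mu y + sconj s.
Proof.
have b0 := enorm_ge0 y; have a0 := slope_ge0 s.
apply: (le_trans (dotv_le s y)).
apply: (@le_trans _ _ ((1 + excess s) * enorm y)).
  by rewrite ler_wpM2r// enorm_le_excess.
rewrite mulrDl mul1r /sigma -addrA lerD2l excessE /sconj.
have := @conjugate_powR R (slope s `^ (p - 1)) (enorm y) q p (powR_ge0 _ _) b0 q0 p0.
have -> : q^-1 + p^-1 = 1 by field; rewrite !gt_eqF.
move=> /(_ erefl); rewrite -powRrM.
have -> : (p - 1) * q = p by field; rewrite gt_eqF.
have -> : mu / p * enorm y `^ p + mu * (1 - p^-1) * slope s `^ p =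
   mu * (slope s `^ p / q + enorm y `^ p / p) by field; rewrite !gt_eqF.
by move=> h; rewrite -mulrA ler_wpM2l// ltW.
Qed.

Lemma sigma0 : sigma p mu (0 : V) = 0.
Proof. by rewrite /sigma enorm0 powR0 ?mulr0 ?addr0// gt_eqF. Qed.

Lemma enorm_maximizer_le s : enorm (maximizer s) <= slope s.
Proof.
rewrite enormZ ger0_norm ?divr_ge0 ?slope_ge0 ?enorm_ge0//.
have [->|n0] := eqVneq (enorm s) 0; first by rewrite mulr0 slope_ge0.
by rewrite divfK.
Qed.

Lemma maximizerP s : dotv s (maximizer s) = sigma p mu (maximizer s) + sconj s.
Proof.
have [s1|s1] := leP (enorm s) 1.
  have e0 : excess s = 0 by apply/eqP; rewrite eq_le excess_ge0 andbT ge_max subr_le0 s1 lexx.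
  have a0 : slope s = 0 by rewrite /slope e0 mul0r powR0// invr_neq0 ?gt_eqF.
  by rewrite /sconj /maximizer a0 mul0r scale0r sigma0 powR0 ?gt_eqF// mulr0 addr0 -(scale0r (0 : V)) dotvZr mul0r.
have sp : 0 < enorm s by exact: lt_trans s1.
have eE : enorm s = 1 + excess s.
  by rewrite /excess max_l; [rewrite addrC subrK|rewrite subr_ge0 ltW].
have nE : enorm (maximizer s) = slope s.
  by rewrite enormZ ger0_norm ?divr_ge0 ?slope_ge0 ?enorm_ge0// divfK// gt_eqF.
rewrite /sigma nE {1}/maximizer dotvZr -sqr_enorm expr2 mulrA divfK ?gt_eqF//.
rewrite eE excessE mulrDr mulr1 -addrA; congr (_ + _).
rewrite /sconj mulrCA mulr_powRB1 ?slope_ge0//.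
by field; rewrite gt_eqF.
Qed.

Lemma sigma_conjE s : sigma_conj p mu s = (sconj s)%:E.
Proof.
apply/eqP; rewrite eq_le; apply/andP; split.
  apply: ge_ereal_sup => _ [y _ <-] /=.
  by rewrite -EFinB lee_fin lerBlDl young_sigma.
apply: ereal_sup_ubound; exists (maximizer s) => //=.
by rewrite -EFinB maximizerP addrC addKr.
Qed.

Lemma sconj_le s : sconj s <= mu * (1 - p^-1) * mu^-1 `^ q * enorm s `^ q.
Proof.
have c0 : 0 <= mu * (1 - p^-1) by rewrite ltW// mulr_gt0.
have mui : 0 <= mu^-1 by rewrite invr_ge0 ltW.
have h : excess s `^ q <= enorm s `^ q.
  by apply: ge0_ler_powR; rewrite ?nnegrE ?enorm_ge0 ?excess_ge0 ?excess_le// ltW.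
rewrite /sconj slope_powE (powRM _ (excess_ge0 s) mui) -[leRHS]mulrA ler_wpM2l// mulrC.
by rewrite ler_wpM2l// powR_ge0.
Qed.

(** A converse to [sconj_le]: on a set of finite measure, a field whose
    conjugate energy is finite is in L^q. *)
Lemma sconj_coercive : exists2 C : R, 0 <= C & forall s, enorm s `^ q <= C * (1 + sconj s).
Proof.
pose K := mu `^ q / (mu * (1 - p^-1)).
have K0 : 0 <= K by rewrite divr_ge0 ?powR_ge0// ltW// mulr_gt0.
have mui : 0 <= mu^-1 by rewrite invr_ge0 ltW.
exists (2 `^ q * (1 + K)) => [|s]; first by rewrite mulr_ge0 ?powR_ge0 ?addr_ge0.
apply: (@le_trans _ _ ((1 + excess s) `^ q)).
  by apply: ge0_ler_powR; rewrite ?nnegrE ?enorm_ge0 ?enorm_le_excess ?addr_ge0 ?excess_ge0// ltW.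
apply: (le_trans (powR_addn_le q0 ler01 (excess_ge0 s))).
rewrite -mulrA ler_wpM2l ?powR_ge0// powR1.
have -> : excess s `^ q = K * sconj s.
  rewrite /K /sconj slope_powE (powRM _ (excess_ge0 s) mui).
  have e1 : mu `^ q * mu^-1 `^ q = 1.
    by rewrite -(powRM _ (ltW mu0) mui) divff ?gt_eqF// powR1.
  transitivity (excess s `^ q * (mu `^ q * mu^-1 `^ q)); first by rewrite e1 mulr1.
  move: (excess s `^ q) (mu `^ q) (mu^-1 `^ q) => a b c; field.
  by rewrite subr_eq0 gt_eqF// gt_eqF//= gt_eqF.
have := sconj_ge0 s; nra.
Qed.

Lemma convex_sigma t x y : 0 <= t -> t <= 1 ->
  sigma p mu (t *: x + (1 - t) *: y) <= t * sigma p mu x + (1 - t) * sigma p mu y.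
Proof.
move=> t0 t1; have t1' : 0 <= 1 - t by rewrite subr_ge0.
have h : enorm (t *: x + (1 - t) *: y) <= t * enorm x + (1 - t) * enorm y.
  by rewrite (le_trans (enormD _ _))// !enormZ !ger0_norm.
have hp : enorm (t *: x + (1 - t) *: y) `^ p <= t * enorm x `^ p + (1 - t) * enorm y `^ p.
  apply: (@le_trans _ _ ((t * enorm x + (1 - t) * enorm y) `^ p)).
    by apply: ge0_ler_powR; rewrite ?nnegrE ?enorm_ge0 ?addr_ge0 ?mulr_ge0 ?enorm_ge0// ltW.
  have t01 : 0 <= t <= 1 by rewrite t0.
  have := @convex_powR R p (ltW p1) (Itv01 t0 t1) (enorm x) (enorm y).
  rewrite !inE /= !in_itv /= !andbT => /(_ (enorm_ge0 x) (enorm_ge0 y)).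
  by rewrite !convRE /=.
rewrite /sigma.
have := ler_wpM2l (ltW (divr_gt0 mu0 p0)) hp; move: h => {hp}.
move: (enorm (t *: x + (1 - t) *: y) `^ p) (enorm x `^ p) (enorm y `^ p) => X Y Z.
move: (enorm (t *: x + (1 - t) *: y)) (enorm x) (enorm y) (mu / p) => a b c k.
lra.
Qed.

End sigma_conjugate.

(** * Functionals dominated by the energy *)

Section dual_representation.
Variables (R : realType) (d : nat) (p mu : R) (Omega : set 'rV[R]_d).
Hypotheses (p1 : 1 < p) (mu0 : 0 < mu).
Hypotheses (mO : measurable Omega) (fO : (lebesgue_rV R d Omega < +oo)%E).
Local Notation V := 'rV[R]_d.
Local Notation lam := (lebesgue_rV R d).
Local Notation Dp := (LpV Omega p).
Implicit Types (F G : V -> V).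

Let p0 : 0 < p. Proof. exact: lt_trans p1. Qed.
Let p1' : 1 <= p. Proof. exact: ltW. Qed.

Definition sigma_int G : R := \int[lam]_(x in Omega) sigma p mu (G x).

Lemma measurable_sigma G : measurable_fun Omega G -> measurable_fun Omega (fun x => sigma p mu (G x)).
Proof.
move=> mG; apply: measurable_funD; first exact: measurable_enorm.
apply: measurable_funM => //; apply: (measurableT_comp (measurable_powR _)).
exact: measurable_enorm.
Qed.

Lemma LpV_pow_integrable G : Dp G -> lam.-integrable Omega (EFin \o (fun x => enorm (G x) `^ p)).
Proof.
move=> [_ /(LpP mO _ p0)[_]]; congr (lam.-integrable Omega _).
by apply/funext => x /=; rewrite ger0_norm ?enorm_ge0.
Qed.

Lemma LpV_enorm_integrable G : Dp G -> lam.-integrable Omega (EFin \o (fun x => enorm (G x))).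
Proof. by move=> [_ LG]; exact: (Lp_integrable mO fO p1' LG). Qed.

Lemma sigma_integrable G : Dp G -> lam.-integrable Omega (EFin \o (fun x => sigma p mu (G x))).
Proof.
move=> DG; have i1 := LpV_enorm_integrable DG; have i2 := LpV_pow_integrable DG.
exact: (integrableD mO i1 (integrableZl mO (mu / p) i2)).
Qed.

Lemma LpV_0 : Dp (0 : V -> V).
Proof.
split; first exact: measurable_cst.
apply: (Lp_bounded mO fO p0 (B := 0)); first by apply: measurable_enorm; exact: measurable_cst.
by move=> x _; rewrite enorm0 normr0.
Qed.

Lemma LpV_bounded (B : R) G : measurable_fun Omega G ->
  (forall x, Omega x -> enorm (G x) <= B) -> Dp G.
Proof.
move=> mG GB; split => //; apply: (Lp_bounded mO fO p0 (B := B)); first exact: measurable_enorm.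
by move=> x Ox; rewrite ger0_norm ?enorm_ge0// GB.
Qed.

Lemma LpV_dominated F G : measurable_fun Omega F -> Dp G ->
  (forall x, Omega x -> enorm (F x) <= enorm (G x)) -> Dp F.
Proof.
move=> mF [mG LG] FG; split => //.
apply: (integrable_pow_lin mO (a := 0) p0 LG LG (measurable_enorm mF) _).1.
by move=> x Ox; rewrite normr0 mul0r add0r !ger0_norm ?enorm_ge0//; exact: FG.
Qed.

Lemma convex_sigma_int t F G : Dp F -> Dp G -> 0 <= t -> t <= 1 ->
  sigma_int (t *: F + (1 - t) *: G) <= t * sigma_int F + (1 - t) * sigma_int G.
Proof.
move=> DF DG t0 t1.
have DtG : Dp ((1 - t) *: G).
  by have := LpV_lin mO (1 - t) p0 DG LpV_0; congr (LpV _ _ _); apply/funext => x; rewrite /= addr0.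
have iF := sigma_integrable DF; have iG := sigma_integrable DG.
rewrite /sigma_int -(RintegralZl t mO iF) -(RintegralZl (1 - t) mO iG) -RintegralD//; last 2 first.
- exact: (integrableZl mO t iF).
- exact: (integrableZl mO (1 - t) iG).
apply: (le_Rintegral mO).
- exact: (sigma_integrable (LpV_lin mO t p0 DF DtG)).
- exact: (integrableD mO (integrableZl mO t iF) (integrableZl mO (1 - t) iG)).
- by move=> x _; exact: convex_sigma.
Qed.

Variables (L : (V -> V) -> R) (M : R).
Hypothesis linL : forall a F G, Dp F -> Dp G -> L (a *: F + G) = a * L F + L G.
Hypothesis Lsigma : forall G, Dp G -> L G <= M + sigma_int G.

Lemma dominated_functional0 : L 0 = 0.
Proof. by have := linL 1 LpV_0 LpV_0; rewrite scaler0 addr0 mul1r => h; lra. Qed.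

Lemma dominated_functional_bound_ge0 : 0 <= M.
Proof.
have := Lsigma LpV_0; rewrite dominated_functional0 (_ : sigma_int 0 = 0) ?addr0//.
by rewrite /sigma_int; under eq_Rintegral do rewrite sigma0//; rewrite Rintegral_cst// mul0r.
Qed.

Lemma dominated_functionalZ a G : Dp G -> L (a *: G) = a * L G.
Proof. by move=> DG; have := linL a DG LpV_0; rewrite addr0 dominated_functional0 addr0. Qed.

Lemma LpVZ a G : Dp G -> Dp (a *: G).
Proof. by move=> DG; have := LpV_lin mO a p0 DG LpV_0; congr (LpV _ _ _); apply/funext => x; rewrite /= addr0. Qed.

Lemma enormZ_ge0 (a : R) (x : V) : 0 <= a -> enorm (a *: x) = a * enorm x.
Proof. by move=> a0; rewrite enormZ ger0_norm. Qed.

(** For every t > 0 the bounds on L (t G_n) and L (- t G_n) give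
    t |L G_n| <= M + int sigma(t G_n), where the last integral tends to 0 by
    dominated convergence.  Since t is arbitrary, L G_n tends to 0. *)
Lemma order_continuous (G_ : nat -> V -> V) G : (forall n, measurable_fun Omega (G_ n)) -> Dp G ->
  (forall n x, Omega x -> enorm (G_ n x) <= enorm (G x)) ->
  (forall x, Omega x -> (fun n => enorm (G_ n x)) @ \oo --> (0 : R)) ->
  (fun n => L (G_ n)) @ \oo --> (0 : R).
Proof.
move=> mG_ DG GG cG.
have DG_ n : Dp (G_ n) by exact: LpV_dominated DG (GG n).
have cPhi t : 0 < t -> (fun n => sigma_int (t *: G_ n)) @ \oo --> (0 : R).
  move=> t0; have DtG := LpVZ t DG.
  have [|||_ ] := @Rintegral_dominated_cvg _ V R lam Omega mO (fun n x => sigma p mu ((t *: G_ n) x)) (fun=> 0)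
      (fun x => sigma p mu ((t *: G) x)) _ _ (sigma_integrable DtG).
  - by move=> n; apply: measurable_sigma; case: (LpVZ t (DG_ n)).
  - move=> x Ox.
    have c1 : (fun n => enorm ((t *: G_ n) x)) @ \oo --> (0 : R).
      rewrite (_ : (fun n => _) = (fun n => t * enorm (G_ n x))); last first.
        by apply/funext => n; rewrite -[(t *: G_ n) x]/(t *: G_ n x) enormZ_ge0// ltW.
      by rewrite -[X in _ --> X](mulr0 t); apply: cvgM; [exact: cvg_cst|exact: cG].
    have c2 := cvg_powR0 p0 (fun n => enorm_ge0 ((t *: G_ n) x)) c1.
    have := cvgD c1 (cvgM (cvg_cst (mu / p)) c2); rewrite mulr0 addr0; exact.
  - move=> n x Ox; rewrite (ger0_norm (sigma_ge0 p1 mu0 _)) /sigma.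
    have le : enorm ((t *: G_ n) x) <= enorm ((t *: G) x).
      by rewrite -[(t *: G_ n) x]/(t *: G_ n x) -[(t *: G) x]/(t *: G x) !enormZ_ge0 ?(ltW t0)// ler_pM2l// GG.
    apply: lerD; first exact: le.
    apply: ler_wpM2l; first by rewrite divr_ge0 ?(ltW mu0) ?(ltW p0).
    by apply: ge0_ler_powR; rewrite ?nnegrE ?enorm_ge0 ?(ltW p0).
  - by rewrite Rintegral_cst// mul0r; exact.
have sigmaN (y : V) : sigma p mu (- y) = sigma p mu y by rewrite /sigma enormN.
have up t n : 0 < t -> t * `|L (G_ n)| <= M + sigma_int (t *: G_ n).
  move=> t0; have h1 := Lsigma (LpVZ t (DG_ n)); have h2 := Lsigma (LpVZ (- t) (DG_ n)).
  have e : sigma_int (- t *: G_ n) = sigma_int (t *: G_ n).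
    apply: eq_Rintegral => x _.
    by rewrite -[(- t *: G_ n) x]/(- t *: G_ n x) scaleNr sigmaN.
  move: h1 h2; rewrite {}e (dominated_functionalZ t (DG_ n)) (dominated_functionalZ (- t) (DG_ n)).
  move: (sigma_int (t *: G_ n)) (L (G_ n)) => a b h1 h2.
  rewrite -[X in X * _](gtr0_norm t0) -normrM.
  rewrite ler_norml.
  by apply/andP; split; lra.
apply/cvgr0Pnorm_lt => e e0.
(* t e = 2 (M + 1) exceeds M + int sigma(t G_n) as soon as the integral is below 1 *)
pose t := (M + 1) / e * 2.
have M1 : 0 < M + 1 by rewrite ltr_wpDl// dominated_functional_bound_ge0.
have t0 : 0 < t by rewrite mulr_gt0// divr_gt0.
have := cPhi t t0; move/cvgr0Pnorm_lt => /(_ 1 ltr01); apply: filterS => n.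
rewrite ger0_norm; last by apply: Rintegral_ge0 => x _; exact: sigma_ge0.
have := up t n t0; move: (sigma_int (t *: G_ n)) (L (G_ n)) => a b h2 h.
rewrite -(ltr_pM2l t0); apply: (le_lt_trans h2).
have -> : t * e = 2 * (M + 1) by rewrite /t; field; rewrite gt_eqF.
have := dominated_functional_bound_ge0; lra.
Qed.

(** All multiples of the difference of F and G have energy 0, so L of these
    multiples is bounded by M. *)
Lemma dominated_functional_ae F G : Dp F -> Dp G -> {ae lam, forall x, Omega x -> F x = G x} -> L F = L G.
Proof.
move=> DF DG FG.
have DH : Dp (-1 *: G + F) by exact: LpV_lin.
have PhiH t : sigma_int (t *: (-1 *: G + F)) = 0.
  have DtH := LpVZ t DH.
  have := @ae_eq_integral _ V R lam Omega (EFin \o (fun=> 0)) (EFin \o (fun x => sigma p mu ((t *: (-1 *: G + F)) x))) mO.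
  rewrite /sigma_int /Rintegral => ->.
  - by rewrite integral0.
  - by apply/measurable_EFinP; apply: measurable_sigma; case: DtH.
  - exact/measurable_EFinP.
  - apply: filterS FG => x FGx Ox; congr EFin.
    rewrite -[(t *: (-1 *: G + F)) x]/(t *: (-1 *: G x + F x)) FGx// scaleN1r addNr scaler0.
    exact: sigma0.
have H t : t * L (-1 *: G + F) <= M.
  by have := Lsigma (LpVZ t DH); rewrite PhiH addr0 dominated_functionalZ.
have : L (-1 *: G + F) = 0.
  apply/eqP/negPn/negP => n0.
  by have := H ((M + 1) / L (-1 *: G + F)); rewrite divfK// => h; lra.
by rewrite (linL (-1) DG DF); move: (L F) (L G) => a b; lra.
Qed.

End dual_representation.

(** * Representation on bounded fields *)

Section bounded_fields.
Variables (R : realType) (d : nat) (p mu : R) (Omega : set 'rV[R]_d).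
Hypotheses (p1 : 1 < p) (mu0 : 0 < mu).
Hypotheses (mO : measurable Omega) (fO : (lebesgue_rV R d Omega < +oo)%E).
Local Notation V := 'rV[R]_d.
Local Notation lam := (lebesgue_rV R d).
Local Notation Dp := (LpV Omega p).
Implicit Types (F G : V -> V) (f : V -> R).
Variables (L : (V -> V) -> R) (M : R).
Hypothesis linL : forall a F G, Dp F -> Dp G -> L (a *: F + G) = a * L F + L G.
Hypothesis Lsigma : forall G, Dp G -> L G <= M + sigma_int p mu Omega G.

Local Notation e_ i := (delta_mx ord0 i : V).
Definition along (i : 'I_d) f : V -> V := fun x => f x *: e_ i.

Lemma enorm_delta (i : 'I_d) : enorm (e_ i) = 1.
Proof.
rewrite /enorm /dotv (bigD1 i)//= big1 ?addr0; last first.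
  by move=> j ji; rewrite !mxE eqxx (negbTE ji) mul0r.
by rewrite mxE !eqxx mulr1 sqrtr1.
Qed.

Lemma enorm_along i f x : enorm (along i f x) = `|f x|.
Proof. by rewrite enormZ enorm_delta mulr1. Qed.

Lemma measurable_along i f : measurable_fun Omega f -> measurable_fun Omega (along i f).
Proof. by move=> mf; apply: measurable_scalev => //; exact: measurable_cst. Qed.

Lemma LpV_along (B : R) i f : measurable_fun Omega f -> (forall x, Omega x -> `|f x| <= B) -> Dp (along i f).
Proof.
move=> mf fB; apply: (LpV_bounded p1 mO fO (B := B)); first exact: measurable_along.
by move=> x Ox; rewrite enorm_along fB.
Qed.

Lemma LpV_along_indic i (A : set V) : measurable A -> Dp (along i (\1_A : V -> R)).
Proof.
move=> mA; apply: (LpV_along (B := 1)) => [|x _].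
  by apply: measurable_funTS; exact: measurable_indic.
by rewrite indicE; case: (_ \in _); rewrite ?normr1 ?normr0.
Qed.

Lemma dominated_functional_along (a : R) i f g : Dp (along i f) -> Dp (along i g) ->
  L (along i (fun x => a * f x + g x)) = a * L (along i f) + L (along i g).
Proof.
move=> Df Dg; rewrite -linL//; congr L; apply/funext => x.
by rewrite /along scalerDl -scalerA.
Qed.

Lemma order_continuous_along i (f_ : nat -> V -> R) (B : R) : (forall n, measurable_fun Omega (f_ n)) ->
  (forall n x, Omega x -> `|f_ n x| <= B) ->
  (forall x, Omega x -> f_ ^~ x @ \oo --> (0 : R)) ->
  (fun n => L (along i (f_ n))) @ \oo --> (0 : R).
Proof.
move=> mf fB cf; apply: (order_continuous p1 mu0 mO fO linL Lsigma (G := along i (fun=> B))).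
- by move=> n; exact: measurable_along.
- by apply: (LpV_along (B := `|B|)).
- by move=> n x Ox; rewrite !enorm_along (le_trans (fB n x Ox))// ler_norm.
- move=> x Ox; under eq_fun do rewrite enorm_along.
  by have := cvg_norm (cf x Ox); rewrite normr0; exact.
Qed.

(** Countable additivity comes from [order_continuous_along], applied to the
    indicators of the remainders of a disjoint union. *)
Definition coord_charge (i : 'I_d) (A : set V) : \bar R := (L (along i (\1_A : V -> R)))%:E.

Section charge.
Variable i : 'I_d.

Let nu0 : coord_charge i set0 = 0%E.
Proof.
rewrite /coord_charge (_ : along i _ = 0) ?(dominated_functional0 p1 mO fO linL)//.
by apply/funext => x; rewrite /along indicE memNset// scale0r.
Qed.

Let nufin A : measurable A -> coord_charge i A \is a fin_num.
Proof. by []. Qed.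

Let nusigma : semi_sigma_additive (coord_charge i).
Proof.
move=> F mF tF mU.
pose T n : set V := \bigcup_(k in [set k | (n <= k)%N]) F k.
have mT n : measurable (T n) by apply: bigcup_measurable => k _; exact: mF.
have E n : L (along i (\1_(\bigcup_k F k) : V -> R)) =
    \sum_(0 <= k < n) L (along i (\1_(F k) : V -> R)) + L (along i (\1_(T n) : V -> R)).
  elim: n => [|n IH].
    by rewrite big_geq// add0r; congr (L (along i \1_ _)); apply/seteqP; split => x [k _ ?]; exists k.
  rewrite big_nat_recr//= IH -addrA; congr (_ + _).
  rewrite -[L (along i \1_(F n))]mul1r -dominated_functional_along; [|exact: LpV_along_indic..].
  congr (L (along i _)); apply/funext => x; rewrite mul1r !indicE.
  have [Fx|nFx] := pselect (F n x).
    rewrite (mem_set Fx) (_ : (x \in T n) = true); last by apply/mem_set; exists n => /=.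
    rewrite memNset ?addr0// => -[k /= nk Fk].
    have nE : n = k by apply: (tF n k) => //; exists x.
    by move: nk; rewrite nE ltnn.
  rewrite (memNset nFx) add0r; congr (_%:R); congr nat_of_bool; apply/idP/idP; rewrite !inE.
    move=> [k /= nk Fk]; exists k => //=; rewrite ltn_neqAle nk andbT.
    by apply/eqP => nE; apply: nFx; rewrite nE.
  by move=> [k /= nk Fk]; exists k => //=; exact: ltnW.
have c : (fun n => L (along i (\1_(T n) : V -> R))) @ \oo --> (0 : R).
  apply: (@order_continuous_along i _ 1).
  - by move=> n; apply: measurable_funTS; exact: measurable_indic.
  - by move=> n x _; rewrite indicE; case: (_ \in _); rewrite ?normr1 ?normr0.
  - move=> x _; have [[k _ Fk]|nU] := pselect ((\bigcup_k F k) x); last first.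
      rewrite (_ : (fun n => _) = fun=> 0); first exact: cvg_cst.
      by apply/funext => n; rewrite indicE memNset// => -[k _ Fk]; apply: nU; exists k.
    apply: (@cvg_trans _ ((fun=> 0 : R) @ \oo)); last exact: cvg_cst.
    apply: near_eq_cvg; exists k.+1 => // n /= kn; rewrite indicE memNset// => -[j /= nj Fj].
    have kE : k = j by apply: (tF k j) => //; exists x.
    by move: nj; rewrite -kE leqNgt kn.
rewrite /coord_charge.
rewrite (_ : (fun n => _) = EFin \o (fun n => L (along i (\1_(\bigcup_k F k) : V -> R)) - L (along i (\1_(T n) : V -> R)))).
  apply: cvg_EFin; first exact: nearW.
  by have := cvgB (cvg_cst (L (along i (\1_(\bigcup_k F k) : V -> R)))) c; rewrite subr0; exact.
by apply/funext => n /=; rewrite (E n) addrK -sumEFin.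
Qed.

HB.instance Definition _ := isCharge.Build _ V R (coord_charge i) nu0 nufin nusigma.

(** L does not distinguish fields that agree almost everywhere, so the
    coordinate charge vanishes on null sets and has a Radon-Nikodym density. *)
Lemma coord_density : exists g : V -> R, lam.-integrable setT (EFin \o g) /\
  forall A, measurable A -> L (along i (\1_A : V -> R)) = \int[lam]_(x in Omega) (g x * \1_A x).
Proof.
have dom : coord_charge i `<< lam.
  apply/null_content_dominatesP => A mA A0; rewrite /coord_charge -[RHS]/((0 : R)%:E) -(dominated_functional0 p1 mO fO linL); congr EFin.
  apply: (dominated_functional_ae p1 mO fO linL Lsigma); [exact: LpV_along_indic|exact: LpV_0|].
  exists A; split => // x /= /not_implyP[_ h]; apply: contrapT => nA; apply: h.
  by rewrite /along indicE memNset// scale0r.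
pose nu : {charge set V -> \bar R} := coord_charge i.
pose h := Radon_Nikodym nu lam.
have hfin x : h x \is a fin_num by exact: Radon_Nikodym_fin_num.
have hint : lam.-integrable setT h by exact: Radon_Nikodym_integrable.
exists (fun x => fine (h x)); split.
  by rewrite (_ : EFin \o _ = h)//; apply/funext => x /=; rewrite fineK.
move=> A mA; have mAO : measurable (A `&` Omega) by exact: measurableI.
have -> : L (along i (\1_A : V -> R)) = L (along i (\1_(A `&` Omega) : V -> R)).
  apply: (dominated_functional_ae p1 mO fO linL Lsigma); [exact: LpV_along_indic|exact: LpV_along_indic|].
  apply: aeW => x Ox; rewrite /along !indicE; congr (_%:R *: _); congr nat_of_bool.
  by apply/idP/idP; rewrite !inE; [move=> ?|case].
have := @Radon_Nikodym_integral _ V R nu lam (A `&` Omega) dom mAO.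
rewrite -[nu _]/((L (along i (\1_(A `&` Omega) : V -> R)))%:E) -/h => E.
apply: EFin_inj; rewrite E setIC integral_mkcondr /Rintegral fineK.
  apply: eq_integral => x _; rewrite patchE indicE; case: ifP => _.
    by rewrite mulr1 fineK.
  by rewrite mulr0.
have := integrable_fin_num (measurableI _ _ mO mA) (integrableS measurableT (measurableI _ _ mO mA) (@subsetT _ _) hint).
rewrite integral_mkcondr; congr (_ \is a fin_num); apply: eq_integral => x _.
rewrite patchE indicE; case: ifP => _; by rewrite ?mulr1 ?fineK ?mulr0.
Qed.

End charge.

(** The number of integers among 1, ..., n that are at most y is the integer part
    of y for y <= n. *)
Lemma staircase (y : R) n : 0 <= y ->
  \sum_(k < n) (k.+1%:R <= y)%R%:R <= y /\
  (y <= n%:R -> y <= \sum_(k < n) ((k.+1%:R <= y)%R%:R : R) + 1).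
Proof.
move=> y0; elim: n => [|n [IH1 IH2]].
  by rewrite big_ord0 add0r; split => // h; rewrite (le_trans h).
have full m : m%:R <= y -> \sum_(k < m) ((k.+1%:R <= y)%R%:R : R) = m%:R.
  move=> my; rewrite (eq_bigr (fun=> 1)); first by rewrite sumr_const card_ord.
  by move=> k _; rewrite (_ : (_ <= y) = true)//; apply: le_trans my; rewrite ler_nat.
rewrite big_ord_recr /=; have [yn|yn] := leP n.+1%:R y.
  have yn' : n%:R <= y by apply: le_trans yn; rewrite ler_nat.
  rewrite (full n yn') -natrD addn1; split => // h; rewrite (le_trans h)//.
  by rewrite lerDl.
rewrite addr0; split => // _.
have [/IH2//|ny] := leP y n%:R.
by rewrite (full n (ltW ny)) natr1 ltW.
Qed.

(** Staircases with steps of height B / (n+1) approximate f uniformly, their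
    level sets are measurable, and both sides of the formula are continuous along
    this approximation. *)
(** Adding a constant makes f nonnegative. *)
Lemma coord_repr_ge0 i (g f : V -> R) (B : R) : lam.-integrable Omega (EFin \o g) ->
  (forall A, measurable A -> L (along i (\1_A : V -> R)) = \int[lam]_(x in Omega) (g x * \1_A x)) ->
  measurable_fun Omega f -> 0 < B -> (forall x, Omega x -> 0 <= f x <= B) ->
  L (along i f) = \int[lam]_(x in Omega) (g x * f x).
Proof.
move=> ig gA mf B0 fB.
pose c (n : nat) : R := B / n.+1%:R.
have c0 n : 0 < c n by rewrite divr_gt0.
(* f is at least (k+1) steps high on A n k *)
pose A n (k : nat) : set V := Omega `&` [set x | k.+1%:R <= f x / c n].
have mfc n : measurable_fun Omega (fun x => f x / c n) by apply: measurable_funM.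
have mA n k : measurable (A n k).
  have := @measurable_fun_le _ V R Omega (fun=> k.+1%:R) (fun x => f x / c n) mO (measurable_cst _) (mfc n).
  by [].
pose s_ n (m : nat) x : R := c n * \sum_(k < m) \1_(A n k) x.
have close n x : Omega x -> `|f x - s_ n n.+1 x| <= c n.
  move=> Ox; have /andP[f0 fb] := fB x Ox.
  have [|h1 h2] := @staircase (f x / c n) n.+1; first by rewrite divr_ge0// ltW.
  have le : f x / c n <= n.+1%:R.
    by rewrite ler_pdivrMr// /c mulrC divfK// pnatr_eq0.
  have {}h2 := h2 le.
  have E : \sum_(k < n.+1) \1_(A n k) x = \sum_(k < n.+1) ((k.+1%:R <= f x / c n)%R%:R : R).
    apply: eq_bigr => k _; rewrite indicE; congr (_%:R); congr nat_of_bool.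
    by apply/idP/idP; rewrite inE; [case|move=> ?].
  rewrite /s_ E; move: h1 h2; set S := \sum_(k < n.+1) _.
  rewrite ler_pdivlMr// ler_pdivrMr// => h1 h2.
  by rewrite ler_norml; apply/andP; split; lra.
have ms n m : measurable_fun Omega (s_ n m).
  apply: measurable_funM => //; apply: measurable_sum => k.
  by apply: measurable_funTS; exact: measurable_indic.
have bs n m x : `|s_ n m x| <= c n * m%:R.
  rewrite normrM (gtr0_norm (c0 n)) ler_wpM2l ?(ltW (c0 n))//.
  apply: (@le_trans _ _ (\sum_(k < m) 1)); last by rewrite sumr_const card_ord.
  rewrite (le_trans (ler_norm_sum _ _ _))// ler_sum// => k _.
  by rewrite indicE; case: (_ \in _); rewrite ?normr1 ?normr0.
have igs n m : lam.-integrable Omega (EFin \o (fun x => g x * s_ n m x)).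
  apply: (integrable_le mO (g := fun x => (c n * m%:R) * `|g x|)).
  - by apply: measurable_funM => //; exact: integrable_measurable ig.
  - exact: (integrableZl mO (c n * m%:R) (integrable_norm ig)).
  - by move=> x _; rewrite normrM mulrC ler_wpM2r.
have igA B' : measurable B' -> lam.-integrable Omega (EFin \o (fun x => g x * \1_B' x)).
  move=> mB; apply: (integrable_le mO (g := fun x => `|g x|)).
  - apply: measurable_funM; first exact: integrable_measurable ig.
    by apply: measurable_funTS; exact: measurable_indic.
  - exact: integrable_norm ig.
  - by move=> x _; rewrite normrM indicE; case: (_ \in _); rewrite ?normr1 ?normr0 ?mulr1 ?mulr0.
have Ds n m : Dp (along i (s_ n m)) by apply: (LpV_along (B := c n * m%:R)).
have Ls n m : L (along i (s_ n m)) = \int[lam]_(x in Omega) (g x * s_ n m x).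
  elim: m => [|m IH].
    have -> : s_ n 0%N = fun=> 0 by apply/funext => x; rewrite /s_ big_ord0 mulr0.
    rewrite (_ : along i _ = 0); last by apply/funext => x; rewrite /along scale0r.
    rewrite (dominated_functional0 p1 mO fO linL); under eq_Rintegral do rewrite mulr0.
    by rewrite Rintegral_cst// mul0r.
  have E : s_ n m.+1 = (fun x => c n * \1_(A n m) x + s_ n m x).
    by apply/funext => x; rewrite /s_ big_ord_recr /= mulrDr addrC.
  rewrite E dominated_functional_along ?IH ?gA//; [|exact: LpV_along_indic].
  rewrite -RintegralZl//; last exact: igA.
  rewrite -RintegralD//; last exact: (integrableZl mO (c n) (igA _ (mA n m))).
  by apply: eq_Rintegral => x _; ring.
have c_cvg : c @ \oo --> (0 : R).
  by rewrite -[X in _ --> X](mulr0 B); apply: cvgM; [exact: cvg_cst|exact: cvg_harmonic].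
have cB n : c n <= B by rewrite ler_pdivrMr// ler_peMr// ?(ltW B0)// ler1n.
have Df : Dp (along i f).
  by apply: (LpV_along (B := B)) => // x Ox; have /andP[f0 fb] := fB x Ox; rewrite ger0_norm.
have cd x : Omega x -> (fun n => f x - s_ n n.+1 x) @ \oo --> (0 : R).
  move=> Ox; apply/cvgr0Pnorm_le => e e0.
  move/cvgr0Pnorm_le : c_cvg => /(_ _ e0); apply: filterS => n.
  by rewrite (gtr0_norm (c0 n)); apply: le_trans; exact: close.
have lim1 : (fun n => L (along i (s_ n n.+1))) @ \oo --> L (along i f).
  have H : (fun n => L (along i (fun x => -1 * s_ n n.+1 x + f x))) @ \oo --> (0 : R).
    apply: (@order_continuous_along i _ B).
    - by move=> n; apply: measurable_funD => //; apply: measurable_funM.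
    - by move=> n x Ox; rewrite mulN1r addrC (le_trans (close n x Ox)).
    - by move=> x Ox; under eq_fun do rewrite mulN1r addrC; exact: cd.
  have E : (fun n => L (along i (s_ n n.+1))) =
      (fun n => L (along i f) - L (along i (fun x => -1 * s_ n n.+1 x + f x))).
    apply/funext => n; rewrite (dominated_functional_along (-1) (Ds n n.+1) Df).
    by rewrite mulN1r opprD opprK addrCA subrr addr0.
  by rewrite E -[X in _ --> X]subr0; apply: cvgB; [exact: cvg_cst|exact: H].
have lim2 : (fun n => \int[lam]_(x in Omega) (g x * s_ n n.+1 x)) @ \oo --> \int[lam]_(x in Omega) (g x * f x).
  have [||||_ h] := @Rintegral_dominated_cvg _ V R lam Omega mO (fun n x => g x * s_ n n.+1 x) (fun x => g x * f x) (fun x => (B + B) * `|g x|).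
  - by move=> n; apply: measurable_funM => //; exact: integrable_measurable ig.
  - move=> x Ox; apply: cvgM; first exact: cvg_cst.
    have E : (fun n => s_ n n.+1 x) = (fun n => f x - (f x - s_ n n.+1 x)).
      by apply/funext => n; rewrite opprB addrC subrK.
    by rewrite E -[X in _ --> X]subr0; apply: cvgB; [exact: cvg_cst|exact: cd].
  - exact: (integrableZl mO (B + B) (integrable_norm ig)).
  - move=> n x Ox; rewrite normrM mulrC ler_wpM2r//.
    have /andP[f0 fb] := fB x Ox; have := close n x Ox; have := cB n.
    rewrite !ler_norml => h1 /andP[h2 h3]; apply/andP; split; lra.
  - exact: h.
rewrite (funext (fun n => Ls n n.+1)) in lim1.
exact: (cvg_unique (@Rhausdorff R) lim1 lim2).
Qed.

Lemma coord_repr i (g f : V -> R) (B : R) : lam.-integrable Omega (EFin \o g) ->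
  (forall A, measurable A -> L (along i (\1_A : V -> R)) = \int[lam]_(x in Omega) (g x * \1_A x)) ->
  measurable_fun Omega f -> (forall x, Omega x -> `|f x| <= B) ->
  L (along i f) = \int[lam]_(x in Omega) (g x * f x).
Proof.
move=> ig gA mf fB; pose K := `|B| + 1.
have K0 : 0 < K by rewrite ltr_wpDl.
have fK x : Omega x -> `|f x| <= K.
  by move=> Ox; rewrite (le_trans (fB x Ox))// /K (le_trans (ler_norm B))// lerDl.
have mK : measurable_fun Omega (fun _ : V => K) by exact: measurable_cst.
have h1 : L (along i (fun x => f x + K)) = \int[lam]_(x in Omega) (g x * (f x + K)).
  apply: (coord_repr_ge0 (B := K + K)) => //; first exact: measurable_funD.
    by rewrite addr_gt0.
  move=> x Ox; have := fK x Ox; rewrite ler_norml => /andP[a b]; apply/andP; split; lra.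
have h2 : L (along i (fun=> K)) = \int[lam]_(x in Omega) (g x * K).
  by apply: (coord_repr_ge0 (B := K)) => // x _; rewrite ltW//=.
have D1 : Dp (along i (fun=> K)) by apply: (LpV_along (B := K)) => // x _; rewrite ger0_norm// ltW.
have D2 : Dp (along i (fun x => f x + K)).
  apply: (LpV_along (B := K + K)) => [|x Ox]; first exact: measurable_funD.
  by rewrite (le_trans (ler_normD _ _))// lerD// ?fK// ger0_norm// ltW.
have fE : along i f = along i (fun x => -1 * K + (f x + K)).
  by congr (along i _); apply/funext => x; ring.
have i1 : lam.-integrable Omega (EFin \o (fun x => g x * K)) := integrableZr mO K ig.
have i2 : lam.-integrable Omega (EFin \o (fun x => g x * f x)).
  apply: (integrable_le mO (g := fun x => K * `|g x|)).
  - by apply: measurable_funM => //; exact: integrable_measurable ig.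
  - exact: (integrableZl mO K (integrable_norm ig)).
  - by move=> x Ox; rewrite normrM mulrC ler_wpM2r// fK.
have split_int : \int[lam]_(x in Omega) (g x * (f x + K)) =
    \int[lam]_(x in Omega) (g x * f x) + \int[lam]_(x in Omega) (g x * K).
  by under eq_Rintegral do rewrite mulrDr; rewrite RintegralD.
by rewrite fE (dominated_functional_along (-1) D1 D2) h1 h2 split_int mulN1r addrC addrK.
Qed.

Lemma bounded_field_repr : exists s : V -> V,
  [/\ measurable_fun Omega s, (forall i, lam.-integrable Omega (EFin \o (fun x => s x ord0 i))) &
   forall (B : R) G, measurable_fun Omega G -> (forall x, Omega x -> enorm (G x) <= B) ->
     L G = \int[lam]_(x in Omega) dotv (s x) (G x)].
Proof.
have /choice[g hg] := coord_density.
have ig i : lam.-integrable Omega (EFin \o g i) by apply: integrableS (hg i).1.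
pose s x : V := \row_i g i x.
have sE i : (fun x => s x ord0 i) = g i by apply/funext => x; rewrite mxE.
exists s; split.
- by apply: measurable_fun_coords => // i; rewrite sE; exact: integrable_measurable (ig i).
- by move=> i; rewrite sE.
move=> B G mG GB.
have mGi i : measurable_fun Omega (fun x => G x ord0 i) by exact: measurable_coord.
have bGi i x : Omega x -> `|G x ord0 i| <= B.
  by move=> Ox; rewrite (le_trans (coord_le_enorm _ _))// GB.
have Di i : Dp (along i (fun x => G x ord0 i)) := LpV_along i (mGi i) (bGi i).
have igi i : lam.-integrable Omega (EFin \o (fun x => g i x * G x ord0 i)).
  apply: (integrable_le mO (g := fun x => B * `|g i x|)).
  - by apply: measurable_funM => //; exact: integrable_measurable (ig i).
  - exact: (integrableZl mO B (integrable_norm (ig i))).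
  - by move=> x Ox; rewrite normrM mulrC ler_wpM2r// bGi.
have sumE (r : seq 'I_d) : Dp (\sum_(i <- r) along i (fun x => G x ord0 i)) /\
  L (\sum_(i <- r) along i (fun x => G x ord0 i)) =
  \int[lam]_(x in Omega) (\sum_(i <- r) g i x * G x ord0 i) /\
  lam.-integrable Omega (EFin \o (fun x => \sum_(i <- r) g i x * G x ord0 i)).
  elim: r => [|i r [IH1 [IH2 IH3]]].
    rewrite !big_nil (dominated_functional0 p1 mO fO linL); split; first exact: LpV_0.
    under eq_Rintegral do rewrite big_nil; rewrite Rintegral_cst// mul0r; split => //.
    by under eq_fun do rewrite big_nil; exact: integrable_cst.
  rewrite !big_cons; split.
    by have := LpV_lin mO 1 (lt_trans ltr01 p1) (Di i) IH1; congr (LpV _ _ _); apply/funext => x; rewrite /= scale1r.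
  split.
    have := linL 1 (Di i) IH1; rewrite scale1r mul1r => ->.
    rewrite IH2 (coord_repr (ig i) (hg i).2 (mGi i) (bGi i)) -RintegralD//.
    by apply: eq_Rintegral => x _; rewrite big_cons.
  by under eq_fun do rewrite big_cons; exact: (integrableD mO (igi i) IH3).
have [_ [E _]] := sumE (index_enum _).
have GE : G = \sum_(i <- index_enum 'I_d) along i (fun x => G x ord0 i).
  apply/funext => x; rewrite fct_sumE; apply/rowP => j; rewrite summxE (bigD1 j)//= big1.
    by rewrite addr0 !mxE !eqxx mulr1.
  by move=> k kj; rewrite !mxE eqxx eq_sym (negbTE kj) mulr0.
rewrite [in LHS]GE E; apply: eq_Rintegral => x _.
by rewrite /dotv; apply: eq_bigr => i _; rewrite mxE.
Qed.

End bounded_fields.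

(** * The dual field *)

Section dual_field.
Variables (R : realType) (d : nat) (p mu : R) (Omega : set 'rV[R]_d).
Hypotheses (p1 : 1 < p) (mu0 : 0 < mu).
Hypotheses (mO : measurable Omega) (fO : (lebesgue_rV R d Omega < +oo)%E).
Local Notation V := 'rV[R]_d.
Local Notation lam := (lebesgue_rV R d).
Local Notation Dp := (LpV Omega p).
Local Notation q := (p / (p - 1)).
Implicit Types (F G s : V -> V).

Let p0 : 0 < p. Proof. exact: lt_trans p1. Qed.
Let pm1 : 0 < p - 1. Proof. by rewrite subr_gt0. Qed.
Let q0 : 0 < q. Proof. by rewrite divr_gt0. Qed.

Lemma measurable_slope s : measurable_fun Omega s -> measurable_fun Omega (fun x => slope p mu (s x)).
Proof.
move=> ms; apply: (measurableT_comp (measurable_powR _)).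
apply: measurable_funM => //; apply: measurable_maxr => //.
by apply: measurable_funB => //; exact: measurable_enorm.
Qed.

Lemma measurable_sconj s : measurable_fun Omega s -> measurable_fun Omega (fun x => sconj p mu (s x)).
Proof.
move=> ms; apply: measurable_funM => //.
by apply: (measurableT_comp (measurable_powR _)); exact: measurable_slope.
Qed.

Lemma measurable_maximizer s : measurable_fun Omega s -> measurable_fun Omega (fun x => maximizer p mu (s x)).
Proof.
move=> ms; apply: measurable_scalev => //.
rewrite [X in measurable_fun _ X](_ : _ = fun x => slope p mu (s x) * enorm (s x) `^ (-1)).
  apply: measurable_funM; first exact: measurable_slope.
  by apply: (measurableT_comp (measurable_powR _)); exact: measurable_enorm.
by apply/funext => x; rewrite powR_inv1 ?enorm_ge0.
Qed.

Lemma LpV_conj_integrable s G : LpV Omega q s -> Dp G ->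
  lam.-integrable Omega (EFin \o (fun x => dotv (s x) (G x))).
Proof.
move=> Ls DG; have [ms _] := Ls; have [mG _] := DG.
have is_ : lam.-integrable Omega (EFin \o (fun x => enorm (s x) `^ q)).
  by have := LpV_pow_integrable (conj_exponent_gt1 p1) mO Ls.
have iG := LpV_pow_integrable p1 mO DG.
apply: (integrable_le mO (g := fun x => q^-1 * enorm (s x) `^ q + p^-1 * enorm (G x) `^ p)).
- exact: measurable_dotv.
- exact: (integrableD mO (integrableZl mO q^-1 is_) (integrableZl mO p^-1 iG)).
move=> x _; apply: (le_trans (norm_dotv_le _ _)).
have := @conjugate_powR R (enorm (s x)) (enorm (G x)) q p (enorm_ge0 _) (enorm_ge0 _) q0 p0.
have -> : q^-1 + p^-1 = 1 by field; rewrite !gt_eqF.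
by move=> /(_ erefl); rewrite [X in _ <= X + _ -> _]mulrC [X in _ <= _ + X -> _]mulrC.
Qed.

Variables (L : (V -> V) -> R) (M : R).
Hypothesis linL : forall a F G, Dp F -> Dp G -> L (a *: F + G) = a * L F + L G.
Hypothesis Lsigma : forall G, Dp G -> L G <= M + sigma_int p mu Omega G.

Definition trunc (k : V -> R) (n : nat) (x : V) : R := (k x <= n%:R)%R%:R.

Lemma measurable_trunc k n : measurable_fun Omega k -> measurable_fun Omega (trunc k n).
Proof.
move=> mk; pose A : set V := Omega `&` [set x | k x <= n%:R].
have mA : measurable A.
  by have := @measurable_fun_le _ V R Omega k (fun=> n%:R) mO mk (measurable_cst _).
apply: (eq_measurable_fun (\1_A : V -> R)).
  move=> x; rewrite inE => Ox; rewrite indicE /trunc; congr (_%:R); congr nat_of_bool.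
  by apply/idP/idP; rewrite inE; [case|move=> ?].
by apply: measurable_funTS; exact: measurable_indic.
Qed.

Lemma trunc_bound k n x : 0 <= trunc k n x <= 1.
Proof. by rewrite /trunc; case: (k x <= _); rewrite ?lexx ?ler01. Qed.

Lemma trunc_eventually k x : \forall n \near \oo, trunc k n x = 1.
Proof.
exists (Num.bound `|k x|) => // n /= h; rewrite /trunc (_ : (_ <= _) = true)//.
apply: (le_trans (ler_norm _)); apply: ltW; apply: (lt_le_trans (archi_boundP (normr_ge0 _))).
by rewrite ler_nat.
Qed.

(** The field s is given by [bounded_field_repr].  The bound on L at the
    maximizer, truncated to where |s| <= n, is a bound for the integral of sigma#(s)
    over this set, and monotone convergence removes the truncation.  Then s is in
    L^q, so both sides of the representation are continuous along the truncations
    of an arbitrary G. *)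
Lemma dual_representation : exists s : V -> V,
  [/\ LpV Omega q s, (\int[lam]_(x in Omega) (sconj p mu (s x))%:E <= M%:E)%E &
   forall G, Dp G -> L G = \int[lam]_(x in Omega) dotv (s x) (G x)].
Proof.
have [s [ms is_ sE]] := bounded_field_repr p1 mu0 mO fO linL Lsigma.
exists s.
pose ns x := enorm (s x).
have mns : measurable_fun Omega ns by exact: measurable_enorm.
have msc := measurable_sconj ms.
have sc0 x : 0 <= sconj p mu (s x) by exact: sconj_ge0.
(* the pointwise maximizer is a bounded field where |s| <= n *)
have test n : (\int[lam]_(x in Omega) (sconj p mu (s x) * trunc ns n x)%:E <= M%:E)%E.
  pose B := (n%:R / mu) `^ (p - 1)^-1.
  pose G x : V := trunc ns n x *: maximizer p mu (s x).
  have mG : measurable_fun Omega G.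
    by apply: measurable_scalev => //; [exact: measurable_trunc|exact: measurable_maximizer].
  have GB x : Omega x -> enorm (G x) <= B.
    move=> _; rewrite enormZ /G /trunc; have [h|_] := leP (ns x) n%:R; last first.
      by rewrite normr0 mul0r powR_ge0.
    rewrite normr1 mul1r (le_trans (enorm_maximizer_le _ _ _))//.
    apply: ge0_ler_powR; rewrite ?nnegrE ?divr_ge0 ?excess_ge0 ?(ltW mu0) ?invr_ge0 ?(ltW pm1)//.
    by rewrite ler_pM2r ?invr_gt0// (le_trans (excess_le _)).
  have DG : Dp G by exact: (LpV_bounded p1 mO fO mG GB).
  have h := Lsigma DG; rewrite (sE B G mG GB) in h.
  have iS := sigma_integrable mu p1 mO fO DG.
  have pw x : Omega x -> sconj p mu (s x) * trunc ns n x = dotv (s x) (G x) - sigma p mu (G x).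
    move=> _; rewrite /G /trunc; case: (_ <= _); last first.
      by rewrite mulr0 scale0r (sigma0 _ _ p1) subr0 -(scale0r (0 : V)) dotvZr mul0r.
    by rewrite mulr1 scale1r (maximizerP p1 mu0) addrC addKr.
  have iD : lam.-integrable Omega (EFin \o (fun x => dotv (s x) (G x))).
    apply: (integrable_le mO (g := fun x => B * \sum_i `|s x ord0 i|)).
    - exact: measurable_dotv.
    - have isum (r : seq 'I_d) : lam.-integrable Omega (EFin \o (fun x => \sum_(i <- r) `|s x ord0 i|)).
        elim: r => [|i r IH]; first by under eq_fun do rewrite big_nil; exact: integrable_cst.
        by under eq_fun do rewrite big_cons; exact: (integrableD mO (integrable_norm (is_ i)) IH).
      exact: (integrableZl mO B (isum _)).
    - move=> x Ox; rewrite /dotv (le_trans (ler_norm_sum _ _ _))// mulr_sumr ler_sum// => i _.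
      by rewrite normrM mulrC ler_wpM2r// (le_trans (coord_le_enorm _ _))// GB.
  have iT : lam.-integrable Omega (EFin \o (fun x => sconj p mu (s x) * trunc ns n x)).
    have := integrableB mO iD iS; apply: eq_integrable => // x; rewrite inE => Ox /=.
    by rewrite pw.
  rewrite -(fineK (integrable_fin_num mO iT)) lee_fin.
  rewrite -[leLHS]/(\int[lam]_(x in Omega) (sconj p mu (s x) * trunc ns n x)).
  rewrite (_ : \int[lam]_(x in Omega) _ = \int[lam]_(x in Omega) (dotv (s x) (G x) - sigma p mu (G x))); last first.
    by apply: eq_Rintegral => x; rewrite inE => Ox; rewrite pw.
  by rewrite RintegralB// lerBlDr.
have Iconj : (\int[lam]_(x in Omega) (sconj p mu (s x))%:E <= M%:E)%E.
  pose g n x := (sconj p mu (s x) * trunc ns n x)%:E.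
  have mg n : measurable_fun Omega (g n).
    by apply/measurable_EFinP; apply: measurable_funM => //; exact: measurable_trunc.
  have g0 n x : Omega x -> (0 <= g n x)%E.
    by move=> _; rewrite lee_fin mulr_ge0//; have /andP[] := trunc_bound ns n x.
  have ndg x : Omega x -> {homo g ^~ x : n m / (n <= m)%N >-> (n <= m)%E}.
    move=> _ n m nm; rewrite lee_fin ler_wpM2l// /trunc ler_nat.
    have [h|//] := boolP (ns x <= n%:R).
    by rewrite (_ : ns x <= m%:R)// (le_trans h)// ler_nat.
  have c := @cvg_monotone_convergence _ V R lam Omega mO g mg g0 ndg.
  rewrite (eq_integral (fun x => limn (g ^~ x))).
    by apply: (cvge_to_le c); apply: nearW => n; exact: test.
  move=> x _; apply/esym/cvg_lim => //.
  apply: cvg_near_cst.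
  by apply: filterS (trunc_eventually ns x) => n hn; rewrite /g hn mulr1.
have Ls : LpV Omega q s.
  split => //; apply/(LpP mO _ q0); split => //.
  have [C C0 hC] := sconj_coercive d p1 mu0.
  have isc : lam.-integrable Omega (EFin \o (fun x => sconj p mu (s x))).
    apply/integrableP; split; first exact/measurable_EFinP.
    rewrite (eq_integral (fun x => (sconj p mu (s x))%:E)).
      exact: le_lt_trans Iconj (ltry _).
    by move=> x _; rewrite /= ger0_norm.
  apply: (integrable_le mO (g := fun x => C * (1 + sconj p mu (s x)))).
  - exact: measurable_abs_powR.
  - exact: (integrableZl mO C (integrableD mO (integrable_cst mO fO 1) isc)).
  - move=> x _; rewrite (ger0_norm (powR_ge0 _ _)) (ger0_norm (enorm_ge0 _)); exact: hC.
split => // G DG.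
have [mG _] := DG.
pose nG x := enorm (G x).
have mnG : measurable_fun Omega nG by exact: measurable_enorm.
pose Gn n x : V := trunc nG n x *: G x.
have mGn n : measurable_fun Omega (Gn n).
  by apply: measurable_scalev => //; exact: measurable_trunc.
have GnB n x : Omega x -> enorm (Gn n x) <= n%:R.
  move=> _; rewrite enormZ /trunc; have [h|h] := leP (nG x) n%:R; first by rewrite normr1 mul1r.
  by rewrite normr0 mul0r.
have DGn n : Dp (Gn n) := LpV_bounded p1 mO fO (mGn n) (GnB n).
have lim1 : (fun n => L (Gn n)) @ \oo --> L G.
  have H : (fun n => L (-1 *: Gn n + G)) @ \oo --> (0 : R).
    apply: (order_continuous p1 mu0 mO fO linL Lsigma (G := G)) => //.
    - by move=> n; case: (LpV_lin mO (-1) p0 (DGn n) DG).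
    - move=> n x _; rewrite -[(-1 *: Gn n + G) x]/(-1 *: (trunc nG n x *: G x) + G x) scalerA -{2}[G x]scale1r -scalerDl enormZ.
      rewrite ler_piMl ?enorm_ge0// /trunc; case: (nG x <= _).
        by rewrite mulr1 addNr normr0.
      by rewrite mulr0 add0r normr1.
    - move=> x _; apply: cvg_near_cst.
      apply: filterS (trunc_eventually nG x) => n hn.
      by rewrite -[(-1 *: Gn n + G) x]/(-1 *: (trunc nG n x *: G x) + G x) hn scale1r scaleN1r addNr enorm0.
  have E : (fun n => L (Gn n)) = (fun n => L G - L (-1 *: Gn n + G)).
    by apply/funext => n; rewrite (linL (-1) (DGn n) DG) mulN1r opprD opprK addrCA subrr addr0.
  by rewrite E -[X in _ --> X]subr0; apply: cvgB; [exact: cvg_cst|exact: H].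
have lim2 : (fun n => \int[lam]_(x in Omega) dotv (s x) (Gn n x)) @ \oo --> \int[lam]_(x in Omega) dotv (s x) (G x).
  have iD := LpV_conj_integrable Ls DG.
  have [||||_ h] := @Rintegral_dominated_cvg _ V R lam Omega mO (fun n x => dotv (s x) (Gn n x)) (fun x => dotv (s x) (G x)) (fun x => `|dotv (s x) (G x)|).
  - by move=> n; exact: measurable_dotv.
  - move=> x _; apply: cvg_near_cst.
    by apply: filterS (trunc_eventually nG x) => n hn; rewrite /Gn hn scale1r.
  - exact: integrable_norm iD.
  - move=> n x _; rewrite /Gn dotvZr normrM ler_piMl//.
    by have /andP[t0 t1] := trunc_bound nG n x; rewrite ger0_norm.
  - exact: h.
have E : (fun n => L (Gn n)) = (fun n => \int[lam]_(x in Omega) dotv (s x) (Gn n x)).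
  by apply/funext => n; exact: (sE _ _ (mGn n) (GnB n)).
by rewrite E in lim1; exact: (cvg_unique (@Rhausdorff R) lim1 lim2).
Qed.

End dual_field.

(** * Duality *)

Section duality.
Variables (R : realType) (d : nat) (p mu : R) (Omega : set 'rV[R]_d).
Hypotheses (d0 : (0 < d)%N) (p1 : 1 < p) (mu0 : 0 < mu).
Hypotheses (oO : open Omega) (bO : bounded_set Omega).
Local Notation V := 'rV[R]_d.
Local Notation lam := (lebesgue_rV R d).
Local Notation q := (p / (p - 1)).
Local Notation norm := (H10_norm Omega).
Implicit Types (F G s : V -> V) (f g phi : V -> R) (h u : (V -> R) -> R).

Let mO : measurable Omega. Proof. exact: open_measurable_rV. Qed.
Let fO : (lam Omega < +oo)%E. Proof. exact: bounded_set_lam. Qed.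
Let p1' : 1 <= p. Proof. exact: ltW. Qed.
Let p0 : 0 < p. Proof. exact: lt_trans p1. Qed.
Let two1 : (1 : R) <= 2. Proof. by rewrite ler1n. Qed.
Let two0 : (0 : R) < 2. Proof. by rewrite ltr0n. Qed.

Lemma tildeP h : XD Omega p h -> is_tilde Omega p h (tilde Omega p h).
Proof. by move=> [_ hf]; exact: (@getPex _ (is_tilde Omega p h) hf). Qed.

Lemma H10_norm_subrr f : H10 Omega f -> norm (fun x => f x - f x) = 0.
Proof.
move=> Hf; have Hz := H10_sub oO bO Hf Hf.
rewrite (H10_normE oO bO Hz) -[RHS]sqrtr0; congr Num.sqrt.
have := H10_inner_lin oO bO (-1) Hf Hf Hz; rewrite mulN1r addNr => E.
by rewrite -[RHS]E -sub_linE.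
Qed.

(** A constant sequence is admissible in the definition. *)
Lemma is_tilde_test h f phi : is_tilde Omega p h f -> test_fun Omega phi ->
  \int[lam]_(x in Omega) (f x * phi x) = h phi.
Proof.
move=> [_ ht] tphi; have Hphi := H10_test oO bO tphi.
have := ht phi Hphi (fun=> phi) (fun=> tphi).
rewrite H10_norm_subrr// => /(_ (cvg_cst _)) c.
exact: (cvg_unique (@Rhausdorff R) (cvg_cst _) c).
Qed.

Lemma W1p0_integrable f : W1p0 Omega p f -> lam.-integrable Omega (EFin \o f).
Proof. by move=> /(W1p0_elim oO bO p1')[Lf _ _ _]; exact: (Lp_integrable mO fO p1' Lf). Qed.

Lemma wgrad_ae f g : W1p0 Omega p f -> W1p0 Omega p g -> {ae lam, forall x, Omega x -> f x = g x} ->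
  {ae lam, forall x, Omega x -> wgrad Omega p f x = wgrad Omega p g x}.
Proof.
move=> Wf Wg fg; have [Lf LF wF _] := W1p0_elim oO bO p1' Wf; have [Lg LG wG _] := W1p0_elim oO bO p1' Wg.
apply: (wgrad_unique oO bO p1' p1' LF LG wF) => phi tphi i.
rewrite -wG//; have tp := test_fun_partial i tphi.
apply: (ae_eq_Rintegral oO).
- exact: (integrable_measurable (integrableM_test oO (W1p0_integrable Wf) tp)).
- exact: (integrable_measurable (integrableM_test oO (W1p0_integrable Wg) tp)).
- by apply: filterS fg => x fgx Ox; rewrite fgx.
Qed.

Lemma is_tilde_unique h f g : is_tilde Omega p h f -> is_tilde Omega p h g ->
  {ae lam, forall x, Omega x -> wgrad Omega p f x = wgrad Omega p g x}.
Proof.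
move=> tf tg; have [Wf _] := tf; have [Wg _] := tg.
apply: wgrad_ae => //; apply: (ae_eq_tests oO (W1p0_integrable Wf) (W1p0_integrable Wg)).
by move=> phi tphi; rewrite (is_tilde_test tf tphi) (is_tilde_test tg tphi).
Qed.

Definition tgrad h : V -> V := wgrad Omega p (tilde Omega p h).

Lemma tgrad_LpV h : XD Omega p h -> LpV Omega p (tgrad h).
Proof. by move=> /tildeP[Wf _]; have [_ LF _ _] := W1p0_elim oO bO p1' Wf. Qed.

Lemma XD_intro h f : Hm1 Omega h -> is_tilde Omega p h f ->
  XD Omega p h /\ {ae lam, forall x, Omega x -> tgrad h x = wgrad Omega p f x}.
Proof.
move=> Hh tf; have X : XD Omega p h by split => //; exists f.
by split => //; exact: is_tilde_unique (tildeP X) tf.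
Qed.

Lemma XD_lin a h h' : XD Omega p h -> XD Omega p h' ->
  XD Omega p (fun g => a * h g + h' g) /\
  {ae lam, forall x, Omega x -> tgrad (fun g => a * h g + h' g) x = a *: tgrad h x + tgrad h' x}.
Proof.
move=> Xh Xh'; have [[lh [C hC]] _] := Xh; have [[lh' [C' hC']] _] := Xh'.
have [Wf tf] := tildeP Xh; have [Wf' tf'] := tildeP Xh'.
set f := tilde Omega p h in Wf tf *; set f' := tilde Omega p h' in Wf' tf' *.
have [Wff ae] := wgrad_lin oO bO a p1' Wf Wf'.
have Hh : Hm1 Omega (fun g => a * h g + h' g).
  split; first by move=> b g k Hg Hk; rewrite lh// lh'//; ring.
  exists (`|a| * C + C') => g Hg; rewrite (le_trans (ler_normD _ _))// normrM mulrDl -mulrA.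
  by rewrite lerD ?hC'// ler_wpM2l ?hC.
have tt : is_tilde Omega p (fun g => a * h g + h' g) (fun x => a * f x + f' x).
  split => // phi Hphi phin tphin c.
  have c1 := tf phi Hphi phin tphin c; have c2 := tf' phi Hphi phin tphin c.
  have E : (fun n => \int[lam]_(x in Omega) ((a * f x + f' x) * phin n x)) =
    (fun n => a * \int[lam]_(x in Omega) (f x * phin n x) + \int[lam]_(x in Omega) (f' x * phin n x)).
    apply/funext => n; under eq_Rintegral do rewrite mulrDl -mulrA.
    have i1 := integrableM_test oO (W1p0_integrable Wf) (tphin n).
    have i2 := integrableM_test oO (W1p0_integrable Wf') (tphin n).
    rewrite (RintegralD mO (integrableZl mO a i1) i2).
    by rewrite (RintegralZl a mO i1).
  by rewrite E; apply: cvgD => //; apply: cvgM => //; exact: cvg_cst.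
have [X ae'] := XD_intro Hh tt; split; first exact: X.
by apply: filterS2 ae ae' => x e1 e2 Ox; rewrite e2// e1.
Qed.

Definition test_functional phi : (V -> R) -> R := fun psi => \int[lam]_(x in Omega) (phi x * psi x).

Lemma H10_Lp f : H10 Omega f -> Lp Omega 2 f.
Proof. by move=> /(W1p0_elim oO bO two1)[]. Qed.

Lemma Hm1_test_functional phi : test_fun Omega phi -> Hm1 Omega (test_functional phi).
Proof.
move=> tphi; have Lphi := test_fun_Lp oO bO two0 tphi.
split.
  move=> a f g /H10_Lp Lf /H10_Lp Lg; rewrite /test_functional.
  have i1 := Lp2_mul oO Lphi Lf; have i2 := Lp2_mul oO Lphi Lg.
  rewrite -RintegralZl// -RintegralD//; last exact: (integrableZl mO a i1).
  by apply: eq_Rintegral => x _; ring.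
have [C C0 hC] := poincare d0 oO bO.
exists (Num.sqrt (Lp_pow Omega 2 phi * C)) => f Hf.
have cs := L2_cauchy_schwarz oO Lphi (H10_Lp Hf).
rewrite (H10_normE oO bO Hf) -sqrtrM ?mulr_ge0 ?Lp_pow_ge0// -sqrtr_sqr ler_wsqrtr//.
by rewrite (le_trans cs)// -mulrA ler_wpM2l ?Lp_pow_ge0// hC.
Qed.

(** The function h~ of psi |-> int phi psi is phi itself.  These functionals are
    how the condition on X_D determines the divergence of s. *)
Lemma XD_test phi : test_fun Omega phi ->
  XD Omega p (test_functional phi) /\
  {ae lam, forall x, Omega x -> tgrad (test_functional phi) x = grad phi x}.
Proof.
move=> tphi; have Hh := Hm1_test_functional tphi.
have [Wphi ae] := test_fun_W1p0 oO bO p1' tphi.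
have tt : is_tilde Omega p (test_functional phi) phi.
  by split => // psi Hpsi psin tpsin c; exact: (Hm1_cvg oO bO Hh Hpsi tpsin c).
have [X ae'] := XD_intro Hh tt; split; first exact: X.
by apply: filterS2 ae ae' => x e1 e2 Ox; rewrite e2// e1.
Qed.

Lemma FD_XD h : XD Omega p h -> FD p mu Omega h = (sigma_int p mu Omega (tgrad h))%:E.
Proof.
move=> X; rewrite /FD; case: asboolP => // _.
have := integrable_fin_num mO (sigma_integrable mu p1 mO fO (tgrad_LpV X)).
by move=> /fineK <-.
Qed.

Lemma FD_notXD h : ~ XD Omega p h -> FD p mu Omega h = +oo%E.
Proof. by move=> X; rewrite /FD; case: asboolP. Qed.

Lemma sigma_int_ae F G : LpV Omega p F -> LpV Omega p G -> {ae lam, forall x, Omega x -> F x = G x} ->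
  sigma_int p mu Omega F = sigma_int p mu Omega G.
Proof.
move=> [mF _] [mG _] FG; apply: (ae_eq_Rintegral oO); try exact: measurable_sigma.
by apply: filterS FG => x FGx Ox; rewrite FGx.
Qed.

Lemma sigma_conj_intE s : sigma_conj_int p mu Omega s = (\int[lam]_(x in Omega) (sconj p mu (s x))%:E)%E.
Proof. by apply: eq_integral => x _; rewrite sigma_conjE. Qed.

Lemma sconj_integrable s : LpV Omega q s -> lam.-integrable Omega (EFin \o (fun x => sconj p mu (s x))).
Proof.
move=> Ls; have [ms _] := Ls.
have isq := LpV_pow_integrable (conj_exponent_gt1 p1) mO Ls.
apply: (integrable_le mO (g := fun x => mu * (1 - p^-1) * mu^-1 `^ q * enorm (s x) `^ q)).
- exact: measurable_sconj.
- exact: (integrableZl mO _ isq).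
- by move=> x _; rewrite ger0_norm ?sconj_ge0//; exact: sconj_le.
Qed.

Variable u : (V -> R) -> R.
Hypothesis Hu : Hm1 Omega u.
Local Notation w := (inv_mlapD Omega u).
Local Notation Y := (YD p Omega (fun f => - u f)).

(** Integrate [young_sigma] along the gradient of h~. *)
Lemma weak_duality s : Y s -> (FD_conj p mu Omega u <= sigma_conj_int p mu Omega s)%E.
Proof.
move=> [Ls _ hs]; have ic := sconj_integrable Ls.
apply: ge_ereal_sup => _ [h Hh <-].
have [X|X] := pselect (XD Omega p h); last by rewrite (FD_notXD X) leNye.
have LG := tgrad_LpV X.
have e : h w = \int[lam]_(x in Omega) dotv (s x) (tgrad h x).
  have := hs h X; rewrite (Hm1_inv_opp d0 oO bO Hu Hh) -/(tgrad h) => /eqP.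
  by rewrite addrC subr_eq0 => /eqP.
rewrite (FD_XD X) sigma_conj_intE -EFinB -(fineK (integrable_fin_num mO ic)) lee_fin.
rewrite /Hm1_inner e lerBlDl.
have iS := sigma_integrable mu p1 mO fO LG.
rewrite -[fine _]/(\int[lam]_(x in Omega) sconj p mu (s x)) /sigma_int -RintegralD//.
apply: (le_Rintegral mO).
- exact: (LpV_conj_integrable p1 mO Ls LG).
- exact: (integrableD mO iS ic).
- by move=> x _; exact: young_sigma.
Qed.

(** Extend grad h~ |-> h(w) below M + int sigma and represent the extension by
    a field s. *)
Lemma strong_duality : (FD_conj p mu Omega u < +oo)%E ->
  exists2 s, Y s & (sigma_conj_int p mu Omega s <= FD_conj p mu Omega u)%E.
Proof.
move=> Foo.
have ub h : XD Omega p h -> ((h w)%:E - (sigma_int p mu Omega (tgrad h))%:E <= FD_conj p mu Omega u)%E.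
  move=> X; have [Hh _] := X; rewrite -(FD_XD X); apply: ereal_sup_ubound.
  by exists h.
(* the zero functional shows that the supremum is not -oo *)
have t0 := @test_fun_cst0 R d Omega.
have [X0 ae0] := XD_test t0.
have h0 : test_functional (fun=> 0) w = 0.
  by rewrite /test_functional; under eq_Rintegral do rewrite mul0r; rewrite Rintegral_cst// mul0r.
have grad0 x : grad (fun _ : V => 0 : R) x = 0.
  by apply/rowP => i; rewrite !mxE /partial derive_cst.
have Ffin : FD_conj p mu Omega u \is a fin_num.
  rewrite fin_numE -ltey Foo andbT -ltNye; apply: lt_le_trans (ub _ X0).
  by rewrite -EFinB ltNyr.
pose M := fine (FD_conj p mu Omega u).
have ubM h : XD Omega p h -> h w <= M + sigma_int p mu Omega (tgrad h).
  by move=> /ub; rewrite -(fineK Ffin) -EFinB lee_fin lerBlDr.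
(* the graph of grad h~ |-> h(w), saturated under equality almost everywhere, as
   tgrad is linear only up to null sets *)
pose E : set ((V -> V) * R) := [set z | exists h, [/\ XD Omega p h, LpV Omega p z.1,
  {ae lam, forall x, Omega x -> z.1 x = tgrad h x} & z.2 = h w]].
have gE : @linear_graph R (V -> V) (LpV Omega p) (fun G => M + sigma_int p mu Omega G) E.
  split.
  - exists (test_functional (fun=> 0)); split => //=; first exact: LpV_0.
    by apply: filterS ae0 => x e Ox; rewrite e// grad0.
  - move=> a F G r r' [h [Xh DF aeF /= ->]] [h' [Xh' DG aeG /= ->]].
    have [X ae] := XD_lin a Xh Xh'.
    exists (fun g => a * h g + h' g); split; [exact: X|exact: (LpV_lin mO a p0 DF DG)| |by []].
    apply: filterS3 aeF aeG ae => x e1 e2 e3 Ox.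
    by rewrite (e3 Ox) -(e1 Ox) -(e2 Ox).
  - move=> F r [h [Xh DF aeF /= ->]]; split => //.
    by rewrite (sigma_int_ae DF (tgrad_LpV Xh) aeF) ubM.
have linD a (F G : V -> V) : LpV Omega p F -> LpV Omega p G -> LpV Omega p (a *: F + G).
  by move=> DF DG; exact: (LpV_lin mO a p0 DF DG).
have convP t (F G : V -> V) : LpV Omega p F -> LpV Omega p G -> 0 <= t -> t <= 1 ->
    M + sigma_int p mu Omega (t *: F + (1 - t) *: G) <= t * (M + sigma_int p mu Omega F) + (1 - t) * (M + sigma_int p mu Omega G).
  move=> DF DG t0' t1; have := convex_sigma_int p1 mu0 mO fO DF DG t0' t1.
  move: (sigma_int p mu Omega _) (sigma_int p mu Omega F) (sigma_int p mu Omega G) => x y z hxyz; lra.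
have [L [linL Lsigma LE]] := hahn_banach_convex linD convP gE.
have [s [Ls Is sE]] := dual_representation p1 mu0 mO fO linL Lsigma.
exists s; last by rewrite sigma_conj_intE -(fineK Ffin).
have ELtest phi : test_fun Omega phi -> L (grad phi) = test_functional phi w.
  move=> tphi; have [X ae] := XD_test tphi; apply: LE.
  exists (test_functional phi); split; [exact: X|exact: (test_fun_LpV oO bO p0 tphi)| |by []].
  by apply: filterS ae => x e Ox; rewrite e.
split => //.
- move=> phi tphi; have DG := test_fun_LpV oO bO p0 tphi.
  rewrite -(sE _ DG) (ELtest _ tphi).
  have := Hm1_inv_opp d0 oO bO Hu (Hm1_test_functional tphi).
  rewrite /test_functional => e; under [in RHS]eq_Rintegral do rewrite mulrC.
  by rewrite e opprK.
- move=> h X; have [Hh _] := X; rewrite (Hm1_inv_opp d0 oO bO Hu Hh).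
  rewrite -/(tgrad h) -(sE _ (tgrad_LpV X)).
  have -> : L (tgrad h) = h w.
    by apply: LE; exists h; split; [exact: X|exact: tgrad_LpV|exact: aeW|by []].
  by rewrite addNr.
Qed.

End duality.

Theorem lemma2p14 (R : realType) (d : nat) (p mu : R) (Omega : set 'rV[R]_d)
    (hd : (0 < d)%N) (hp : 1 < p) (hmu : 0 < mu)
    (hopen : open Omega) (hbounded : bounded_set Omega)
    (u : ('rV[R]_d -> R) -> R) (hu : Hm1 Omega u) :
  (YD p Omega (fun f => - u f) !=set0 ->
     is_min (YD p Omega (fun f => - u f)) (sigma_conj_int p mu Omega)
            (FD_conj p mu Omega u)) /\
  (YD p Omega (fun f => - u f) = set0 -> FD_conj p mu Omega u = +oo%E).
Proof.
have weak s := weak_duality hd hp hmu hopen hbounded hu (s := s).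
have strong := strong_duality hd hp hmu hopen hbounded hu.
split => [[s0 Ys0]|Y0].
  split => //.
  have [Ls0 _ _] := Ys0.
  have mO : measurable Omega by exact: open_measurable_rV.
  have ic := sconj_integrable hp hmu hopen Ls0.
  have Foo : (FD_conj p mu Omega u < +oo)%E.
    apply: le_lt_trans (weak s0 Ys0) _; rewrite (sigma_conj_intE Omega hp hmu).
    exact: integrable_lty ic.
  have [s Ys le] := strong Foo; exists s => //.
  by apply/eqP; rewrite eq_le le weak.
apply/eqP; rewrite -leye_eq leNgt; apply/negP => Foo.
by have [s Ys _] := strong Foo; rewrite Y0 in Ys.
Qed.
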